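(* There is an algorithm running in time $n^{\mathcal{O}(1)}$ that, given an $n$-vertex $P_6$-free graph $G$ with an integer weight (possibly negative) on every vertex, either finds an efficient dominating set of $G$ of maximum total weight, or correctly determines that $G$ has no efficient dominating set.
   Context: All graphs are finite, simple and undirected. $P_k$ denotes the path on $k$ vertices; a graph is $P_k$-free if it contains no induced subgraph isomorphic to $P_k$. A vertex dominates itself and all of its neighbours. An efficient dominating set of $G$ is a set $S\subseteq V(G)$ such that every vertex of $G$ is dominated by exactly one vertex of $S$ (equivalently, every vertex $v$ satisfies $|N[v]\cap S|=1$, where $N[v]$ is the closed neighbourhood). The weight of a set is the sum of the weights of its vertices. *)

(* Defs.v *)
From HB Require Import structures.
From mathcomp Require Import all_boot all_order all_algebra.
Set Implicit Arguments. Unset Strict Implicit. Unset Printing Implicit Defensive.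
Import Order.TTheory GRing.Theory Num.Theory.

Definition simple_graph (n : nat) (e : rel 'I_n) : Prop :=
  symmetric e /\ irreflexive e.

Definition has_induced_path (n k : nat) (e : rel 'I_n) : Prop :=
  exists f : 'I_k -> 'I_n, injective f /\
    forall i j : 'I_k, e (f i) (f j) = ((i.+1 == j) || (j.+1 == i)).

Definition P_free (k n : nat) (e : rel 'I_n) : Prop := ~ has_induced_path k e.

Definition closed_nbhd (n : nat) (e : rel 'I_n) (v : 'I_n) : {set 'I_n} :=
  [set u | (u == v) || e v u].

Definition efficient_dominating (n : nat) (e : rel 'I_n) (S : {set 'I_n}) : Prop :=
  forall v : 'I_n, #|closed_nbhd e v :&: S| = 1%N.

Definition set_weight (n : nat) (w : 'I_n -> int) (S : {set 'I_n}) : int :=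
  (\sum_(v in S) w v)%R.

(* Model of computation: a word RAM with unit-cost integer addition and
   subtraction, indirect addressing and conditional jumps.  A program is
   a finite list of instructions (independent of the input).            *)

Inductive instr : Type :=
| IConst of nat & int
| IAdd   of nat & nat & nat
| ISub   of nat & nat & nat
| ILoad  of nat & nat
| IStore of nat & nat
| IJz    of nat & nat
| IJneg  of nat & nat
| IHalt.

Record config := Config { pc : nat; regs : nat -> int }.

Definition addr (z : int) : nat := match z with Posz k => k | Negz _ => 0%N end.

Definition upd (m : nat -> int) (r : nat) (z : int) : nat -> int :=
  fun i => if i == r then z else m i.

(* one step; None when the machine has halted (IHalt, or pc outside the program) *)
Definition step (prog : seq instr) (c : config) : option config :=
  let m := regs c in
  let p := pc c in
  match nth IHalt prog p with
  | IConst r z => Some (Config p.+1 (upd m r z))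
  | IAdd r a b => Some (Config p.+1 (upd m r (m a + m b)%R))
  | ISub r a b => Some (Config p.+1 (upd m r (m a - m b)%R))
  | ILoad r a => Some (Config p.+1 (upd m r (m (addr (m a)))))
  | IStore a r => Some (Config p.+1 (upd m (addr (m a)) (m r)))
  | IJz r l => Some (Config (if m r == 0%R then l else p.+1) m)
  | IJneg r l => Some (Config (if (m r < 0)%R then l else p.+1) m)
  | IHalt => None
  end.

Definition halted (prog : seq instr) (c : config) : bool :=
  if step prog c is None then true else false.

Fixpoint exec (prog : seq instr) (fuel : nat) (c : config) : config :=
  match fuel with
  | 0 => c
  | f.+1 => match step prog c with None => c | Some c' => exec prog f c' end
  end.

(* Input encoding: R[0] = n; R[1 + a*n + b] = 1 if ab is an edge, else 0
   (for a, b < n); R[1 + n*n + a] = w(a) (for a < n); all other registers 0. *)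
Definition encode_input (n : nat) (e : rel 'I_n) (w : 'I_n -> int) : nat -> int :=
  fun i =>
    if i == 0%N then (n%:Z)%R else
    let j := i.-1 in
    if (j < n * n)%N then
      match @insub _ (fun x => x < n)%N 'I_n (j %/ n), @insub _ (fun x => x < n)%N 'I_n (j %% n) with
      | Some a, Some b => ((e a b : nat)%:Z)%R
      | _, _ => 0%R
      end
    else if (j < n * n + n)%N then
      match @insub _ (fun x => x < n)%N 'I_n (j - n * n) with
      | Some a => w a
      | None => 0%R
      end
    else 0%R.

Definition init_config (n : nat) (e : rel 'I_n) (w : 'I_n -> int) : config :=
  Config 0 (encode_input e w).

(* Output decoding: R[0] = 0 means "no efficient dominating set";
   otherwise the output set is { v | R[1 + v] <> 0 }. *)
Definition output_set (n : nat) (m : nat -> int) : {set 'I_n} :=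
  [set v : 'I_n | m (nat_of_ord v).+1 != 0%R].

(* Main.v *)
(* An efficient dominating set is a set D of candidates A (initially all vertices) that hits N[x] exactly once for every
   constraint x in X (initially all vertices). If N[x] :&: A is contained in N[y] :&: A for constraints x, y, then no
   candidate in N[y] outside N[x] can be in D; deleting such candidates exhaustively makes every inclusion between traces
   N[x] :&: A an equality. The components of the hypergraph of traces can then be treated separately. In each of them the
   algorithm guesses one vertex u of D, deletes the candidates that share a constraint with u, and recurses.

   For P6-free graphs four levels of this recursion are enough. First v is guessed, and all other candidates are at
   distance at least 3 from v. Let Z be the set of these vertices. The components of G[Z] met by a trace form a laminar
   family, so some constraint b meets every component in question. After its dominator is guessed, the candidates induce a
   disjoint union of cliques, because a path v - a - b extends into a component of G[Z] by at most two vertices. Among the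
   constraints meeting all these cliques, a cyclic argument then provides a vertex u of D such that fixing u leaves no
   constraint that meets two cliques. At the last level each component is a single clique, all of whose vertices are
   equivalent up to weight.

   The RAM program is compiled from a language whose only loops are bounded loops over the n vertices, so that the
   polynomial running time follows from the syntax alone. *)
Require Import Defs.
From HB Require Import structures.
From mathcomp Require Import all_boot all_order all_algebra.
From mathcomp Require Import zify.
Import Order.TTheory GRing.Theory Num.Theory.
Set Implicit Arguments.
Unset Strict Implicit.
Unset Printing Implicit Defensive.

(** * Candidates and constraints *)

(** At level 0 the candidate set itself is tested, so a set that is returned with a true flag is
    always a solution. P6-freeness enters through completeness. Since all guesses in a component are
    tried and the heaviest valid result is kept, it suffices that every solution D contains, in each
    component, some vertex that is a good guess. This vertex may depend on D, which is why D occurs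
    in the structural lemmas although the algorithm does not know it, and why the signs of the
    weights do not matter. The deletion rule is reapplied at every level. Its effect is used
    backwards: if a constraint y sees a candidate that x does not see, then x sees one that y does
    not see. Such private candidates prolong paths until they are induced paths on six vertices.
    Every vertex with a candidate in its closed neighbourhood stays a constraint, so candidates can
    play x or y themselves. On the machine, the obstacle is that the input starts at register 1 and
    leaves no low register free. There is no multiplication either, so addresses arise by repeated
    addition. *)

Lemma iter_deflation_fix (T : finType) (f : {set T} -> {set T}) (A : {set T}) k :
  (forall B, f B \subset B) -> #|A| <= k -> f (iter k f A) = iter k f A.
Proof.
move=> fS; elim: k A => [|k IHk] A leAk.
  have -> : A = set0 by apply/cards0_eq/eqP; rewrite -leqn0.
  by apply/eqP; rewrite -subset0; exact: fS.
rewrite iterSr; have [fA|nA] := eqVneq (f A) A.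
  by rewrite fA iter_fix.
apply: IHk; rewrite -ltnS; apply: leq_trans leAk.
by apply/proper_card; rewrite properEneq nA fS.
Qed.

(** Complementation turns an inflationary map into a deflationary one. *)
Lemma iter_inflation_fix (T : finType) (f : {set T} -> {set T}) (A : {set T}) :
  (forall B : {set T}, B \subset f B) -> f (iter #|T| f A) = iter #|T| f A.
Proof.
move=> fS; pose g (B : {set T}) := ~: f (~: B).
have iterg k : iter k f A = ~: iter k g (~: A).
  by elim: k => [|k IHk] ; [rewrite setCK|rewrite 2!iterS [g (iter _ _ _)]/g setCK -IHk].
have := @iter_deflation_fix T g (~: A) #|T|; rewrite iterg => H.
rewrite -[LHS]setCK -/(g _) H //; last exact: max_card.
by move=> B; rewrite /g -setCS setCK.
Qed.

Section Instances.
Variables (n : nat) (e : rel 'I_n).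
Hypotheses (e_sym : symmetric e) (e_irr : irreflexive e).
Implicit Types (A B D P S X Y Z : {set 'I_n}) (a b c d u v x y z : 'I_n).

Definition cn x a := (a == x) || e x a.

Lemma cnC x a : cn x a = cn a x.
Proof. by rewrite /cn eq_sym e_sym. Qed.

Lemma cnn x : cn x x. Proof. by rewrite /cn eqxx. Qed.

Lemma edge_cn x a : e x a -> cn x a. Proof. by rewrite /cn orbC => ->. Qed.

Lemma cn_edge x a : cn x a -> a != x -> e x a.
Proof. by case/orP=> [->|]. Qed.

Lemma ncn_edge x a : ~~ cn x a -> ~~ e x a. Proof. by case/norP. Qed.

Lemma edgeN x a : e x a -> x != a.
Proof. by move=> exa; apply/eqP => xa; rewrite xa e_irr in exa. Qed.

Lemma in_closed_nbhd x a : (a \in closed_nbhd e x) = cn x a.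
Proof. by rewrite inE. Qed.

(** A Boolean form built from quantifiers over vertices, which the expression language below can
    evaluate literally. *)
Definition hit x D :=
  [exists a, (a \in D) && cn x a] &&
  [forall a, forall b, [&& a \in D, b \in D, cn x a & cn x b] ==> (a == b)].

Lemma hitP x D : reflect (#|closed_nbhd e x :&: D| = 1) (hit x D).
Proof.
apply: (iffP andP) => [[/existsP[a /andP[aD xa]] /forallP uniqD]|/eqP/cards1P[a Da]].
  apply/eqP/cards1P; exists a; apply/setP=> b; rewrite !inE -/(cn x b).
  apply/andP/eqP => [[xb bD]|->]; last by [].
  by have /forallP/(_ b)/implyP := uniqD a; rewrite aD bD xa xb => /(_ isT)/eqP.
have inD b : (b \in D) && cn x b = (b == a).
  by rewrite -in_closed_nbhd andbC -in_setI Da inE.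
split; first by apply/existsP; exists a; rewrite inD.
apply/forallP=> b; apply/forallP=> c; apply/implyP => /and4P[bD cD xb xc].
have /eqP-> : b == a by rewrite -inD bD xb.
by have /eqP-> : c == a by rewrite -inD cD xc.
Qed.

Lemma hit_ex x D : hit x D -> exists2 d, d \in D & cn x d.
Proof. by case/andP=> /existsP[d /andP[]]; exists d. Qed.

Lemma hit_uniq x D a b :
  hit x D -> a \in D -> b \in D -> cn x a -> cn x b -> a = b.
Proof.
case/andP=> _ /forallP/(_ a)/forallP/(_ b)/implyP H aD bD xa xb.
by apply/eqP/H/and4P.
Qed.

Lemma hit_intro x D d :
  d \in D -> cn x d -> (forall a, a \in D -> cn x a -> a = d) -> hit x D.
Proof.
move=> dD xd H; apply/andP; split; first by apply/existsP; exists d; rewrite dD.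
apply/forallP=> b; apply/forallP=> c; apply/implyP => /and4P[bD cD xb xc].
by rewrite (H b) // (H c).
Qed.

Lemma eq_hit x D D' :
  (forall a, cn x a -> (a \in D) = (a \in D')) -> hit x D = hit x D'.
Proof.
move=> DD'; apply/hitP/hitP => <-; apply: eq_card => a; rewrite !inE -/(cn x a);
  by case xa: (cn x a) => //=; rewrite DD'.
Qed.

Definition sol A X D := D \subset A /\ forall x, x \in X -> hit x D.

Definition bad X A a :=
  [exists x, exists y, [&& x \in X, y \in X, cn y a, ~~ cn x a &
     [forall b, (b \in A) && cn x b ==> cn y b]]].

Definition prune X A := [set a in A | ~~ bad X A a].

(** [n] rounds reach a fixed point, because a round that changes the set removes at least one
    vertex. *)
Definition cl X A := iter n (prune X) A.

Definition saturated A X := forall x y, x \in X -> y \in X ->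
  (forall b, b \in A -> cn x b -> cn y b) ->
  forall a, a \in A -> cn y a -> cn x a.

Lemma prune_sub X A : prune X A \subset A.
Proof. by apply/subsetP=> a; rewrite inE => /andP[]. Qed.

Lemma cl_sub X A : cl X A \subset A.
Proof.
suff H k : iter k (prune X) A \subset A by exact: H.
by elim: k => //= k; exact: subset_trans (prune_sub _ _).
Qed.

Lemma cl_saturated X A : saturated (cl X A) X.
Proof.
have fixA : prune X (cl X A) = cl X A.
  apply: iter_deflation_fix; first exact: prune_sub.
  by rewrite -[leqRHS]card_ord; exact: max_card.
move=> x y xX yX xy a aA ya; move: (aA); rewrite -{1}fixA inE => /andP[_].
apply: contraNT => nxa; apply/existsP; exists x; apply/existsP; exists y.
rewrite xX yX ya nxa /=; apply/forallP=> b; apply/implyP=> /andP[].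
exact: xy.
Qed.

(* The vertex of D that dominates x also dominates y, so no other candidate dominating y is in D. *)
Lemma sol_prune A X D : sol A X D -> sol (prune X A) X D.
Proof.
case=> DA hD; split=> //; apply/subsetP=> a aD; rewrite inE (subsetP DA) //=.
apply/negP=> /existsP[x /existsP[y /and5P[xX yX ya nxa /forallP xy]]].
have [d dD xd] := hit_ex (hD x xX).
have yd : cn y d by move: (xy d); rewrite (subsetP DA) // xd.
by rewrite (hit_uniq (hD y yX) aD dD ya yd) xd in nxa.
Qed.

Lemma sol_cl A X D : sol A X D -> sol (cl X A) X D.
Proof.
move=> solD; suff H k : sol (iter k (prune X) A) X D by exact: H.
by elim: k => //= k; exact: sol_prune.
Qed.

Definition linked A X a b :=
  [&& a \in A, b \in A & [exists x, [&& x \in X, cn x a & cn x b]]].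

Lemma linkedI A X a b x :
  a \in A -> b \in A -> x \in X -> cn x a -> cn x b -> linked A X a b.
Proof.
by move=> aA bA xX xa xb; rewrite /linked aA bA; apply/existsP; exists x; rewrite xX xa.
Qed.

Lemma linkedE A X a b : linked A X a b ->
  [/\ a \in A, b \in A & exists x, [/\ x \in X, cn x a & cn x b]].
Proof. by case/and3P=> aA bA /existsP[x /and3P[xX xa xb]]; split=> //; exists x. Qed.

Lemma linked_sym A X : symmetric (linked A X).
Proof.
move=> a b; rewrite /linked andbCA; congr [&& _, _ & _].
by apply: eq_existsb => x; rewrite [X in _ && X]andbC.
Qed.

Lemma connect_linked_sym A X : connect_sym (linked A X).
Proof. exact/sym_connect_sym/linked_sym. Qed.

Definition grow A X P :=
  [set b | (b \in P) || (b \in A) &&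
    [exists x, exists a, [&& x \in X, a \in P, cn x a & cn x b]]].

(** Rounds of growth instead of [connect]: this is the form that a program with loops of length [n]
    executes. [comp_connect] gives the usual meaning. *)
Definition component A X u := iter n (grow A X) [set u].

Lemma comp_connect A X u b :
  u \in A -> (b \in component A X u) = connect (linked A X) u b.
Proof.
move=> uA; apply/idP/idP => [|ub].
  have H k c : c \in iter k (grow A X) [set u] -> (c \in A) && connect (linked A X) u c.
    elim: k c => [|k IHk] c /=; first by rewrite inE => /eqP->; rewrite uA connect0.
    rewrite inE => /orP[/IHk//|/andP[cA]].
    case/existsP=> x /existsP[a /and4P[xX /IHk/andP[aA ua] xa xc]].
    by rewrite cA; apply: connect_trans ua (connect1 _); exact: linkedI xX xa xc.
  by move=> /H/andP[].
have fixC : grow A X (component A X u) = component A X u.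
  rewrite /component -[X in iter X](card_ord n).
  by apply: iter_inflation_fix => B; apply/subsetP=> c cB; rewrite inE cB.
have clC : closed (linked A X) (mem (component A X u)).
  apply: intro_closed; first exact: connect_linked_sym.
  move=> a c /linkedE[aA cA [x [xX xa xc]]] aP.
  rewrite -fixC inE cA; apply/orP; right; apply/existsP; exists x; apply/existsP.
  by exists a; rewrite xX xa xc /= andbT.
rewrite -(closed_connect clC ub).
suff H k : u \in iter k (grow A X) [set u] by exact: H.
by elim: k => [|k uk] /=; rewrite inE ?uk.
Qed.

Lemma comp_sub A X u : u \in A -> component A X u \subset A.
Proof.
move=> uA; apply/subsetP=> b; rewrite comp_connect //.
case/connectP=> p; case: (lastP p) => [_ -> //|{}p c].
rewrite rcons_path last_rcons => /andP[_ /linkedE[_ cA _]] -> //.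
Qed.

Definition restrict X P := [set x in X | [exists a, (a \in P) && cn x a]].

Lemma restrictP X P x a : x \in X -> a \in P -> cn x a -> x \in restrict X P.
Proof. by move=> xX aP xa; rewrite inE xX; apply/existsP; exists a; rewrite aP. Qed.

Definition fix_in X P u :=
  [set a in P | (a == u) || ~~ [exists x, [&& x \in X, cn x u & cn x a]]].

Lemma fix_in_sub X P u : fix_in X P u \subset P.
Proof. by apply/subsetP=> a; rewrite inE => /andP[]. Qed.

Lemma fix_in_eq X P u a x :
  a \in fix_in X P u -> x \in X -> cn x u -> cn x a -> a = u.
Proof.
rewrite inE => /andP[_ /orP[/eqP//|/existsP]] H xX xu xa.
by case: H; exists x; rewrite xX xu.
Qed.

Lemma sol_fix_in A X D u : u \in D -> sol A X D -> sol (fix_in X A u) X D.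
Proof.
move=> uD [DA hD]; split=> //; apply/subsetP=> a aD; rewrite inE (subsetP DA) //=.
have [//|nau] := eqVneq; apply/existsP=> [[x /and3P[xX xu xa]]].
by rewrite (hit_uniq (hD x xX) aD uD xa xu) eqxx in nau.
Qed.

Lemma sol_comp A X D u :
  u \in A -> sol A X D -> sol (component A X u) (restrict X (component A X u)) (D :&: component A X u).
Proof.
move=> uA [DA hD]; split; first exact: subsetIr.
move=> x; rewrite inE => /andP[xX /existsP[a /andP[aP xa]]].
have [d dD xd] := hit_ex (hD x xX).
have dP : d \in component A X u.
  move: (aP); rewrite !comp_connect // => ua; apply: connect_trans ua (connect1 _).
  exact: linkedI (subsetP (comp_sub X uA) _ aP) (subsetP DA _ dD) xX xa xd.
apply: (@hit_intro _ _ d) => //; first by rewrite inE dD.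
by move=> b /setIP[bD _] xb; exact: hit_uniq (hD x xX) bD dD xb xd.
Qed.

(** This allows candidates and their neighbours to be used as constraints in the path arguments. It
    survives the deletion of candidates and the restriction to a component. *)
Definition full A X := forall x a, a \in A -> cn x a -> x \in X.

Lemma full_self A X a : full A X -> a \in A -> a \in X.
Proof. by move=> fA aA; exact: fA aA (cnn a). Qed.

Lemma full_sub A B X : B \subset A -> full A X -> full B X.
Proof. by move=> BA fA x a aB; apply: fA; exact: (subsetP BA). Qed.

Lemma full_restrict A X P : P \subset A -> full A X -> full P (restrict X P).
Proof.
move=> PA fA x a aP xa; apply: (restrictP _ aP xa).
exact: fA (subsetP PA a aP) xa.
Qed.

(* ci_conn: the hypergraph with the edges N[x] :&: A, for x in X, is connected. *)
Record conn_inst A X D : Prop := ConnInst {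
  ci_full : full A X;
  ci_sat : saturated A X;
  ci_sol : sol A X D;
  ci_ne : exists a, a \in A;
  ci_conn : forall S : {set 'I_n}, (exists2 a, a \in A & a \in S) ->
    (forall a b x, a \in A -> a \in S -> b \in A -> x \in X -> cn x a -> cn x b -> b \in S) ->
    A \subset S }.

(** A trace that meets a component lies inside it, so inclusions between traces, and with them
    saturation, can be tested within the component. *)
Lemma conn_inst_comp A X D u :
  full A X -> saturated A X -> sol A X D -> u \in A ->
  conn_inst (component A X u) (restrict X (component A X u)) (D :&: component A X u).
Proof.
move=> fA sA solD uA; have PA := comp_sub X uA.
have inP x a b : x \in X -> a \in component A X u -> cn x a -> b \in A -> cn x b ->
    b \in component A X u.
  move=> xX aP xa bA xb; move: (aP); rewrite !comp_connect // => ua.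
  by apply: connect_trans ua (connect1 _); exact: linkedI (subsetP PA _ aP) bA xX xa xb.
split.
- exact: full_restrict fA.
- move=> x y; rewrite inE => /andP[xX /existsP[a /andP[aP xa]]].
  rewrite inE => /andP[yX _] xy c cP yc; apply: (sA x y) => //; last exact: (subsetP PA).
  by move=> b bA xb; apply: xy => //; apply: inP xX aP xa bA xb.
- exact: sol_comp.
- by exists u; rewrite comp_connect // connect0.
move=> S [a aP aS] clS; apply/subsetP=> b bP.
have ab : connect (linked A X) a b.
  by move: aP bP; rewrite !comp_connect // connect_linked_sym; exact: connect_trans.
case/connectP: ab => p.
elim: p a aP aS => [|c p IHp] a aP aS /=; first by move=> _ ->.
move=> /andP[/linkedE[aA cA [x [xX xa xc]]] pp] lp.
have cP := inP _ _ _ xX aP xa cA xc.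
apply: (IHp c) => //.
by apply: (clS a c x) => //; exact: restrictP aP xa.
Qed.

(** * Induced paths on six vertices *)

Hypothesis e_P6 : P_free 6 e.

Lemma P6_free_path a b c d u v :
  e a b -> e b c -> e c d -> e d u -> e u v ->
  ~~ e a c -> ~~ e a d -> ~~ e a u -> ~~ e a v -> ~~ e b d -> ~~ e b u -> ~~ e b v ->
  ~~ e c u -> ~~ e c v -> ~~ e d v -> False.
Proof.
move=> ab bc cd du uv /negbTE ac /negbTE ad /negbTE au /negbTE av /negbTE bd /negbTE bu
  /negbTE bv /negbTE cu /negbTE cv /negbTE dv.
pose s := [:: a; b; c; d; u; v]; pose R (i j : nat) := (i.+1 == j) || (j.+1 == i).
have adjs : all (fun i => all (fun j => e (nth a s i) (nth a s j) == R i j) (iota 0 6)) (iota 0 6).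
  rewrite /R /= !e_irr !(e_sym b a, e_sym c a, e_sym d a, e_sym u a, e_sym v a, e_sym c b,
    e_sym d b, e_sym u b, e_sym v b, e_sym d c, e_sym u c, e_sym v c, e_sym u d, e_sym v d,
    e_sym v u).
  by rewrite ab bc cd du uv ac ad au av bd bu bv cu cv dv.
(* No two vertices of the six-vertex path have the same neighbourhood, so the adjacency pattern
   alone forces [f] to be injective. *)
have rows : all (fun i => all (fun j => all (fun k => R i k == R j k) (iota 0 6) ==> (i == j))
  (iota 0 6)) (iota 0 6) by [].
have in6 (i : 'I_6) : nat_of_ord i \in iota 0 6 by rewrite mem_iota /=.
have adjf (i j : 'I_6) : e (nth a s i) (nth a s j) = R i j.
  exact/eqP/(allP (allP adjs _ (in6 i)) _ (in6 j)).
apply: e_P6; exists (fun i : 'I_6 => nth a s i); split=> // i j fij.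
apply/val_inj/eqP/(implyP (allP (allP rows _ (in6 i)) _ (in6 j)))/allP => k.
by rewrite mem_iota /= => k6; rewrite -(adjf i (Ordinal k6)) fij adjf.
Qed.

(** On [Z] the classes are the components of [G[Z]]. A vertex outside [Z] forms a class of its own,
    as [connect] is reflexive everywhere. *)
Definition wclass Z := connect [rel x y | [&& x \in Z, y \in Z & e x y]].

Lemma wclass_sym Z x y : wclass Z x y = wclass Z y x.
Proof.
apply: sym_connect_sym => {}x {}y /=.
by rewrite andbCA e_sym.
Qed.

Lemma wclass_edge Z x y : x \in Z -> y \in Z -> e x y -> wclass Z x y.
Proof. by move=> xZ yZ xy; apply: connect1; rewrite /= xZ yZ. Qed.

Lemma wclass_cn Z x y : x \in Z -> y \in Z -> cn x y -> wclass Z x y.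
Proof.
move=> xZ yZ /orP[/eqP->|]; [exact: connect0 | exact: wclass_edge].
Qed.

Lemma wclass_trans Z x y z : wclass Z x y -> wclass Z y z -> wclass Z x z.
Proof. exact: connect_trans. Qed.

Lemma wclass_refl Z x : wclass Z x x. Proof. exact: connect0. Qed.

Lemma wclass_in Z x y : x \in Z -> wclass Z x y -> y \in Z.
Proof.
move=> xZ /connectP[p]; case: (lastP p) => [_ -> //|{}p c].
by rewrite rcons_path last_rcons => /andP[_ /and3P[_ cZ _]] ->.
Qed.

(* An induced path t1 - t2 - b attached to a component of G[Z] leaves room for at most two more vertices. *)
Section Tail.
Variables (Z : {set 'I_n}) (t1 t2 b s : 'I_n).
Hypotheses (t12 : e t1 t2) (t2b : e t2 b) (t1b : ~~ e t1 b).
Hypothesis t1Z : forall z, wclass Z s z -> ~~ e t1 z.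
Hypothesis t2Z : forall z, wclass Z s z -> ~~ e t2 z.

(** Otherwise t1 - t2 - b - z - y - y' would be an induced path. *)
Lemma tail_module z y y' :
  wclass Z s z -> wclass Z s y -> wclass Z s y' ->
  e b z -> ~~ e b y -> ~~ e b y' -> e z y -> e y y' -> cn z y'.
Proof.
move=> sz sy sy' bz by_ by' zy yy'; apply/orP; right.
apply/negPn/negP=> zy'.
exact: (P6_free_path t12 t2b bz zy yy' t1b (t1Z sz) (t1Z sy) (t1Z sy')
  (t2Z sz) (t2Z sy) (t2Z sy') by_ by' zy').
Qed.

(** The component stays within distance two of [b]: on a walk, the vertex after one at distance two
    is adjacent to the same neighbour [z] of [b], by [tail_module]. *)
Lemma tail_near y : e b s -> wclass Z s y ->
  e b y \/ exists z, [/\ wclass Z s z, e b z & e z y].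
Proof.
move=> bs sy.
suff H x p : wclass Z s x -> path [rel x y | [&& x \in Z, y \in Z & e x y]] x p ->
    (e b x \/ exists z, [/\ wclass Z s z, e b z & e z x]) ->
    e b (last x p) \/ exists z, [/\ wclass Z s z, e b z & e z (last x p)].
  case/connectP: (sy) => p pp ->; apply: H => //; [exact: wclass_refl | by left].
elim: p x => [|x' p IHp] x //= sx /andP[/and3P[xZ x'Z xx'] pp] Hx.
have sx' : wclass Z s x' by apply: wclass_trans sx _; exact: wclass_edge.
apply: IHp => //.
have [bx'|bx'] := boolP (e b x'); first by left.
right; have [bx|bx] := boolP (e b x); first by exists x.
case: Hx => [|[z [sz bz zx]]]; first by rewrite (negbTE bx).
exists z; split=> //; apply: cn_edge (tail_module sz sx sx' bz bx bx' zx xx') _.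
by apply/eqP=> x'z; rewrite x'z bz in bx'.
Qed.

End Tail.

(** The form in which saturation is used: a candidate seen by [y] only forces one seen by [x]
    only. *)
Lemma sat_escape A X x y a :
  saturated A X -> x \in X -> y \in X -> a \in A -> cn y a -> ~~ cn x a ->
  exists2 b, b \in A & cn x b && ~~ cn y b.
Proof.
move=> sA xX yX aA ya nxa.
have [/existsP[b /and3P[bA xb yb]]|H] := boolP [exists b, [&& b \in A, cn x b & ~~ cn y b]].
  by exists b; rewrite ?xb.
case/negP: nxa; apply: (sA x y) => // b bA xb; apply/negPn/negP=> yb.
by case/existsP: H; exists b; rewrite bA xb.
Qed.

Definition touched Z B b := [set a in B | [exists a', [&& a' \in B, cn b a' & wclass Z a a']]].

Lemma touchedP Z B b a : a \in B ->
  reflect (exists a', [/\ a' \in B, cn b a' & wclass Z a a']) (a \in touched Z B b).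
Proof.
move=> aB; rewrite inE aB; apply: (iffP existsP) => [[a' /and3P[]]|[a' []]] *; exists a'; first by split.
exact/and3P.
Qed.

(* The traces K(b), b in X, of the constraints on the components of G[Z] form a laminar family: an induced P6 arises
   from b, x whose traces intersect without being nested. Hence a largest trace meets everything. *)
Lemma laminar Z A X D : conn_inst A X D -> A \subset Z ->
  exists2 b, b \in X & forall a, a \in A -> exists a', [/\ a' \in A, cn b a' & wclass Z a a'].
Proof.
move=> [fA sA _ [a0 a0A] conn] /subsetP AZ.
have a0X := full_self fA a0A.
case: (arg_maxnP (fun b => #|touched Z A b|) a0X) => b bX bmax0; exists b => //.
have bmax y : y \in X -> #|touched Z A y| <= #|touched Z A b| by exact: bmax0.
have KA y : touched Z A y \subset A by apply/subsetP=> a; rewrite inE => /andP[].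
have selfK y a : a \in A -> cn y a -> a \in touched Z A y.
  by move=> aA ya; apply/touchedP => //; exists a; rewrite wclass_refl.
suff AK : A \subset touched Z A b by move=> a aA; apply/touchedP => //; exact: (subsetP AK).
(* By connectivity it is enough that the candidates touched by the maximal [b] are closed under
   links. If [x] links a touched [a] to an untouched [a'], then by maximality [b] touches some [c]
   that [x] does not touch. The classes of [c], [a] and [a'] are distinct. *)
apply: conn.
  have [c0 c0K] : exists c0, c0 \in touched Z A b.
    apply/set0Pn; rewrite -card_gt0; apply: leq_trans (bmax _ a0X).
    by rewrite card_gt0; apply/set0Pn; exists a0; apply: selfK => //; exact: cnn.
  by exists c0 => //; exact: (subsetP (KA b)).
move=> a a' x aA aK a'A xX xa xa'; apply/negPn/negP=> a'K.
have /subsetPn[c cK cNx] : ~~ (touched Z A b \subset touched Z A x).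
  apply/negP=> bx; have := bmax _ xX; rewrite leqNgt => /negP; apply.
  by apply/proper_card/properP; split=> //; exists a' => //; exact: selfK.
have cA := subsetP (KA b) c cK.
case/touchedP: (cK) => // c2 [c2A bc2 cc2].
case/touchedP: (aK) => // a1 [a1A ba1 aa1].
have bN y : y \in A -> wclass Z a' y -> ~~ cn b y.
  by move=> yA a'y; apply: contra a'K => b_y; apply/touchedP => //; exists y.
have xN y : y \in A -> wclass Z c2 y -> ~~ cn x y.
  move=> yA c2y; apply: contra cNx => x_y; apply/touchedP => //; exists y; split=> //.
  exact: wclass_trans cc2 c2y.
have Nac : ~~ wclass Z a c2.
  by apply: contraL xa => ac; apply: xN => //; rewrite wclass_sym.
have Naa' : ~~ wclass Z a a'.
  apply: contra a'K => aa'; apply/touchedP => //; exists a1; split=> //.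
  by apply: wclass_trans aa1; rewrite wclass_sym.
have Nca' : ~~ wclass Z c2 a' by apply: contraL xa' => ca'; exact: xN.
have sep u v p q : ~~ wclass Z p q -> wclass Z p u -> wclass Z q v -> p \in Z -> q \in Z -> ~~ e u v.
  move=> Npq pu qv pZ qZ; apply: contra Npq => uv.
  apply: (wclass_trans pu); apply: (@wclass_trans _ _ v); last by rewrite wclass_sym.
  by apply: wclass_edge => //; [exact: wclass_in pZ pu | exact: wclass_in qZ qv].
have [[[aZ a'Z] c2Z] a1Z] := (AZ _ aA, AZ _ a'A, AZ _ c2A, AZ _ a1A).
have c2X := full_self fA c2A; have a'X := full_self fA a'A.
have Nc2a1 : ~~ cn c2 a1.
  apply: contra Nac => c2a1; apply: wclass_trans aa1 _.
  by rewrite wclass_sym; exact: wclass_cn.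
(* Saturation supplies the possible ends of the path: [y2] adjacent to [c2] but not to [b], and
   below [y3] adjacent to [a'] but not to [x]. *)
have [y2 y2A /andP[c2y2 by2]] := sat_escape sA c2X bX a1A ba1 Nc2a1.
have Na'a : ~~ cn a' a.
  by apply: contra Naa' => a'a; rewrite wclass_sym; exact: wclass_cn.
have [y3 y3A /andP[a'y3 xy3]] := sat_escape sA a'X xX aA xa Na'a.
have bZ : b \notin Z.
  apply: contra Nac => bZ; apply: wclass_trans aa1 _; rewrite wclass_sym.
  apply: (@wclass_trans _ _ b); last exact: wclass_cn.
  by rewrite wclass_sym; exact: wclass_cn.
have xZ : x \notin Z.
  apply: contra Naa' => xZ; apply: (@wclass_trans _ _ x); last exact: wclass_cn.
  by rewrite wclass_sym; exact: wclass_cn.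
have toE w y : w \notin Z -> y \in Z -> cn w y -> e w y.
  by move=> wZ yZ /cn_edge; apply; apply: contraNneq wZ => <-.
have ebc2 := toE _ _ bZ c2Z bc2; have eba1 := toE _ _ bZ a1Z ba1.
have exa := toE _ _ xZ aZ xa; have exa' := toE _ _ xZ a'Z xa'.
have y2Z := AZ _ y2A; have y3Z := AZ _ y3A.
have ey2c2 : e y2 c2.
  by rewrite e_sym; apply: (cn_edge c2y2); apply: contraNneq by2 => ->.
have ea'y3 : e a' y3.
  by apply: (cn_edge a'y3); apply: contraNneq xy3 => ->.
have wc2y2 : wclass Z c2 y2 by apply: wclass_cn.
have wa'y3 : wclass Z a' y3 by apply: wclass_cn.
have eby2 : ~~ e y2 b by rewrite e_sym; exact: ncn_edge.
have eby3 : ~~ e b y3 by apply/ncn_edge/bN.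
have eba' : ~~ e b a' by apply/ncn_edge/bN => //; exact: wclass_refl.
have exc2 : ~~ e c2 x by rewrite e_sym; apply/ncn_edge/xN => //; exact: wclass_refl.
have exy2 : ~~ e y2 x by rewrite e_sym; apply/ncn_edge/xN.
have exy3 : ~~ e x y3 by exact: ncn_edge.
have ec2a' := sep _ _ _ _ Nca' (wclass_refl _ _) (wclass_refl _ _) c2Z a'Z.
have ec2y3 := sep _ _ _ _ Nca' (wclass_refl _ _) wa'y3 c2Z a'Z.
have ey2a' := sep _ _ _ _ Nca' wc2y2 (wclass_refl _ _) c2Z a'Z.
have ey2y3 := sep _ _ _ _ Nca' wc2y2 wa'y3 c2Z a'Z.
(* There are three paths: y2 - c2 - b - x - a' - y3 if [b] and [x] are adjacent; otherwise y2 - c2 -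
   b - z - x - a' if [b] and [x] have a common neighbour [z] in the class of [a]; otherwise c2 - b -
   z - a - x - a', with [z] from [tail_near]. *)
have [ebx|ebx] := boolP (e b x).
  by apply: (P6_free_path ey2c2 _ ebx exa' ea'y3); rewrite // e_sym.
have N1 : ~~ wclass Z c2 a1.
  by apply: contra Nac => c2a1; apply: wclass_trans aa1 _; rewrite wclass_sym.
have N2 : ~~ wclass Z a1 a'.
  by apply: contra Naa'; exact: wclass_trans.
have ec2b : e c2 b by rewrite e_sym.
have t1Z z : wclass Z a1 z -> ~~ e y2 z by move=> a1z; exact: (sep _ _ _ _ N1).
have t2Z z : wclass Z a1 z -> ~~ e c2 z.
  by move=> a1z; apply: (sep _ _ _ _ N1) => //; exact: wclass_refl.
have za' z : wclass Z a1 z -> ~~ e z a'.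
  by move=> a1z; apply: (sep _ _ _ _ N2) => //; exact: wclass_refl.
have common z : wclass Z a1 z -> e b z -> e z x -> False.
  move=> a1z bz zx.
  exact: (P6_free_path ey2c2 ec2b bz zx exa' eby2 (t1Z _ a1z) exy2 ey2a' (t2Z _ a1z)
    exc2 ec2a' ebx eba' (za' _ a1z)).
have a1a : wclass Z a1 a by rewrite wclass_sym.
have eax : e a x by rewrite e_sym.
have [eba|eba] := boolP (e b a); first exact: common eba eax.
case: (tail_near ey2c2 ec2b eby2 t1Z t2Z eba1 a1a) => [|[z [a1z bz zea]]]; first exact/negP.
have [zx|zx] := boolP (e z x); first exact: common bz zx.
exact: (P6_free_path ec2b bz zea eax exa' (t2Z _ a1z) (t2Z _ a1a) exc2 ec2a' eba ebx eba'
  zx (za' _ a1z) (za' _ a1a)).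
Qed.

(** * Vertices at distance at least three from a guessed vertex *)

Definition far v := [set z | (z == v) || ~~ [exists x, cn x v && cn x z]].

Lemma farN v z x : z \in far v -> z != v -> cn x v -> ~~ cn x z.
Proof.
rewrite inE => /orP[->//|H zv xv]; apply: contra H => xz.
by apply/existsP; exists x; rewrite xv.
Qed.

Lemma far_class v z : wclass (far v) v z -> z = v.
Proof.
case/connectP=> [[|y p] /=]; first by [].
case/andP=> /and3P[_ yZ vy] _ _; have yv : y != v by rewrite eq_sym edgeN.
by have := farN yZ yv (cnn v); rewrite edge_cn.
Qed.

(** Here [b] is at distance exactly two from [v], and v - x - b is the path t1 - t2 - b required in
    Section [Tail]. *)
Lemma far_link v b s : b \notin far v -> s \in far v -> s != v -> e b s ->
  exists x, [/\ e v x, e x b & ~~ e v b].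
Proof.
rewrite inE => /norP[bv /negPn/existsP[x /andP[xv xb]]] sZ sv bs.
have nbv : ~~ cn b v by apply/negP=> /(farN sZ sv); rewrite edge_cn.
exists x; split; last by apply: contra nbv => vb; rewrite cnC edge_cn.
  rewrite e_sym; apply: (cn_edge xv); apply: contraNneq nbv => ->.
  by rewrite cnC.
by apply: (cn_edge xb); apply: contraNneq nbv => ->.
Qed.

Definition cluster A := forall a b c, a \in A -> b \in A -> c \in A ->
  cn a b -> cn b c -> cn a c.

(** The guard [b] enters every component of [G[far v]] that contains a candidate. If there are
    several such components, [laminar] provides [b], which is outside [far v] because a vertex of
    [far v] sees only its own component. If there is one, [b] is the outer end of an edge by which a
    walk from [v] enters it. *)
Lemma far_guard v A X D : conn_inst A X D -> A \subset far v -> v \notin A ->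
  (forall a, a \in A -> connect e v a) ->
  exists b x, [/\ e v x, e x b, ~~ e v b, b \notin far v &
    forall a, a \in A -> exists2 s, wclass (far v) a s & e b s].
Proof.
move=> iA Afar vA vconn; have [fA _ _ [a0 a0A] _] := iA.
have Av a s : a \in A -> wclass (far v) a s -> s != v.
  move=> aA aws; apply: contraNneq vA => sv; move: aws; rewrite sv wclass_sym.
  by move=> /far_class <-.
have AZ a : a \in A -> a \in far v := subsetP Afar a.
suff [b [bZ bA]] : exists b, b \notin far v /\
    forall a, a \in A -> exists2 s, wclass (far v) a s & e b s.
  have [s a0s bs] := bA _ a0A.
  have [x [vx xb vb]] := far_link bZ (wclass_in (AZ _ a0A) a0s) (Av _ _ a0A a0s) bs.
  by exists b, x; split.
have [/existsP[a /andP[aA /existsP[a' /andP[a'A Naa']]]]|/existsP one] :=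
  boolP [exists a, (a \in A) && [exists a', (a' \in A) && ~~ wclass (far v) a a']].
  have [b bX bA] := laminar iA Afar.
  have bZ : b \notin far v.
    apply: contra Naa' => bZ; have [a1 [a1A ba1 aa1]] := bA _ aA.
    have [a2 [a2A ba2 aa2]] := bA _ a'A.
    apply: (wclass_trans aa1); apply: (@wclass_trans _ _ b).
      by rewrite wclass_sym; apply: wclass_cn ba1 => //; exact: AZ.
    apply: (@wclass_trans _ _ a2); last by rewrite wclass_sym.
    by apply: wclass_cn => //; exact: AZ.
  exists b; split=> // c cA; have [c1 [c1A bc1 cc1]] := bA _ cA.
  exists c1 => //; apply: (cn_edge bc1); apply: contraNneq bZ => <-; exact: AZ.
have oneC a : a \in A -> wclass (far v) a0 a.
  move=> aA; apply/negPn/negP=> Na; case: one; exists a0; rewrite a0A.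
  by apply/existsP; exists a; rewrite aA.
have [x [y [xy Nx yC]]] : exists x y, [/\ e x y, ~~ wclass (far v) a0 x & wclass (far v) a0 y].
  have Nv : ~~ wclass (far v) a0 v by apply/negP=> /(Av _ _ a0A); rewrite eqxx.
  case/connectP: (vconn _ a0A) => p pp lp.
  suff H x : ~~ wclass (far v) a0 x -> path e x p -> a0 = last x p ->
      exists x y, [/\ e x y, ~~ wclass (far v) a0 x & wclass (far v) a0 y] by exact: H Nv pp lp.
  elim: p x {pp lp} => [|y p IHp] x /= Nx; first by move=> _ a0x; rewrite -a0x wclass_refl in Nx.
  case/andP=> xy pp lp; have [yC|yC] := boolP (wclass (far v) a0 y); last exact: (IHp y).
  by exists x, y.
exists x; split.
  apply: contra Nx => xZ; apply: (wclass_trans yC); rewrite wclass_sym.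
  exact: wclass_edge xZ (wclass_in (AZ _ a0A) yC) xy.
move=> a aA; exists y => //; apply: wclass_trans yC.
by rewrite wclass_sym; exact: oneC.
Qed.

(** The guess is the dominator of the guard [b], or any vertex of [D] if no candidate sees [b];
    afterwards no other candidate is adjacent to [b]. Behind the path v - x - b, a suitable
    neighbour [z] of [b] then sees whatever is seen by a candidate next to it. By saturation the two
    have equal traces, and equality is transitive. *)
Lemma far_cluster v A X D : conn_inst A X D -> A \subset far v ->
  (forall a, a \in A -> connect e v a) ->
  exists2 u, u \in D & cluster (cl X (fix_in X A u)).
Proof.
move=> iA Afar vconn; have [fA sA solD [a0 a0A] connA] := iA; have [DA hD] := solD.
have AZ a : a \in A -> a \in far v := subsetP Afar a.
have a0X := full_self fA a0A.
have clA u : cl X (fix_in X A u) \subset A.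
  exact: subset_trans (cl_sub _ _) (fix_in_sub _ _ _).
(* If [v] is a candidate, no constraint links it to another one, so the connected set [A] consists
   of [v] alone. *)
have [vA|vA] := boolP (v \in A).
  have Av : A \subset [set v].
    apply: connA; first by exists v; rewrite ?inE.
    move=> a b x _; rewrite !inE => /eqP-> bA _ xv xb.
    have [//|bv] := eqVneq b v.
    by rewrite (negbTE (farN (AZ _ bA) bv xv)) in xb.
  have [u uD _] := hit_ex (hD _ a0X); exists u => //.
  move=> a b c /(subsetP (clA u))/(subsetP Av)/set1P-> _ /(subsetP (clA u))/(subsetP Av)/set1P-> _ _.
  exact: cnn.
have [b [x [vx xb vb bZ bA]]] := far_guard iA Afar vA vconn.
have Av a s : a \in A -> wclass (far v) a s -> s != v.
  move=> aA aws; apply: contraNneq vA => sv; move: aws; rewrite sv wclass_sym.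
  by move=> /far_class <-.
have vN a z : a \in A -> wclass (far v) a z -> ~~ e v z.
  move=> aA az; apply/ncn_edge/(farN (wclass_in (AZ _ aA) az)); last exact: cnn.
  exact: Av az.
have xN a z : a \in A -> wclass (far v) a z -> ~~ e x z.
  move=> aA az; apply/ncn_edge/(farN (wclass_in (AZ _ aA) az)); first exact: Av az.
  by rewrite cnC edge_cn.
have [u uD uB] : exists2 u, u \in D &
    forall y, y \in fix_in X A u -> y != u -> ~~ e b y.
  have [/existsP[d /andP[dA bd]]|bN] := boolP [exists d, (d \in A) && cn b d].
    have bX := fA _ _ dA bd; have [u uD bu] := hit_ex (hD _ bX).
    exists u => // y yA yu; apply: contra yu => b_y; apply/eqP.
    exact: fix_in_eq yA bX bu (edge_cn b_y).
  have [u uD _] := hit_ex (hD _ a0X); exists u => // y /(subsetP (fix_in_sub _ _ _)) yA _.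
  by apply: contra bN => b_y; apply/existsP; exists y; rewrite yA edge_cn.
exists u => //; set A' := cl _ _.
have uX : u \in X by apply: (full_self fA); exact: subsetP DA u uD.
have sA' : saturated A' X by exact: cl_saturated.
have A'A y : y \in A' -> y \in A by exact: (subsetP (clA u)).
have A'fix y : y \in A' -> y \in fix_in X A u by exact: (subsetP (cl_sub _ _)).
have isol y : y \in A' -> cn u y -> y = u.
  by move=> yA' uy; exact: fix_in_eq (A'fix _ yA') uX (cnn u) uy.
have isol' y z : y \in A' -> z \in A' -> cn y z -> y != u -> z != u.
  move=> yA' zA' yz; apply: contraNneq => zu; rewrite zu cnC in yz.
  by rewrite (isol _ yA' yz).
have A'b y : y \in A' -> y != u -> ~~ e b y by move=> /A'fix; exact: uB.
(* The vertex [z] represents the clique of [y]: every candidate other than [u] that it sees has the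
   same trace. One inclusion is [tail_module], the other is saturation. *)
have near y : y \in A' -> y != u -> exists2 z, cn z y &
    forall w, w \in A' -> w != u -> cn z w ->
      (forall p, p \in A' -> cn w p -> cn z p) /\ (forall p, p \in A' -> cn z p -> cn w p).
  move=> yA' yu; have [s ys bs] := bA _ (A'A _ yA').
  have yA := A'A _ yA'; have sy : wclass (far v) s y by rewrite wclass_sym.
  have ysT z : wclass (far v) s z -> wclass (far v) y z by exact: wclass_trans.
  have vs z : wclass (far v) s z -> ~~ e v z by move=> sz; apply: vN yA _; exact: ysT.
  have xs z : wclass (far v) s z -> ~~ e x z by move=> sz; apply: xN yA _; exact: ysT.
  have sZ := wclass_in (AZ _ yA) ys.
  case: (tail_near vx xb vb vs xs bs sy) => [|[z [sz bz zy]]].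
    by rewrite (negbTE (A'b _ yA' yu)).
  have zX : z \in X by apply: fA yA _; exact: edge_cn.
  exists z; first exact: edge_cn.
  move=> w wA' wu zw.
  have zZ := wclass_in sZ sz.
  have sw : wclass (far v) s w.
    by apply: (wclass_trans sz); apply: wclass_cn => //; exact: AZ (A'A _ wA').
  have wz p : p \in A' -> cn w p -> cn z p.
    move=> pA' wp; have [->//|pw] := eqVneq p w.
    have pu := isol' _ _ wA' pA' wp wu.
    have sp : wclass (far v) s p.
      by apply: (wclass_trans sw); apply: wclass_cn => //; apply: AZ; exact: A'A.
    apply: (tail_module vx xb vb vs xs sz sw sp bz (A'b _ wA' wu) (A'b _ pA' pu)).
      apply: (cn_edge zw); apply: contraTneq bz => <-; exact: A'b.
    exact: cn_edge.
  split=> // p pA'; apply: (sA' w z) => //; exact: full_self fA (A'A _ wA').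
move=> a y c aA' yA' cA' ay yc.
have [yu|yu] := eqVneq y u.
  move: ay yc; rewrite yu cnC => /(isol _ aA')-> /(isol _ cA')->; exact: cnn.
have cu := isol' _ _ yA' cA' yc yu.
have [z zy Hz] := near _ yA' yu.
have [yz _] := Hz _ yA' yu zy.
have [_ zc] := Hz _ cA' cu (yz _ cA' yc).
by rewrite cnC; apply: zc => //; apply: yz => //; rewrite cnC.
Qed.

(** * Constraints that meet several cliques of a cluster graph *)

Definition spans A b := forall a, a \in A -> exists a', [/\ a' \in A, cn b a' & cn a a'].

(* Classes are the cliques of the cluster graph G[A]. A constraint b' that still meets two classes after u has been
   fixed is compared with a spanning constraint b that u satisfies. *)
Section Survivor.
Variables (A X D : {set 'I_n}) (u b' a1 a2 : 'I_n).
Hypotheses (iA : conn_inst A X D) (clA : cluster A) (uD : u \in D) (b'X : b' \in X).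
Hypotheses (a1A' : a1 \in cl X (fix_in X A u)) (a2A' : a2 \in cl X (fix_in X A u)).
Hypotheses (b'a1 : cn b' a1) (b'a2 : cn b' a2) (a12 : ~~ cn a1 a2).

Let A'fix y : y \in cl X (fix_in X A u) -> y \in fix_in X A u.
Proof. exact: (subsetP (cl_sub _ _)). Qed.

Let A'A y : y \in cl X (fix_in X A u) -> y \in A.
Proof. by move/A'fix; exact: (subsetP (fix_in_sub _ _ _)). Qed.

Let AX y : y \in A -> y \in X. Proof. exact: full_self (ci_full iA). Qed.
Let DA y : y \in D -> y \in A. Proof. exact: (subsetP (proj1 (ci_sol iA))). Qed.

Let A'u y x : y \in cl X (fix_in X A u) -> y != u -> x \in X -> cn x u -> ~~ cn x y.
Proof. by move=> yA' yu xX xu; apply: contra yu => xy; apply/eqP; exact: fix_in_eq (A'fix yA') xX xu xy. Qed.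

Lemma survivor_not_dom : ~~ cn b' u.
Proof.
apply: contra a12 => b'u.
by rewrite (fix_in_eq (A'fix a1A') b'X b'u b'a1) (fix_in_eq (A'fix a2A') b'X b'u b'a2) cnn.
Qed.

Let sep p q r t : p \in A -> q \in A -> r \in A -> t \in A ->
  ~~ cn p q -> cn p r -> cn q t -> ~~ e r t.
Proof.
move=> pA qA rA tA Npq pr qt; apply: contra Npq => rt.
apply: (clA pA rA qA pr); apply: (clA rA tA qA); first exact: edge_cn.
by rewrite cnC.
Qed.

(** Every clique keeps a candidate that [b'] does not see. Otherwise the trace of the dominator [d]
    of [l] would lie in that of [b'], hence be equal to it by saturation, and [a1] and [a2] would
    both be in the clique of [d]. *)
Let miss l : l \in A -> exists y, [/\ y \in cl X (fix_in X A u), cn l y & ~~ cn b' y].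
Proof.
move=> lA; have [solDA hD] := ci_sol iA; have [d dD ld] := hit_ex (hD l (AX lA)).
have dA := DA dD; have dX := AX dA.
have [solA' _] := sol_cl (sol_fix_in uD (ci_sol iA)).
have sA' : saturated (cl X (fix_in X A u)) X by exact: cl_saturated.
have [/existsP[y /and3P[yA' dy b'y]]|none] :=
  boolP [exists y, [&& y \in cl X (fix_in X A u), cn d y & ~~ cn b' y]].
  by exists y; split=> //; exact: (clA lA dA (A'A yA')).
case/negP: a12; have sub : forall y, y \in cl X (fix_in X A u) -> cn d y -> cn b' y.
  move=> y yA' dy; apply/negPn/negP=> b'y; case/existsP: none; exists y.
  by rewrite yA' dy.
have da1 := sA' _ _ dX b'X sub _ a1A' b'a1; have da2 := sA' _ _ dX b'X sub _ a2A' b'a2.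
by apply: (clA (A'A a1A') dA (A'A a2A')) => //; rewrite cnC.
Qed.

Let a1u : a1 != u. Proof. by apply: contraTneq b'a1 => ->; exact: survivor_not_dom. Qed.
Let a2u : a2 != u. Proof. by apply: contraTneq b'a2 => ->; exact: survivor_not_dom. Qed.

Let uA : u \in A. Proof. exact: DA. Qed.
Let uX : u \in X. Proof. exact: AX. Qed.

Let notinA w : cn w a1 -> cn w a2 -> w \notin A.
Proof.
move=> wa1 wa2; apply: contra a12 => wA; apply: (clA (A'A a1A') wA (A'A a2A')) => //.
by rewrite cnC.
Qed.

Let toE w y : w \notin A -> y \in A -> cn w y -> e w y.
Proof. by move=> wA yA /cn_edge; apply; apply: contraNneq wA => <-. Qed.

Let b'A : b' \notin A. Proof. exact: notinA. Qed.

(** In a clique where [b'] sees a surviving candidate, [b'] sees all that [b] sees. For a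
    counterexample [z], take [y1] and [y2] from [miss]; as survivors they are not seen by [b], which
    sees [u]. Then y1 - z - b - b' - c2 - y2 or b - z - c1 - b' - c2 - y2 is induced, depending on
    whether [b] and [b'] are adjacent. *)
Let sub_a b c1 c2 z : b \in X -> b \notin A -> cn b u ->
  c1 \in cl X (fix_in X A u) -> c2 \in cl X (fix_in X A u) -> c1 != u -> c2 != u ->
  ~~ cn c1 c2 -> cn b' c1 -> cn b' c2 ->
  z \in A -> cn c1 z -> cn b z -> cn b' z.
Proof.
move=> bX bA bu c1A' c2A' c1u c2u c12 b'c1 b'c2 zA c1z bz; apply/negPn/negP=> b'z.
have c1A := A'A c1A'; have c2A := A'A c2A'.
have [y1 [y1A' c1y1 b'y1]] := miss c1A; have [y2 [y2A' c2y2 b'y2]] := miss c2A.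
have y1A := A'A y1A'; have y2A := A'A y2A'.
have notu c y : c \in cl X (fix_in X A u) -> c != u -> cn c y -> y != u.
  move=> cA' cu; apply: contraTneq => ->; rewrite cnC; exact: A'u (cnn u).
have y1u := notu _ _ c1A' c1u c1y1; have y2u := notu _ _ c2A' c2u c2y2.
have by1 := A'u y1A' y1u bX bu; have by2 := A'u y2A' y2u bX bu.
have bc1 := A'u c1A' c1u bX bu; have bc2 := A'u c2A' c2u bX bu.
have ebz := toE bA zA bz.
have eb'c1 := toE b'A c1A b'c1; have eb'c2 := toE b'A c2A b'c2.
have ec2y2 : e c2 y2 by apply: (cn_edge c2y2); apply: contraNneq b'y2 => ->.
have zc2 : ~~ e z c2 by apply: (sep c1A c2A) => //; exact: cnn.
have zy2 : ~~ e z y2 by exact: (sep c1A c2A).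
have y1c2 : ~~ e y1 c2 by apply: (sep c1A c2A) => //; exact: cnn.
have y1y2 : ~~ e y1 y2 by exact: (sep c1A c2A).
have ec12 : ~~ e c1 c2 by exact: ncn_edge.
have c1y2 : ~~ e c1 y2 by apply: (sep c1A c2A) => //; exact: cnn.
have ezc1 : e z c1.
  by rewrite e_sym; apply: (cn_edge c1z); apply: contraTneq bz => ->.
have zy1 : e z y1.
  apply: cn_edge; first by apply: (clA zA c1A y1A) => //; rewrite cnC.
  by apply: contraTneq bz => <-.
have [bb'|bb'] := boolP (e b b').
  apply: (@P6_free_path y1 z b b' c2 y2); rewrite ?(e_sym y1 z) ?(e_sym z b) ?(e_sym y1 b)
    ?(e_sym y1 b') ?(e_sym z b') //; exact: ncn_edge.
apply: (@P6_free_path b z c1 b' c2 y2); rewrite ?(e_sym c1 b') ?(e_sym z b') //; exact: ncn_edge.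
Qed.

Section Spanning.
Variable b : 'I_n.
Hypotheses (bX : b \in X) (bS : spans A b) (bu : cn b u).

Let bA : b \notin A.
Proof.
have [c1 [c1A bc1 a1c1]] := bS (A'A a1A'); have [c2 [c2A bc2 a2c2]] := bS (A'A a2A').
apply: contra a12 => bA; apply: (clA (A'A a1A') c1A (A'A a2A') a1c1).
apply: (clA c1A bA (A'A a2A')); first by rewrite cnC.
by apply: (clA bA c2A (A'A a2A')) => //; rewrite cnC.
Qed.

(** If [b'] misses one candidate of a clique that [b] sees, then [b] and [b'] together see the whole
    clique. Otherwise y - x - b - b' - a1 - y1 is induced, or y - x - b - c1 - b' - a2, where [c1]
    in the clique of [a1] is seen by both. *)
Let no_drop x y : x \in A -> y \in A -> cn x y -> cn b x -> ~~ cn b' x -> ~~ cn b y -> cn b' y.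
Proof.
move=> xA yA xy bx b'x b_y; apply/negPn/negP=> b'y.
have a1A := A'A a1A'; have a2A := A'A a2A'.
have [c1 [c1A bc1 a1c1]] := bS a1A.
have b'c1 : cn b' c1 := sub_a bX bA bu a1A' a2A' a1u a2u a12 b'a1 b'a2 c1A a1c1 bc1.
have [a1x|a1x] := boolP (cn a1 x).
  by move: b'x; rewrite (sub_a bX bA bu a1A' a2A' a1u a2u a12 b'a1 b'a2 xA a1x bx).
have [a2x|a2x] := boolP (cn a2 x).
  have a21 : ~~ cn a2 a1 by rewrite cnC.
  by move: b'x; rewrite (sub_a bX bA bu a2A' a1A' a2u a1u a21 b'a2 b'a1 xA a2x bx).
have eyx : e y x.
  by rewrite e_sym; apply: (cn_edge xy); apply: contraNneq b_y => ->.
have exb : e x b by rewrite e_sym; exact: toE.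
have xa1 : ~~ cn x a1 by rewrite cnC.
have xa2 : ~~ cn x a2 by rewrite cnC.
have [y1 [y1A' a1y1 b'y1]] := miss a1A.
have y1A := A'A y1A'.
have y1u : y1 != u.
  by apply: contraTneq a1y1 => ->; rewrite cnC; exact: A'u a1A' a1u uX (cnn u).
have by1 := A'u y1A' y1u bX bu.
have ba1 := A'u a1A' a1u bX bu; have ba2 := A'u a2A' a2u bX bu.
have eb'a1 := toE b'A a1A b'a1; have eb'a2 := toE b'A a2A b'a2.
have ea1y1 : e a1 y1 by apply: (cn_edge a1y1); apply: contraNneq b'y1 => ->.
have S p q r : p \in A -> q \in A -> ~~ cn x p -> cn p q -> (r == x) || (r == y) -> ~~ e r q.
  move=> pA qA xp pq /orP[]/eqP->; apply: (sep xA pA) => //; exact: cnn.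
have [bb'|bb'] := boolP (e b b').
  apply: (@P6_free_path y x b b' a1 y1) => //; rewrite ?(e_sym y b) ?(e_sym y b') ?(e_sym x b');
    by [exact: ncn_edge | apply: (S a1); rewrite ?eqxx ?orbT ?cnn].
have ec1b' : e c1 b' by rewrite e_sym; exact: toE.
have c1a2 : ~~ e c1 a2 by apply: (sep a1A a2A) => //; exact: cnn.
apply: (@P6_free_path y x b c1 b' a2) => //; rewrite ?(e_sym y b) ?(e_sym y b') ?(e_sym x b');
  by [exact: toE | exact: ncn_edge | apply: (S a1); rewrite ?eqxx ?orbT ?cnn
     | apply: (S a2); rewrite ?eqxx ?orbT ?cnn].
Qed.

(** Away from the clique of [u], [b'] sees all that [b] sees. A counterexample would, by [no_drop],
    make [b'] see the candidate given by [miss], which [b] cannot see since it sees [u]. *)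
Lemma survivor_mono l z : l \in A -> ~~ cn u l -> z \in A -> cn l z -> cn b z -> cn b' z.
Proof.
move=> lA ul zA lz bz; apply/negPn/negP=> b'z.
have [y [yA' ly b'y]] := miss lA; have yA := A'A yA'.
have yu : y != u by apply: contraNneq ul => <-; rewrite cnC.
case/negP: b'y; apply: (no_drop zA yA _ bz b'z (A'u yA' yu bX bu)).
by apply: (clA zA lA yA) => //; rewrite cnC.
Qed.

(** Here [u] itself is the candidate seen by [b] and missed by [b']. *)
Lemma survivor_cover z : z \in A -> cn u z -> cn b z || cn b' z.
Proof.
move=> zA uz; have [//|bz] := boolP (cn b z).
exact: (no_drop uA zA uz bu survivor_not_dom bz).
Qed.

(** In the clique of [u], saturation gives a candidate [y] missed by [b], since [b] also sees other
    cliques; by [no_drop], [b'] sees [y]. *)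
Lemma survivor_spans : spans A b'.
Proof.
move=> l lA; have [ul|ul] := boolP (cn u l); last first.
  have [z [zA bz lz]] := bS lA; exists z; split=> //; exact: (survivor_mono lA ul).
have a1A := A'A a1A'; have [c1 [c1A bc1 a1c1]] := bS a1A.
have Nuc1 : ~~ cn u c1.
  apply: contra (A'u a1A' a1u uX (cnn u)) => uc1; apply: (clA uA c1A a1A) => //.
  by rewrite cnC.
have [y yA /andP[uy b_y]] := sat_escape (ci_sat iA) uX bX c1A bc1 Nuc1.
exists y; split=> //; last by apply: (clA lA uA yA) => //; rewrite cnC.
exact: (no_drop uA yA uy bu survivor_not_dom b_y).
Qed.

End Spanning.
End Survivor.

(** As [b] may be a candidate, this includes [cluster A]. *)
Definition uncrossed A := forall b a c, a \in A -> c \in A -> cn b a -> cn b c -> cn a c.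

Definition crosses A b :=
  [exists a, exists c, [&& a \in A, c \in A, cn b a, cn b c & ~~ cn a c]].

Lemma wclass_cluster A a c : cluster A -> a \in A -> wclass A a c -> cn a c.
Proof.
move=> clA aA /connectP[p]; elim/last_ind: p c => [|p y IHp] c; first by move=> _ ->; exact: cnn.
rewrite rcons_path last_rcons => /andP[pp /and3P[lA yA ly]] ->.
exact: (clA _ _ _ aA lA yA (IHp _ pp erefl) (edge_cn ly)).
Qed.

(* Otherwise each u in D leaves a survivor, and passing to the dominator of the survivor defines a map on D. On the
   class of u, survivor neighbourhoods grow along a cycle through u until the last one is the whole class. *)
Lemma cluster_uncross A X D : conn_inst A X D -> cluster A ->
  exists2 u, u \in D & uncrossed (cl X (fix_in X A u)).
Proof.
move=> iA clA; have [fA sA [DA hD] [a0 a0A] _] := iA.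
pose C u := cl X (fix_in X A u).
have CA u y : y \in C u -> y \in A.
  by move/(subsetP (cl_sub _ _))/(subsetP (fix_in_sub _ _ _)).
have AX y : y \in A -> y \in X by exact: full_self.
have DX y : y \in D -> y \in X by move/(subsetP DA); exact: AX.
have [/existsP[u /andP[uD /negP none]]|allcross] :=
  boolP [exists u, (u \in D) && ~~ [exists b, crosses (C u) b]].
  exists u => // b a c aC cC ba bc; apply/negPn/negP=> ac; case: none.
  apply/existsP; exists b; apply/existsP; exists a; apply/existsP; exists c.
  exact/and5P.
have cross u : u \in D -> exists b, crosses (C u) b.
  move=> uD; apply/existsP; apply: contraT => Nu; case/existsP: allcross; exists u.
  by rewrite uD.
(* [F u] is a survivor of the guess [u], and [h u] is its dominator. For [u] in [D] the default
   values are never taken. *)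
pose F u := odflt u [pick b | crosses (C u) b].
pose h u := odflt u [pick d | (d \in D) && cn (F u) d].
have crossF u : u \in D -> crosses (C u) (F u).
  by rewrite /F => /cross[b ub]; case: pickP => // /(_ b); rewrite ub.
have FX u : u \in D -> F u \in X.
  move=> /crossF/existsP[a /existsP[c /and5P[aC _ ba _ _]]].
  exact: fA (CA _ _ aC) ba.
have hP u : u \in D -> h u \in D /\ cn (F u) (h u).
  move=> uD; have [d dD Fd] := hit_ex (hD _ (FX _ uD)); rewrite /h.
  by case: pickP => [d' /andP[]//|/(_ d)]; rewrite dD Fd.
(* The invariant needed for the lemmas on survivors. It passes from [u] to [h u], with [F u] as the
   new spanning constraint. *)
pose good u := u \in D /\ exists b, [/\ b \in X, spans A b & cn b u].
have good_h u : good u -> good (h u).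
  case=> uD [b [bX bS bu]]; have [huD Fhu] := hP _ uD; split=> //.
  exists (F u); split=> //; first exact: FX.
  case/existsP: (crossF _ uD) => a /existsP[c /and5P[aC cC ba bc ac]].
  exact: (survivor_spans iA clA uD (FX _ uD) aC cC ba bc ac bX bS bu).
have [u0 good0] : exists u, good u.
  have [b bX bS] := laminar iA (subxx A).
  have [d dD bd] := hit_ex (hD _ bX); exists d; split=> //; exists b; split=> // a aA.
  have [a' [a'A ba' aa']] := bS a aA; exists a'; split=> //.
  exact: wclass_cluster aA aa'.
have good_it u t : good u -> good (iter t h u) by move=> gu; elim: t => //= t; exact: good_h.
(* A periodic vertex exists by the pigeonhole principle on [n + 1] iterates. Below, the period is
   taken minimal, so that [v t] differs from [u] for 0 < t < m. *)
have [u gu [m0 m0_gt0 perm0]] : exists2 u, good u & exists2 m, 0 < m & iter m h u = u.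
  have /injectivePn[i [j ij eqij]] : ~~ injectiveb (fun t : 'I_n.+1 => iter t h u0).
    by apply/injectiveP=> /leq_card; rewrite !card_ord ltnn.
  wlog ltij : i j ij eqij / i < j.
    move=> W; have [lt|lt|/val_inj eq] := ltngtP i j; first exact: (W i j).
      by apply: (W j i) => //; rewrite eq_sym.
    by rewrite eq eqxx in ij.
  exists (iter i h u0); first exact: good_it.
  by exists (j - i); rewrite ?subn_gt0 // -iterD subnK // ltnW.
have exm : exists m, (0 < m) && (iter m h u == u) by exists m0; rewrite m0_gt0 perm0 eqxx.
case: (ex_minnP exm) => m /andP[m_gt0 /eqP perm] min_m {exm m0 m0_gt0 perm0}.
have uD := proj1 gu; have uA := subsetP DA _ uD.
pose v t := iter t h u.
have gv t : good (v t) by exact: good_it.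
have vD t : v t \in D by exact: (proj1 (gv t)).
(* Both [v t.+1] and [u] are in [D] and they are distinct, so [v t.+1] is outside the clique of [u].
   There [survivor_mono] compares [F (v t)], which sees [v t.+1], with the survivor [F (v t.+1)]. *)
have grows t : t < m -> forall z, z \in A -> cn u z -> cn (F (v 0)) z -> cn (F (v t)) z.
  elim: t => [//|t IHt] ltm z zA uz Fz; have {}IHt := IHt (ltnW ltm) z zA uz Fz.
  have vu : v t.+1 != u.
    by apply/negP=> vu; move: (min_m t.+1 vu); rewrite leqNgt ltm.
  have Nvu : ~~ cn (v t.+1) u.
    apply: contra vu => cvu; apply/eqP; rewrite cnC in cvu.
    exact: (hit_uniq (hD u (DX _ uD)) (vD _) uD cvu (cnn u)).
  case/existsP: (crossF _ (vD t.+1)) => a /existsP[c /and5P[aC cC ba bc ac]].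
  have [_ [b0 [b0X b0S b0u]]] := gv t.
  case/existsP: (crossF _ (vD t)) => a' /existsP[c' /and5P[aC' cC' ba' bc' ac']].
  have FS := survivor_spans iA clA (vD t) (FX _ (vD t)) aC' cC' ba' bc' ac' b0X b0S b0u.
  exact: (survivor_mono iA clA (vD _) (FX _ (vD _)) aC cC ba bc ac (FX _ (vD t)) FS
    (proj2 (hP _ (vD t))) uA Nvu zA uz IHt).
have vm : h (v m.-1) = u by rewrite -[RHS]perm -[in RHS](prednK m_gt0).
case/existsP: (crossF _ (vD m.-1)) => a /existsP[c /and5P[aC cC ba bc ac]].
have [_ [b0 [b0X b0S b0u]]] := gv m.-1.
have FS := survivor_spans iA clA (vD _) (FX _ (vD _)) aC cC ba bc ac b0X b0S b0u.
have Fu : cn (F (v m.-1)) u by have := proj2 (hP _ (vD m.-1)); rewrite vm.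
have FmX := FX _ (vD m.-1).
(* [F u] and [F (v m.-1)] together cover the clique of [u], and by [grows] the second sees all that
   the first sees there. So [F (v m.-1)] sees the whole clique, and saturation confines it to this
   clique, although it meets two. *)
have sub z : z \in A -> cn u z -> cn (F (v m.-1)) z.
  move=> zA uz; case/existsP: (crossF _ uD) => a' /existsP[c' /and5P[aC' cC' ba' bc' ac']].
  have := survivor_cover iA clA uD (FX _ uD) aC' cC' ba' bc' ac' FmX FS Fu zA uz.
  by case/orP=> // Fz; apply: (grows m.-1) => //; rewrite prednK.
have ua := sA _ _ (DX _ uD) FmX sub _ (CA _ _ aC) ba.
have uc := sA _ _ (DX _ uD) FmX sub _ (CA _ _ cC) bc.
case/negP: ac; apply: (clA _ u _ (CA _ _ aC) uA (CA _ _ cC)) => //.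
by rewrite cnC.
Qed.

(** * The recursive algorithm *)

Variable w : 'I_n -> int.

Definition best (s : {set 'I_n} -> {set 'I_n} -> bool * {set 'I_n}) Y P :=
  foldl (fun acc u => if u \in P then
      let r := s Y (fix_in Y P u) in
      if r.1 && (~~ acc.1 || (set_weight w acc.2 < set_weight w r.2)%R) then r else acc
    else acc) (false, set0) (enum 'I_n).

(** The fold runs over all candidates, not over representatives of components. Each component is
    solved once for each member, always with the same result ([comp_eq]), so the union is
    unaffected. The initial flag rejects constraints that have lost all candidates and thus occur in
    no component. *)
Fixpoint solve k X A : bool * {set 'I_n} :=
  if k is k'.+1 then
    let A' := cl X A in
    foldl (fun acc u => if u \in A' then
        let b := best (solve k') (restrict X (component A' X u)) (component A' X u) in
        (acc.1 && b.1, acc.2 :|: b.2)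
      else acc)
      ([forall x, (x \in X) ==> [exists a, (a \in A') && cn x a]], set0) (enum 'I_n)
  else ([forall x, (x \in X) ==> hit x A], A).

Lemma bestP s Y P (b := best s Y P) :
  (b.1 -> exists u, [/\ u \in P, b = s Y (fix_in Y P u) & (s Y (fix_in Y P u)).1]) /\
  (forall u, u \in P -> (s Y (fix_in Y P u)).1 ->
     b.1 /\ (set_weight w (s Y (fix_in Y P u)).2 <= set_weight w b.2)%R).
Proof.
rewrite /b {b} /best.
suff H (l : seq 'I_n) (b := foldl (fun acc u => if u \in P then
      let r := s Y (fix_in Y P u) in
      if r.1 && (~~ acc.1 || (set_weight w acc.2 < set_weight w r.2)%R) then r else acc
    else acc) (false, set0) l) :
  (b.1 -> exists u, [/\ u \in P, b = s Y (fix_in Y P u) & (s Y (fix_in Y P u)).1]) /\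
  (forall u, u \in l -> u \in P -> (s Y (fix_in Y P u)).1 ->
     b.1 /\ (set_weight w (s Y (fix_in Y P u)).2 <= set_weight w b.2)%R).
  by have [H1 H2] := H (enum 'I_n); split=> // u; apply: H2; rewrite mem_enum.
rewrite /b {b}; elim/last_ind: l => [|l v]; first by [].
rewrite foldl_rcons; set b := foldl _ _ _ => -[IH1 IH2].
have [vP|vP] := boolP (v \in P); last first.
  split=> // u; rewrite mem_rcons inE => /orP[/eqP->|]; last exact: IH2.
  by rewrite (negbTE vP).
set r := s Y (fix_in Y P v) => /=.
have [/andP[r1 br]|br] := ifP.
  split; first by exists v.
  move=> u; rewrite mem_rcons inE => /orP[/eqP->|ul uP su] //.
  have [b1 le_ub] := IH2 u ul uP su; split=> //; apply: le_trans le_ub _.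
  by move: br; rewrite b1 /= => /ltW.
split=> // u; rewrite mem_rcons inE => /orP[/eqP-> _|]; last exact: IH2.
rewrite -/r => r1; move/negbT: br; rewrite r1 negb_or negbK => /andP[-> ].
by rewrite -leNgt.
Qed.

Lemma solveS k X A (A' := cl X A)
    (b := fun u => best (solve k) (restrict X (component A' X u)) (component A' X u)) :
  solve k.+1 X A =
    ([forall x, (x \in X) ==> [exists a, (a \in A') && cn x a]] &&
     [forall u, (u \in A') ==> (b u).1], \bigcup_(u in A') (b u).2).
Proof.
rewrite /= -/A'; set i := [forall x, _].
have -> : \bigcup_(u in A') (b u).2 = \bigcup_(u <- enum 'I_n | u \in A') (b u).2.
  by rewrite big_enum_cond.
have -> : [forall u, (u \in A') ==> (b u).1] = all (fun u => (u \in A') ==> (b u).1) (enum 'I_n).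
  by apply/forallP/allP => H u //; apply: H; rewrite mem_enum.
elim/last_ind: (enum _) => [|l u IHl]; first by rewrite big_nil andbT.
rewrite foldl_rcons IHl all_rcons -cats1 big_cat big_cons big_nil /=.
by case: (u \in A') => /=; rewrite ?setU0 // andbCA andbC andbA.
Qed.

Lemma comp_eq A X u c : u \in A -> c \in component A X u -> component A X c = component A X u.
Proof.
move=> uA cu; have cA := subsetP (comp_sub X uA) c cu.
apply/setP=> a; rewrite !comp_connect //; move: cu; rewrite comp_connect // => cu.
by rewrite (same_connect (connect_linked_sym _ _) cu).
Qed.

(** A constraint sees candidates of one component only, so on its neighbourhood the union agrees
    with the result for that component. *)
Lemma solve_sound k X A : (solve k X A).1 -> sol A X (solve k X A).2.
Proof.
elim: k X A => [|k IHk] X A.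
  by move=> /= /forallP H; split=> // x xX; exact: (implyP (H x)).
rewrite solveS; set A' := cl X A; set b := (fun u => best (solve k) (restrict X (component A' X u)) (component A' X u)).
case/andP=> /= /forallP neX /forallP bs.
have bsol u : u \in A' -> (b u).2 \subset component A' X u /\
    forall x, x \in restrict X (component A' X u) -> hit x (b u).2.
  move=> uA'; have [H _] := bestP (solve k) (restrict X (component A' X u)) (component A' X u).
  have [c [cP bc sc]] := H (implyP (bs u) uA'); rewrite /b bc.
  have [DP hD] := IHk _ _ sc; split=> //.
  exact: subset_trans DP (fix_in_sub _ _ _).
split.
  apply/bigcupsP => u uA'; apply: subset_trans (proj1 (bsol u uA')) _.
  exact: subset_trans (comp_sub _ uA') (cl_sub _ _).
move=> x xX; have /existsP[a /andP[aA' xa]] := implyP (neX x) xX.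
have aP : a \in component A' X a by rewrite comp_connect // connect0.
rewrite -[hit _ _](@eq_hit x (b a).2); last first.
  move=> c xc; apply/idP/bigcupP => [ca|[u uA' cu]]; first by exists a.
  have cPu := subsetP (proj1 (bsol u uA')) c cu.
  have cA' := subsetP (comp_sub _ uA') c cPu.
  have ca : c \in component A' X a.
    by rewrite comp_connect //; apply: connect1; exact: linkedI xX xa xc.
  by move: cu; rewrite /b -(comp_eq uA' cPu) (comp_eq aA' ca).
by apply: (proj2 (bsol a aA')); exact: restrictP xX aP xa.
Qed.

(** * Completeness of the four levels *)

Definition complete k X A := forall D, sol A X D ->
  (solve k X A).1 /\ (set_weight w D <= set_weight w (solve k X A).2)%R.

(** [v] may depend on [D]: [best] tries every guess, so it does at least as well as the guess [v],
    whose result is at least as heavy as the part of [D] in the component. *)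
Lemma complete_step k X A :
  (forall D u (P := component (cl X A) X u), sol A X D -> u \in cl X A ->
     exists2 v, v \in D :&: P & complete k (restrict X P) (fix_in (restrict X P) P v)) ->
  complete k.+1 X A.
Proof.
move=> step D solD; rewrite solveS; set A' := cl X A; set b := (fun u => best (solve k) (restrict X (component A' X u)) (component A' X u)).
have solD' : sol A' X D := sol_cl solD; have [DA' hD] := solD'.
have bs u : u \in A' -> (b u).1 /\
    (set_weight w (D :&: component A' X u) <= set_weight w (b u).2)%R.
  move=> uA'; have [v vDP cv] := step D u solD uA'.
  have solP := sol_fix_in vDP (sol_comp uA' solD').
  have [s1 le_s] := cv _ solP.
  have [_ H] := bestP (solve k) (restrict X (component A' X u)) (component A' X u).
  have vP : v \in component A' X u by case/setIP: vDP.
  have [b1 le_b] := H v vP s1; split=> //; exact: le_trans le_s le_b.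
have s1 : (solve k.+1 X A).1.
  rewrite solveS -/A'; apply/andP; split; apply/forallP=> u; apply/implyP=> uX.
    have [d dD ud] := hit_ex (hD u uX); apply/existsP; exists d.
    by rewrite (subsetP DA').
  by case: (bs u uX).
split; first by rewrite solveS in s1.
set B := \bigcup_(u in A') _.
have bP u : u \in A' -> (b u).2 \subset component A' X u.
  move=> uA'; have [H _] := bestP (solve k) (restrict X (component A' X u)) (component A' X u).
  have [c [cP bc sc]] := H (proj1 (bs u uA')); rewrite /b bc.
  by apply: subset_trans (proj1 (solve_sound sc)) (fix_in_sub _ _ _).
(* Weights are compared component by component, indexed by roots. *)
pose r := fingraph.root (linked A' X).
have rD (E : {set 'I_n}) : set_weight w E = (\sum_u \sum_(a in E | r a == u) w a)%R.
  by rewrite /set_weight (partition_big r predT).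
rewrite !rD; apply: ler_sum => u _.
have csym := connect_linked_sym A' X.
have root_comp c a : c \in A' -> (a \in component A' X c) = (r a == r c).
  by move=> cA'; rewrite comp_connect // csym (root_connect csym).
have inB a c : a \in A' -> c \in component A' X a -> (c \in B) = (c \in (b a).2).
  move=> aA' ca; apply/bigcupP/idP => [[v vA' cv]|cb]; last by exists a.
  have cPv := subsetP (bP v vA') c cv.
  by move: cv; rewrite /b -(comp_eq vA' cPv) (comp_eq aA' ca).
have [/existsP[a /andP[aA' /eqP ra]]|none] := boolP [exists a, (a \in A') && (r a == u)].
  have [_] := bs a aA'; rewrite /set_weight.
  have -> : (\sum_(v in D :&: component A' X a) w v = \sum_(v in D | r v == u) w v)%R.
    by apply: eq_bigl => v; rewrite inE root_comp // ra.
  suff -> : (\sum_(v in (b a).2) w v = \sum_(v in B | r v == u) w v)%R by [].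
  apply: eq_bigl => v; rewrite -ra -root_comp //.
  have [va|va] := boolP (v \in component A' X a); first by rewrite andbT (inB a).
  by rewrite andbF; apply: contraNF va; exact: (subsetP (bP a aA')).
have zero (E : {set 'I_n}) : E \subset A' -> (\sum_(v in E | r v == u) w v = 0)%R.
  move=> EA'; rewrite big_pred0 // => v; apply: contraNF none => /andP[vE rv].
  by apply/existsP; exists v; rewrite (subsetP EA').
rewrite !zero //; apply/bigcupsP => v vA'.
exact: subset_trans (bP v vA') (comp_sub _ vA').
Qed.

(** Linked candidates are adjacent, so a component is a clique and a guess deletes all of it except
    the guessed vertex. *)
Lemma complete_uncrossed X A : full A X -> uncrossed (cl X A) -> complete 1 X A.
Proof.
move=> fA un; apply: complete_step => D u P solD uA.
have fA' := full_sub (cl_sub X A) fA.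
have iP := conn_inst_comp fA' (cl_saturated (X := X) (A := A)) (sol_cl solD) uA.
have [fP _ [DP hD] [a aP] _] := iP.
have [v vD _] := hit_ex (hD a (full_self fP aP)); exists v => // E [EP hE].
have vP := subsetP DP v vD; have vX := full_self fP vP.
have PA := subsetP (comp_sub X uA).
have connP c : connect (linked (cl X A) X) v c -> cn v c.
  case/connectP=> p; elim/last_ind: p c => [|p y IHp] c; first by move=> _ ->; exact: cnn.
  rewrite rcons_path last_rcons => /andP[pp /linkedE[lA yA [x [_ xl xy]]]] ->.
  by apply: (un (last v p)); [exact: PA | | rewrite cnC; exact: IHp | exact: un xl xy].
have fix1 : fix_in (restrict X P) P v = [set v].
  apply/setP=> c; rewrite !inE; apply/andP/eqP => [[cP]|->]; last by rewrite eqxx.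
  case/orP=> [/eqP//|/existsP[]]; exists v; rewrite vX cnn /=; apply: connP.
  by rewrite -comp_connect ?PA // (comp_eq uA vP).
rewrite /= fix1; have Ev : E = [set v].
  rewrite fix1 in EP; apply/eqP; rewrite eqEsubset EP sub1set.
  have [d dE _] := hit_ex (hE v vX); have := subsetP EP d dE.
  by rewrite inE => /eqP <-.
rewrite -Ev; split=> //; apply/forallP=> x; apply/implyP; exact: hE.
Qed.

Lemma complete_cluster X A : full A X -> cluster (cl X A) -> complete 2 X A.
Proof.
move=> fA clA; apply: complete_step => D u P solD uA.
have fA' := full_sub (cl_sub X A) fA.
have iP := conn_inst_comp fA' (cl_saturated (X := X) (A := A)) (sol_cl solD) uA.
have PA := subsetP (comp_sub X uA).
have clP : cluster P by move=> a b c /PA aA /PA bA /PA cA; exact: clA.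
have [v vD un] := cluster_uncross iP clP; exists v => //.
apply: complete_uncrossed un; exact: full_sub (fix_in_sub _ _ _) (ci_full iP).
Qed.

Lemma complete_far X A v : full A X -> A \subset far v ->
  (forall a, a \in A -> connect e v a) -> complete 3 X A.
Proof.
move=> fA Afar vA; apply: complete_step => D u P solD uA.
have fA' := full_sub (cl_sub X A) fA.
have iP := conn_inst_comp fA' (cl_saturated (X := X) (A := A)) (sol_cl solD) uA.
have PA : P \subset A := subset_trans (comp_sub X uA) (cl_sub X A).
have vP a : a \in P -> connect e v a by move=> /(subsetP PA); exact: vA.
have [d dD cld] := far_cluster iP (subset_trans PA Afar) vP.
exists d => //; apply: complete_cluster cld.
exact: full_sub (fix_in_sub _ _ _) (ci_full iP).
Qed.

(** Any vertex [v] of [D] is a good first guess. Chains of links are walks in the graph, so [v]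
    reaches all candidates of its component, as [complete_far] requires. *)
Lemma complete_top : complete 4 setT setT.
Proof.
apply: complete_step => D u P solD uA.
have fT : full (cl setT setT) setT by move=> x a _ _; rewrite inE.
have iP := conn_inst_comp fT (cl_saturated (X := setT) (A := setT)) (sol_cl solD) uA.
have [fP _ [DP hD] [a aP] _] := iP.
have [v vD _] := hit_ex (hD a (full_self fP aP)); exists v => //.
have vP := subsetP DP v vD; have vX := full_self fP vP.
have fixP c : c \in fix_in (restrict setT P) P v -> c \in P.
  exact: (subsetP (fix_in_sub _ _ _)).
apply: (@complete_far _ _ v).
- exact: full_sub (fix_in_sub _ _ _) fP.
- apply/subsetP=> c cF; rewrite inE; have [//|cv /=] := eqVneq c v.
  apply: contra cv => /existsP[x /andP[xv xc]]; apply/eqP.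
  exact: fix_in_eq cF (fP _ _ vP xv) xv xc.
move=> c /fixP cP; have: connect (linked (cl setT setT) setT) v c.
  by rewrite -comp_connect ?(comp_eq uA vP) //; exact: subsetP (comp_sub _ uA) v vP.
apply: connect_sub => b d /linkedE[_ _ [x [_ xb xd]]].
have cn1 p q : cn p q -> connect e p q.
  by case/orP=> [/eqP->|/connect1].
by apply: (connect_trans (cn1 _ _ _) (cn1 _ _ xd)); rewrite cnC.
Qed.

Theorem solve_correct (r := solve 4 setT setT) :
  if r.1 then efficient_dominating e r.2 /\
    forall S, efficient_dominating e S -> (set_weight w S <= set_weight w r.2)%R
  else ~ exists S, efficient_dominating e S.
Proof.
have solT S : efficient_dominating e S -> sol setT setT S.
  by move=> effS; split=> [|x _]; [exact: subsetT | apply/hitP].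
case: ifP => [r1|r1].
  have [_ hD] := solve_sound r1; split=> [x|S /solT/complete_top[]//].
  by apply/hitP/hD; rewrite inE.
by case=> S /solT/complete_top[]; rewrite -/r r1.
Qed.

End Instances.

(** * Blocks of RAM code *)

Definition store := nat -> int.

Lemma exec_add prog t1 t2 c : exec prog (t1 + t2) c = exec prog t2 (exec prog t1 c).
Proof.
elim: t1 c => [|t1 IH] c //=; case E: (step prog c) => [c'|]; first exact: IH.
by case: t2 {IH} => //= t2; rewrite E.
Qed.

(* Jump targets are absolute, so a block depends on the position at which it is placed. *)
Definition block := nat -> seq instr.

Definition placed (prog : seq instr) (a : nat) (c : seq instr) :=
  forall i, i < size c -> nth IHalt prog (a + i) = nth IHalt c i.

Lemma placed_cat prog a c1 c2 :
  placed prog a (c1 ++ c2) -> placed prog a c1 /\ placed prog (a + size c1) c2.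
Proof.
move=> H; split=> i lti.
  by rewrite H ?nth_cat ?lti // size_cat ltn_addr.
rewrite -addnA H ?size_cat ?ltn_add2l // nth_cat ltnNge leq_addr /=.
by rewrite addKn.
Qed.

Lemma placed_cons prog a i c :
  placed prog a (i :: c) -> nth IHalt prog a = i /\ placed prog a.+1 c.
Proof.
move=> H; split; first by have := H 0; rewrite addn0 => ->.
by move=> j ltj; have := H j.+1; rewrite addnS -addSn => ->.
Qed.

(** A Hoare triple for total correctness with a time bound. Control leaves the block at its end,
    wherever the block is placed, so triples compose. *)
Variant tri (b : block) (m : store) (T : nat) (Q : store -> Prop) : Prop :=
  Tri of forall prog a, placed prog a (b a) ->
  exists t m', [/\ t <= T, exec prog t (Config a m) = Config (a + size (b a)) m' & Q m'].

Lemma tri_weaken b m T T' (Q Q' : store -> Prop) :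
  tri b m T Q -> T <= T' -> (forall m', Q m' -> Q' m') -> tri b m T' Q'.
Proof.
case=> H leT QQ'; split=> prog a /H[t [m' [let_ E Qm']]]; exists t, m'.
by split=> //; [exact: leq_trans leT | exact: QQ'].
Qed.

Definition eff (m : store) (i : instr) : store :=
  match i with
  | IConst r z => upd m r z
  | IAdd r a b => upd m r (m a + m b)%R
  | ISub r a b => upd m r (m a - m b)%R
  | ILoad r a => upd m r (m (addr (m a)))
  | IStore a r => upd m (addr (m a)) (m r)
  | _ => m
  end.

Definition straight (i : instr) :=
  match i with IJz _ _ | IJneg _ _ | IHalt => false | _ => true end.

Lemma step_straight prog a m : straight (nth IHalt prog a) ->
  step prog (Config a m) = Some (Config a.+1 (eff m (nth IHalt prog a))).
Proof. by rewrite /step /=; case: (nth _ _ _). Qed.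

Lemma exec_straight prog t a m i : nth IHalt prog a = i -> straight i ->
  exec prog t.+1 (Config a m) = exec prog t (Config a.+1 (eff m i)).
Proof. by move=> <- si; rewrite -(addn1 t) addnC exec_add /= step_straight. Qed.

Lemma exec_jz prog t a m r l : nth IHalt prog a = IJz r l ->
  exec prog t.+1 (Config a m) = exec prog t (Config (if m r == 0%R then l else a.+1) m).
Proof. by move=> E; rewrite -(addn1 t) addnC exec_add /= /step /= E. Qed.

Definition asm (l : seq instr) : block := fun _ => l.

Lemma tri_asm l m (Q : store -> Prop) :
  all straight l -> Q (foldl eff m l) -> tri (asm l) m (size l) Q.
Proof.
move=> sl Ql; split=> prog a pl; exists (size l), (foldl eff m l); split=> //.
move: pl sl; rewrite /asm {Ql}.
elim: l a m => [|i l IH] a m; first by rewrite addn0.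
move=> /placed_cons[ia pl] /= /andP[si sl].
by rewrite step_straight ia //= IH // addnS.
Qed.

Definition seqb (b1 b2 : block) : block := fun a => b1 a ++ b2 (a + size (b1 a)).

Lemma tri_seq b1 b2 m T1 T2 (Q : store -> Prop) :
  tri b1 m T1 (fun m1 => tri b2 m1 T2 Q) -> tri (seqb b1 b2) m (T1 + T2) Q.
Proof.
case=> H; split=> prog a /placed_cat[p1 p2]; have [t1 [m1 [le1 E1 [H2]]]] := H prog a p1.
have [t2 [m2 [le2 E2 Q2]]] := H2 prog _ p2; exists (t1 + t2), m2.
by rewrite leq_add // exec_add E1 E2 size_cat addnA.
Qed.

(* Register 1 is a scratch register; it serves to encode unconditional jumps. *)
Definition branch (j : nat -> instr) (b1 b2 : block) : block := fun a =>
  let c2 := b2 a.+1 in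
  let else_pos := a + (size c2).+3 in
  let c1 := b1 else_pos in
  j else_pos :: c2 ++ [:: IConst 1 0; IJz 1 (else_pos + size c1)] ++ c1.

Definition ifz r := branch (IJz r).
Definition ifneg r := branch (IJneg r).

(** The three extra steps are the test and the two-instruction jump over the first alternative. That
    jump clears register 1, hence [upd m' 1 0]. *)
Lemma tri_branch (j : nat -> instr) (cond : bool) b1 b2 m T (Q : store -> Prop) :
  (forall prog a l, nth IHalt prog a = j l ->
     step prog (Config a m) = Some (Config (if cond then l else a.+1) m)) ->
  (if cond then tri b1 m T Q else tri b2 m T (fun m' => Q (upd m' 1 0))) ->
  tri (branch j b1 b2) m (T + 3) Q.
Proof.
move=> Hj H; split=> prog a; rewrite /branch; set c2 := b2 a.+1; set l := a + _; set c1 := b1 l.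
move=> /placed_cons[ja /placed_cat[p2 /placed_cat[pj p1]]].
have El : a.+1 + size c2 + 2 = l by rewrite /l; lia.
rewrite /= El in p1; case: cond H Hj => -[H] Hj.
  have [t [m' [let_ E Qm]]] := H prog l p1; exists t.+1, m'; split=> //; first by lia.
  rewrite /= (Hj _ _ _ ja) E; congr Config.
  by rewrite -/c1 !size_cat /= -{1}El; clear; lia.
have [t [m' [let_ E Qm]]] := H prog a.+1 p2; exists (t.+1 + 2), (upd m' 1 0); split=> //; first by lia.
rewrite exec_add /= (Hj _ _ _ ja) E /=.
have := pj 0; have := pj 1; rewrite addn0 => /(_ isT) j1 /(_ isT) j0.
rewrite {1}/step /= j0 /= addn1 in j1 *; rewrite /step /= j1 /upd eqxx /=; congr Config.
by rewrite !size_cat /= -{1}El; clear; lia.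
Qed.

Lemma tri_ifz r b1 b2 m T (Q : store -> Prop) :
  (if (m r == 0)%R then tri b1 m T Q else tri b2 m T (fun m' => Q (upd m' 1 0))) ->
  tri (ifz r b1 b2) m (T + 3) Q.
Proof. by apply: tri_branch => prog a l E; rewrite /step /= E. Qed.

Lemma tri_ifneg r b1 b2 m T (Q : store -> Prop) :
  (if (m r < 0)%R then tri b1 m T Q else tri b2 m T (fun m' => Q (upd m' 1 0))) ->
  tri (ifneg r b1 b2) m (T + 3) Q.
Proof. by apply: tri_branch => prog a l E; rewrite /step /= E. Qed.

(* The number of iterations is read from register 0. *)
Definition forb (r : nat) (b : block) : block := fun a =>
  let c := b (a + 3) in
  [:: IConst r 0; ISub 1 r 0; IJz 1 (a + (size c).+1 + 6)] ++ c ++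
  [:: IConst 1 1; IAdd r r 1; IConst 1 0; IJz 1 a.+1].

(** An iteration costs two steps for the test and four for the increment and the jump back; the
    final 3 is the initialisation and the last test. Loop control overwrites register 1, so the
    invariant has to tolerate this. *)
Lemma tri_for r b m n T (I : nat -> store -> Prop) :
  1 < r -> m 0 = Posz n ->
  (forall j m' z, I j m' -> I j (upd m' 1 z)) ->
  I 0 (upd m r 0) ->
  (forall j m', j < n -> m' r = Posz j -> m' 0 = Posz n -> I j m' ->
     tri b m' T (fun m2 => [/\ m2 r = Posz j, m2 0 = Posz n & I j.+1 (upd (upd m2 1 1) r (Posz j.+1))])) ->
  tri (forb r b) m (n * (T + 6) + 3) (I n).
Proof.
move=> r1 m0 stab I0 Hb; split=> prog a; rewrite /forb; set c := b (a + 3); set ex := a + _ + 6.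
move=> /placed_cat[p1 /placed_cat[p2 p3]].
have q0 := p1 0 isT; have q1 := p1 1 isT; have q2 := p1 2 isT.
have q3 := p3 0 isT; have q4 := p3 1 isT; have q5 := p3 2 isT; have q6 := p3 3 isT.
rewrite /= ?addn0 ?addn1 ?addn2 in p2 q0 q1 q2 q3 q4 q5 q6.
rewrite (addn3 (a + 3 + size c)) in q6.
have rn0 : (r == 0) = false by lia.
have rn1 : (r == 1) = false by lia.
have n0r : (0 == r) = false by lia.
have n1r : (1 == r) = false by lia.
suff H k m1 : k <= n -> m1 r = Posz (n - k) -> m1 0 = Posz n -> I (n - k) m1 ->
    exists t m', [/\ t <= k * (T + 6) + 2,
      exec prog t (Config a.+1 m1) = Config ex m' & I n m'].
  have [||||t [m' [let_ E Im]]] := H n (upd m r 0) => //.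
  - by rewrite /upd eqxx subnn.
  - by rewrite /upd n0r.
  - by rewrite subnn.
  exists t.+1, m'; split=> //; first by lia.
  rewrite /= /step /= q0 /= E; congr Config.
  by rewrite /ex !size_cat /=; lia.
elim: k m1 => [|k IH] m1 lek m1r m10 Im1.
  exists 2, (upd m1 1 0); split=> //; last by rewrite subn0 in Im1; exact: stab.
  rewrite (exec_straight _ _ q1) // (exec_jz _ _ q2) /= /upd m1r m10 subn0.
  by rewrite subrr eqxx.
set j := n - k.+1 in m1r Im1; have jn : j < n by rewrite /j; lia.
pose m2 := upd m1 1 (m1 r - m1 0)%R.
have [||/(_ prog (a + 3) p2)[t [m3 [le3 E3 [m3r m30 Im3]]]]] := Hb j m2 jn _ _ (stab _ _ _ Im1).
- by rewrite /m2 /upd rn1.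
- by rewrite /m2 /upd.
pose m4 := upd (upd (upd m3 1 1) r (Posz j.+1)) 1 0.
have jk : n - k = j.+1 by rewrite /j; lia.
have [||||t' [m' [le' E' Im']]] := IH m4; first by lia.
- by rewrite /m4 /upd rn1 eqxx jk.
- by rewrite /m4 /upd /= n0r.
- by rewrite jk; exact: stab.
exists (2 + (t + (4 + t'))), m'; split=> //; first by lia.
rewrite exec_add (exec_straight _ _ q1) // (exec_jz _ _ q2) -/m2 /=.
have -> : (m2 1 == 0)%R = false by rewrite /m2 /upd eqxx m1r m10; lia.
rewrite exec_add -[a.+3]addn3 E3 exec_add -E'; congr (exec _ _ _).
rewrite (exec_straight _ _ q3) // (exec_straight _ _ q4) // (exec_straight _ _ q5) //.
rewrite (exec_jz _ _ q6) /=; congr Config.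
have -> : (upd m3 1 1 r + upd m3 1 1 1)%R = Posz j.+1.
  by rewrite /upd rn1 eqxx m3r; lia.
by [].
Qed.

(** * A structured language and its compilation *)

Inductive bexp : Type :=
| BIn of nat & nat
| BAdj of nat & nat
| BEq of nat & nat
| BFlag of nat
| BLt of nat & nat
| BNot of bexp
| BAnd of bexp & bexp
| BEx of bexp.

Inductive cmd : Type :=
| CMap of nat & bexp
| CSet of nat & bexp
| CSum of nat & bexp
| CSeq of cmd & cmd
| CIf of bexp & cmd
| CFor of cmd.

(* Registers: rI and rV hold the loop index and the Boolean value at a nesting depth, rS the scalars and rB the
   base addresses of the set variables. *)
Definition rI d := d * 4 + 10.
Definition rV d := d * 4 + 11.
Definition rS k := k * 4 + 12.
Definition rB k := k * 4 + 13.

(* Index variables are de Bruijn indices into the stack of loop indices, of which d are in scope. *)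
Fixpoint cexp (d : nat) (x : bexp) : block :=
  match x with
  | BIn k i => asm [:: IAdd 1 (rB k) (rI (d - i.+1)); ILoad (rV d) 1]
  | BAdj i j => asm [:: IAdd 1 5 (rI (d - i.+1)); ILoad 1 1; IAdd 1 1 (rI (d - j.+1)); ILoad (rV d) 1]
  | BEq i j => seqb (asm [:: ISub 1 (rI (d - i.+1)) (rI (d - j.+1))])
      (ifz 1 (asm [:: IConst (rV d) 1]) (asm [:: IConst (rV d) 0]))
  | BFlag k => ifz (rS k) (asm [:: IConst (rV d) 0]) (asm [:: IConst (rV d) 1])
  | BLt k l => seqb (asm [:: ISub 1 (rS k) (rS l)])
      (ifneg 1 (asm [:: IConst (rV d) 1]) (asm [:: IConst (rV d) 0]))
  | BNot x => seqb (cexp d x)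
      (ifz (rV d) (asm [:: IConst (rV d) 1]) (asm [:: IConst (rV d) 0]))
  | BAnd x y => seqb (cexp d x) (ifz (rV d) (asm [::]) (cexp d y))
  | BEx x => seqb (asm [:: IConst (rV d) 0])
      (forb (rI d) (seqb (cexp d.+1 x) (ifz (rV d.+1) (asm [::]) (asm [:: IConst (rV d) 1]))))
  end.

(** [CMap] first fills the temporary array at register 7, because the expression may read the set
    that is being assigned. Adding a cleared register 1 serves as a move. *)
Fixpoint ccmd (d : nat) (c : cmd) : block :=
  match c with
  | CMap k x => seqb
      (forb (rI d) (seqb (cexp d.+1 x) (asm [:: IAdd 1 7 (rI d); IStore 1 (rV d.+1)])))
      (forb (rI d) (asm [:: IAdd 1 7 (rI d); ILoad 2 1; IAdd 1 (rB k) (rI d); IStore 1 2]))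
  | CSet k x => seqb (cexp d x) (asm [:: IConst 1 0; IAdd (rS k) (rV d) 1])
  | CSum k x => seqb (asm [:: IConst (rV d) 0]) (seqb
      (forb (rI d) (seqb (cexp d.+1 x)
        (ifz (rV d.+1) (asm [::]) (asm [:: IAdd 1 6 (rI d); ILoad 1 1; IAdd (rV d) (rV d) 1]))))
      (asm [:: IConst 1 0; IAdd (rS k) (rV d) 1]))
  | CSeq c1 c2 => seqb (ccmd d c1) (ccmd d c2)
  | CIf x c => seqb (cexp d x) (ifz (rV d) (asm [::]) (ccmd d c))
  | CFor c => forb (rI d) (ccmd d.+1 c)
  end.

Fixpoint texp (n : nat) (x : bexp) : nat :=
  match x with
  | BIn _ _ => 2
  | BAdj _ _ | BFlag _ => 4
  | BEq _ _ | BLt _ _ => 5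
  | BNot x => texp n x + 4
  | BAnd x y => texp n x + (texp n y + 3)
  | BEx x => 1 + (n * (texp n x + 4 + 6) + 3)
  end.

Fixpoint tcmd (n : nat) (c : cmd) : nat :=
  match c with
  | CMap k x => n * (texp n x + 2 + 6) + 3 + (n * (4 + 6) + 3)
  | CSet k x => texp n x + 2
  | CSum k x => 1 + (n * (texp n x + (3 + 3) + 6) + 3 + 2)
  | CSeq c1 c2 => tcmd n c1 + tcmd n c2
  | CIf x c => texp n x + (tcmd n c + 3)
  | CFor c => n * (tcmd n c + 6) + 3
  end.

(* K bounds the nesting depth and the number of variables. *)
Fixpoint wfe (K d : nat) (x : bexp) : bool :=
  match x with
  | BIn k i => [&& d < K, k < K & i < d]
  | BAdj i j | BEq i j => [&& d < K, i < d & j < d]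
  | BFlag k => (d < K) && (k < K)
  | BLt k l => [&& d < K, k < K & l < K]
  | BNot x => wfe K d x
  | BAnd x y => wfe K d x && wfe K d y
  | BEx x => (d < K) && wfe K d.+1 x
  end.

Fixpoint wfc (K d : nat) (c : cmd) : bool :=
  match c with
  | CMap k x => [&& d < K, k < K & wfe K d.+1 x]
  | CSet k x => [&& d < K, k < K & wfe K d x]
  | CSum k x => [&& d < K, k < K & wfe K d.+1 x]
  | CSeq c1 c2 => wfc K d c1 && wfc K d c2
  | CIf x c => [&& d < K, wfe K d x & wfc K d c]
  | CFor c => (d < K) && wfc K d.+1 c
  end.

Lemma upd_same m r z : upd m r z r = z. Proof. by rewrite /upd eqxx. Qed.

Lemma upd_other m r z i : i <> r -> upd m r z i = m i.
Proof. by rewrite /upd => /eqP/negbTE->. Qed.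

Lemma tri_loop n d b m T (I : nat -> store -> Prop) :
  m 0 = Posz n ->
  (forall j m1 m2, I j m1 -> (forall a, a <> 1 -> a <> rI d -> m2 a = m1 a) -> I j m2) ->
  I 0 m ->
  (forall (a : 'I_n) m', m' (rI d) = Posz a -> m' 0 = Posz n -> I a m' ->
     tri b m' T (fun m2 => [/\ m2 (rI d) = Posz a, m2 0 = Posz n & I a.+1 m2])) ->
  tri (forb (rI d) b) m (n * (T + 6) + 3) (I n).
Proof.
move=> m0 stab I0 Hb; apply: tri_for => //; first by rewrite /rI; lia.
- by move=> j m' z Im; apply: stab Im _ => a a1 _; rewrite upd_other.
- by apply: stab I0 _ => a _ ad; rewrite upd_other.
move=> j m' jn m'r m'0 Im; apply: (tri_weaken (Hb (Ordinal jn) m' m'r m'0 Im)) => //.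
move=> m2 [m2r m20 Im2]; split=> //; apply: stab Im2 _ => a a1 ad.
by rewrite !upd_other.
Qed.

(** * Semantics of the language and correctness of the compiler *)

Section Semantics.
Variables (n : nat) (e : rel 'I_n) (w : 'I_n -> int).

Record state := State { sets : nat -> {set 'I_n}; scal : nat -> int }.

Definition put_set (s : state) k A := State (fun i => if i == k then A else sets s i) (scal s).
Definition put_scal (s : state) k z := State (sets s) (fun i => if i == k then z else scal s i).

Fixpoint eval (s : state) (st : seq 'I_n) (x : bexp) : bool :=
  match x with
  | BIn k i => if onth st i is Some a then a \in sets s k else false
  | BAdj i j => if onth st i is Some a then if onth st j is Some b then cn e a b else false else false
  | BEq i j => if onth st i is Some a then if onth st j is Some b then a == b else false else false
  | BFlag k => scal s k != 0%R
  | BLt k l => (scal s k < scal s l)%R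
  | BNot x => ~~ eval s st x
  | BAnd x y => eval s st x && eval s st y
  | BEx x => [exists a, eval s (a :: st) x]
  end.

Fixpoint run (c : cmd) (st : seq 'I_n) (s : state) : state :=
  match c with
  | CMap k x => put_set s k [set a | eval s (a :: st) x]
  | CSet k x => put_scal s k (Posz (eval s st x))
  | CSum k x => put_scal s k (\sum_(a | eval s (a :: st) x) w a)%R
  | CSeq c1 c2 => run c2 st (run c1 st s)
  | CIf x c => if eval s st x then run c st s else s
  | CFor c => foldl (fun s a => run c (a :: st) s) s (enum 'I_n)
  end.

Variables (K aj : nat).
Let s0 := K * 4 + 10.
Hypothesis s0_aj : s0 <= aj + n.

(** From [aj] on: the matrix, the weights, a table of row addresses at [Fp], a copy of row 0 at
    [Fp + n], [n + 1] cells for the flag and the bits of the output, the temporary array, and one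
    array of bits per set variable. *)
Definition Wp := aj + n * n.
Definition Fp := Wp + n.
Definition outp := Fp + 2 * n.
Definition tmpp := Fp + 3 * n + 1.
Definition setp k := Fp + 4 * n + 1 + k * n.
(** Row 0 may overlap the registers below [s0], so it is replaced by a copy, and entries are looked
    up through the table of row addresses. *)
Definition rowp i := if i == 0 then Fp + n else aj + i * n.

Record represents (s : state) (st : seq 'I_n) (m : store) : Prop := Repr {
  rp_n : m 0 = Posz n;
  rp_5 : m 5 = Posz Fp;
  rp_6 : m 6 = Posz Wp;
  rp_7 : m 7 = Posz tmpp;
  rp_base : forall k, k < K -> m (rB k) = Posz (setp k);
  rp_row : forall i : 'I_n, m (Fp + i) = Posz (rowp i);
  rp_adj : forall i j : 'I_n, m (rowp i + j) = Posz (cn e i j);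
  rp_w : forall i : 'I_n, m (Wp + i) = w i;
  rp_set : forall k (i : 'I_n), k < K -> m (setp k + i) = Posz (i \in sets s k);
  rp_scal : forall k, k < K -> m (rS k) = scal s k;
  rp_idx : forall i a, onth st i = Some a -> m (rI (size st - i.+1)) = Posz a;
  rp_size : size st <= K }.

(** What may change without affecting [represents] at depth [d]: scratch registers, all [rV], the
    [rI] of depth at least [d], and the temporary array. *)
Definition volatile d a :=
  [|| 1 <= a <= 3, (10 <= a < s0) && ((a - 10) %% 4 == 1),
      (d * 4 + 10 <= a < s0) && ((a - 10) %% 4 == 0) | tmpp <= a < tmpp + n].

Lemma rowp_bound (i j : 'I_n) :
  0 < i /\ s0 <= rowp i + j < Wp \/ i = 0 :> nat /\ Fp + n <= rowp i + j < Fp + 2 * n.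
Proof.
rewrite /rowp; have := ltn_ord i; have := ltn_ord j.
case: eqP => [i0|/eqP]; first by right; lia.
rewrite -lt0n => i0 jn i_n; left; rewrite /Wp.
have : i.+1 * n <= n * n by rewrite leq_mul2r i_n orbT.
have : n <= i * n by exact: leq_pmull.
by rewrite mulSn; lia.
Qed.

Lemma Wp_ge : 0 < n -> s0 <= Wp.
Proof.
by move=> n0; have := leq_pmulr n n0; rewrite /Wp; lia.
Qed.

Lemma repr_frame s st m m' : represents s st m ->
  (forall a, ~~ volatile (size st) a -> m' a = m a) -> represents s st m'.
Proof.
move=> [r0 r5 r6 r7 rb rr ra rw rs rc ri sz] H.
have big a : s0 <= a -> a < tmpp \/ tmpp + n <= a -> m' a = m a.
  by move=> sa ta; apply: H; rewrite /volatile; move: sa; rewrite /s0; lia.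
have Wge := Wp_ge.
split=> //.
- by rewrite H // /volatile; move: Wge; rewrite /s0 /tmpp /Fp; lia.
- by rewrite H // /volatile; move: Wge; rewrite /s0 /tmpp /Fp; lia.
- by rewrite H // /volatile; move: Wge; rewrite /s0 /tmpp /Fp; lia.
- by rewrite H // /volatile; move: Wge; rewrite /s0 /tmpp /Fp; lia.
- move=> k lk; rewrite -rb // H // /volatile; move: Wge lk; rewrite /s0 /tmpp /Fp /rB; lia.
- move=> i; rewrite -rr big //; have := ltn_ord i; move: Wge; rewrite /tmpp /Fp; lia.
- move=> i j; rewrite -ra big //; have := rowp_bound i j; have := ltn_ord i;
    move: Wge; rewrite /tmpp /Fp; lia.
- move=> i; rewrite -rw big //; have := ltn_ord i; move: Wge; rewrite /tmpp /Fp; lia.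
- move=> k i lk; rewrite -rs // big //; have := ltn_ord i;
    move: Wge; rewrite /tmpp /setp /Fp; lia.
- move=> k lk; rewrite -rc // H // /volatile; move: Wge lk; rewrite /s0 /tmpp /Fp /rS; lia.
move=> i a ia; rewrite -(ri i a ia) H // /volatile.
have : i < size st by case: ltnP ia => // le; rewrite onth_default.
have n0 : 0 < n by exact: leq_ltn_trans (ltn_ord a).
by move: (Wge n0) sz; rewrite /s0 /tmpp /Fp /rI; lia.
Qed.

(** What the evaluation of an expression at depth [d] may change. In contrast to [volatile], the
    values [rV] of outer depths are protected; [BEx] and [CSum] accumulate in them. *)
Definition low d a :=
  (1 <= a <= 3) || ((d * 4 + 10 <= a < s0) && ((a - 10) %% 4 < 2)).

Lemma low_volatile d a : low d a -> volatile d a.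
Proof. rewrite /low /volatile; lia. Qed.

Lemma lowS d a : low d.+1 a -> low d a.
Proof. rewrite /low; lia. Qed.

Lemma low1 d : low d 1. Proof. by []. Qed.

Lemma low_rV d d' : d <= d' -> d' < K -> low d (rV d').
Proof. rewrite /low /rV /s0; lia. Qed.

Lemma low_rI d d' : d <= d' -> d' < K -> low d (rI d').
Proof. rewrite /low /rI /s0; lia. Qed.

Definition agree d (m m' : store) := forall a, ~~ low d a -> m' a = m a.

Lemma agree_refl d m : agree d m m. Proof. by []. Qed.

Lemma agree_trans d m1 m2 m3 : agree d m1 m2 -> agree d m2 m3 -> agree d m1 m3.
Proof. by move=> H1 H2 a la; rewrite H2 ?H1. Qed.

Lemma agreeS d m m' : agree d.+1 m m' -> agree d m m'.
Proof. by move=> H a la; apply: H; apply: contra la; exact: lowS. Qed.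

Lemma agree_upd d m m' r z : low d r -> agree d m m' -> agree d m (upd m' r z).
Proof. by move=> lr H a la; rewrite /upd; case: eqP => [ar|_]; [rewrite ar lr in la | exact: H]. Qed.

Lemma repr_agree s st m m' : represents s st m -> agree (size st) m m' -> represents s st m'.
Proof.
move=> R H; apply: repr_frame R _ => a fa; apply: H.
by apply: contra fa; exact: low_volatile.
Qed.

Lemma repr_push s st m (a : 'I_n) : represents s st m -> size st < K -> m (rI (size st)) = Posz a ->
  represents s (a :: st) m.
Proof.
move=> [r0 r5 r6 r7 rb rr ra rw rs rc ri sz] lt ma; split=> //.
by case=> [|i] b /=; [case=> <-; rewrite subn1 | exact: ri].
Qed.

Lemma repr_pop s st m a : represents s (a :: st) m -> represents s st m.
Proof.
move=> [r0 r5 r6 r7 rb rr ra rw rs rc ri sz]; split=> //; last exact: ltnW.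
by move=> i b ib; rewrite -(ri i.+1 b ib).
Qed.

Lemma onth_lt (st : seq 'I_n) i : i < size st -> exists a, onth st i = Some a.
Proof. by elim: st i => //= a st IH [|i] //; [exists a | exact: IH]. Qed.

Lemma tri_set d r z m :
  low d r -> tri (asm [:: IConst r z]) m 1 (fun m' => agree d m m' /\ m' r = z).
Proof.
move=> lr; apply: tri_asm => //=; split; last exact: upd_same.
by apply: agree_upd lr _; exact: agree_refl.
Qed.

Lemma tri_bool d (b : bool) m (br : block -> block -> block) r v1 v2 :
  d < K ->
  (forall b1 b2 T Q, (if b then tri b1 m T Q else tri b2 m T (fun m' => Q (upd m' 1 0%R))) ->
     tri (br b1 b2) m (T + 3) Q) ->
  r = rV d ->
  tri (br (asm [:: IConst r v1]) (asm [:: IConst r v2])) m 4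
    (fun m' => agree d m m' /\ m' (rV d) = if b then v1 else v2).
Proof.
move=> dK Hbr ->; have lr : low d (rV d) by exact: low_rV.
apply: (Hbr _ _ 1); case: b {Hbr} => /=; first exact: tri_set.
apply: (tri_weaken (tri_set v2 m lr)) => // m' [ag m'r]; split.
  by apply: agree_upd ag; exact: low1.
by rewrite upd_other // /rV; lia.
Qed.

Lemma wfe_depth d x : wfe K d x -> d < K.
Proof. by elim: x => //= [k i|i j|i j|k|k l|y IHy z _|y _]; case/andP=> //; auto. Qed.

Lemma cexpP x s st m : wfe K (size st) x -> represents s st m ->
  tri (cexp (size st) x) m (texp n x)
    (fun m' => agree (size st) m m' /\ m' (rV (size st)) = Posz (eval s st x)).
Proof.
elim: x st m => [k i|i j|i j|k|k l|x IH|x IHx y IHy|x IH] st m /=.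
- case/and3P=> dK kK /onth_lt[a ia] R; apply: tri_asm => //=; rewrite upd_same upd_same ia; split.
    apply: agree_upd; first exact: low_rV.
    by apply: agree_upd; [exact: low1 | exact: agree_refl].
  rewrite (rp_base R) // (rp_idx R ia) /= upd_other ?(rp_set R) //.
  by have := Wp_ge (leq_ltn_trans (leq0n a) (ltn_ord a)); rewrite /setp /Fp /s0; lia.
- case/and3P=> dK /onth_lt[a ia] /onth_lt[b jb] R; apply: tri_asm => //=; rewrite ia jb.
  have n0 := leq_ltn_trans (leq0n a) (ltn_ord a); have Wge := Wp_ge n0.
  rewrite !upd_same; split.
    do ?[apply: agree_upd; first exact: low1 || exact: low_rV]; exact: agree_refl.
  rewrite (rp_5 R) (rp_idx R ia) /=.
  rewrite [upd m 1 _ (Fp + a)]upd_other; last by move: Wge; rewrite /Fp /s0; lia.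
  rewrite (rp_row R) ![upd _ 1 _ (rI _)]upd_other; try by rewrite /rI; lia.
  rewrite (rp_idx R jb) /= !upd_other ?(rp_adj R) //;
    by have := rowp_bound a b; move: Wge; rewrite /Fp /s0; lia.
- case/and3P=> dK /onth_lt[a ia] /onth_lt[b jb] R; rewrite ia jb.
  apply: (@tri_seq _ _ _ 1 4); apply: tri_asm => //=.
  set m1 := upd m _ _; have m11 : m1 1 = (Posz a - Posz b)%R.
    by rewrite /m1 upd_same (rp_idx R ia) (rp_idx R jb).
  have ag1 : agree (size st) m m1 by apply: agree_upd; [exact: low1 | exact: agree_refl].
  apply: (tri_weaken (tri_bool (b := a == b) 1 0 dK _ (erefl _))) => //; last first.
    by move=> m' [ag m'v]; split; [exact: agree_trans ag1 ag | rewrite m'v; case: (a == b)].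
  move=> b1 b2 T Q H; apply: tri_ifz; move: H; rewrite m11 subr_eq0.
  by rewrite (_ : (Posz a == Posz b) = (a == b)).
- case/andP=> dK kK R.
  apply: (tri_weaken (tri_bool (b := scal s k == 0%R) 0 1 dK _ (erefl _))) => //; last first.
    by move=> m' [ag m'v]; split=> //; rewrite m'v; case: (_ == _).
  by move=> b1 b2 T Q H; apply: tri_ifz; rewrite (rp_scal R).
- case/and3P=> dK kK lK R.
  apply: (@tri_seq _ _ _ 1 4); apply: tri_asm => //=.
  set m1 := upd m _ _; have m11 : m1 1 = (scal s k - scal s l)%R.
    by rewrite /m1 upd_same (rp_scal R) // (rp_scal R).
  have ag1 : agree (size st) m m1 by apply: agree_upd; [exact: low1 | exact: agree_refl].
  apply: (tri_weaken (tri_bool (b := (scal s k < scal s l)%R) 1 0 dK _ (erefl _))) => //; last first.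
    by move=> m' [ag m'v]; split; [exact: agree_trans ag1 ag | rewrite m'v; case: (_ < _)%R].
  by move=> b1 b2 T Q H; apply: tri_ifneg; rewrite m11 subr_lt0.
- move=> wf R; have dK := wfe_depth wf.
  apply: tri_seq; apply: (tri_weaken (IH st m wf R)) => // m1 [ag1 m1v].
  apply: (tri_weaken (tri_bool (b := ~~ eval s st x) 1 0 dK _ (erefl _))) => //; last first.
    by move=> m' [ag m'v]; split; [exact: agree_trans ag1 ag | rewrite m'v; case: (eval _ _ _)].
  move=> b1 b2 T Q H; apply: tri_ifz; rewrite m1v; move: H; by case: (eval _ _ _).
- case/andP=> wx wy R; apply: tri_seq; apply: (tri_weaken (IHx st m wx R)) => // m1 [ag1 m1v].
  apply: tri_ifz; rewrite m1v; case: (eval s st x) m1v => /= m1v.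
    apply: (tri_weaken (IHy st m1 wy (repr_agree R ag1))) => // m2 [ag2 m2v]; split.
      exact: (agree_upd _ (low1 _) (agree_trans ag1 ag2)).
    by rewrite upd_other // /rV; lia.
  by apply: (@tri_weaken _ _ 0 _ _ _ _ (leq0n _) (fun _ H => H)); exact: tri_asm.
case/andP=> dK wf R; set d := size st in dK wf *.
have lV : low d (rV d) by exact: low_rV.
apply: tri_seq; apply: (tri_weaken (tri_set 0 m lV)) => // m1 [ag1 m1v].
(* After [j] rounds, [rV d] decides the existential statement for vertices below [j]. *)
pose I j (m' : store) := agree d m m' /\
  m' (rV d) = Posz [exists a : 'I_n, (a < j) && eval s (a :: st) x].
have IE j m' m'' : I j m' -> agree d m' m'' -> m'' (rV d) = m' (rV d) -> I j m''.
  by case=> ag mv ag' mv'; split; [exact: agree_trans ag' | rewrite mv'].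
apply: (@tri_weaken _ _ _ _ (I n) _ _ (leqnn _)); last first.
  move=> m' [ag m'v]; split=> //; rewrite m'v; congr (Posz (nat_of_bool _)).
  by apply: eq_existsb => a; rewrite ltn_ord.
apply: tri_for => //.
- by rewrite /rI; lia.
- exact: rp_n (repr_agree R ag1).
- move=> j m' z Im; apply: (IE _ _ _ Im); first exact: (agree_upd _ (low1 _) (@agree_refl _ _)).
  by rewrite upd_other // /rV; lia.
- split; first by apply: (agree_upd _ _ ag1); exact: low_rI.
  rewrite upd_other ?m1v; last by rewrite /rV /rI; lia.
  by case: existsP => // -[].
move=> j m' jn m'I m'0 [ag m'v]; pose a := Ordinal jn.
have R' : represents s (a :: st) m' by apply: repr_push (repr_agree R ag) dK _.
apply: tri_seq; apply: (tri_weaken (IH (a :: st) m' wf R')) => // m2 [ag2 m2v].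
have lVS : ~~ low d.+1 (rV d) by rewrite /low /rV; lia.
have lIS : ~~ low d.+1 (rI d) by rewrite /low /rI; lia.
have l0 : ~~ low d.+1 0 by [].
have step b : b = [exists c : 'I_n, (c < j) && eval s (c :: st) x] || eval s (a :: st) x ->
    b = [exists c : 'I_n, (c < j.+1) && eval s (c :: st) x].
  move=> ->; apply/orP/existsP => [[/existsP[c /andP[cj xc]]|xa]|[c /andP[cj xc]]].
  - by exists c; rewrite xc ltnS ltnW.
  - by exists a; rewrite xa ltnS leqnn.
  move: cj; rewrite ltnS leq_eqVlt => /orP[/eqP cj|cj].
    by right; rewrite (_ : a = c) //; exact: val_inj.
  by left; apply/existsP; exists c; rewrite cj.
have fin m3 : agree d.+1 m2 m3 \/ agree d.+1 m2 (upd m3 (rV d) (m2 (rV d))) ->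
    m3 (rV d) = Posz [exists c : 'I_n, (c < j.+1) && eval s (c :: st) x] ->
  [/\ m3 (rI d) = Posz j, m3 0 = Posz n & I j.+1 (upd (upd m3 1 1) (rI d) (Posz j.+1))].
  move=> ag3 m3v.
  have Ne i : i <> rV d -> ~~ low d.+1 i -> m3 i = m2 i.
    by case: ag3 => H iv li; have := H i li; rewrite ?upd_other.
  split.
  - by rewrite Ne ?ag2 // /rV /rI; lia.
  - by rewrite Ne ?ag2 // /rV; lia.
  split; last by rewrite !upd_other //; rewrite /rV /rI; lia.
  apply: agree_upd; first exact: low_rI.
  apply: agree_upd; first exact: low1.
  apply: (agree_trans ag) => i li.
  have li' : ~~ low d.+1 i by apply: contra li; exact: lowS.
  by rewrite Ne ?ag2 //; apply: contraNnot li => ->.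
apply: (@tri_ifz _ _ _ _ 1); rewrite m2v; case E: (eval s (a :: st) x) => /=.
  apply: tri_asm => //=; apply: fin; last first.
    by rewrite upd_other ?upd_same -?(step true) ?E ?orbT // /rV; lia.
  right=> i li; rewrite /upd; case: eqP => [->//|_]; case: eqP => // i1.
  by rewrite i1 in li.
apply: (@tri_weaken _ _ 0 _ _ _ _ (leq0n _) (fun _ H => H)); apply: tri_asm => //=; apply: fin.
  by left; exact: agree_refl.
by rewrite ag2 // m'v; congr (Posz (nat_of_bool _)); apply: step; rewrite E orbF.
Qed.

Lemma repr_top s st (a : 'I_n) m : represents s (a :: st) m -> m (rI (size st)) = Posz a.
Proof. by move=> R; rewrite -(rp_idx (i := 0) R (erefl _)) /= subn1. Qed.

Lemma repr_put_scal s st m m' k z : represents s st m -> k < K ->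
  (forall a, a <> rS k -> ~~ volatile (size st) a -> m' a = m a) -> m' (rS k) = z ->
  represents (put_scal s k z) st m'.
Proof.
(* Putting the old value back into the one register that matters makes [repr_frame] applicable;
   [repr_put_set] does the same with an array. *)
move=> R kK H m'k; pose m1 := upd m' (rS k) (m (rS k)).
have [r0 r5 r6 r7 rb rr ra rw rs rc ri sz] : represents s st m1.
  by apply: repr_frame R _ => a fa; rewrite /m1 /upd; case: eqP => [->//|ak]; exact: H.
have Wge := Wp_ge.
have E a : a <> rS k -> m' a = m1 a by move=> ak; rewrite /m1 upd_other.
have big a : s0 <= a -> m' a = m1 a by move=> sa; apply: E; move: sa; rewrite /s0 /rS; lia.
split=> //.
- by rewrite E // /rS; lia.
- by rewrite E // /rS; lia.
- by rewrite E // /rS; lia.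
- by rewrite E // /rS; lia.
- by move=> l lK; rewrite E ?rb // /rS /rB; lia.
- by move=> i; rewrite big ?rr //; have := ltn_ord i; move: Wge; rewrite /Fp; lia.
- by move=> i j; rewrite big ?ra //; have := rowp_bound i j; have := ltn_ord i; move: Wge; rewrite /Fp; lia.
- by move=> i; rewrite big ?rw //; have := ltn_ord i; move: Wge; lia.
- by move=> l i lK; rewrite big ?rs //; have := ltn_ord i; move: Wge; rewrite /setp /Fp; lia.
- move=> l lK /=; case: eqP => [->//|lk]; rewrite E ?rc //; rewrite /rS; lia.
by move=> i a ia; rewrite E ?(ri i a) // /rS /rI; lia.
Qed.

Lemma setp_inj k l i j : i < n -> j < n -> setp k + i = setp l + j -> k = l.
Proof.
move=> lti ltj eq_kl.
have E : k * n + i = l * n + j by move: eq_kl; rewrite /setp; lia.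
have n0 : 0 < n by exact: leq_ltn_trans (leq0n i) lti.
have /= := congr1 (fun x => x %/ n) E; by rewrite !divnMDl // !divn_small // !addn0.
Qed.

Lemma repr_put_set s st m m' k (A : {set 'I_n}) : represents s st m -> k < K ->
  (forall a, (forall i : 'I_n, a <> setp k + i) -> ~~ volatile (size st) a -> m' a = m a) ->
  (forall i : 'I_n, m' (setp k + i) = Posz (i \in A)) ->
  represents (put_set s k A) st m'.
Proof.
move=> R kK H m'A.
pose m1 a := if (setp k <= a) && (a < setp k + n) then m a else m' a.
have [r0 r5 r6 r7 rb rr ra rw rs rc ri sz] : represents s st m1.
  apply: repr_frame R _ => a fa; rewrite /m1; case: ifP => // ka; apply: H => // i.
  by have := ltn_ord i; lia.
have Wge := Wp_ge.
have E a : ~~ (setp k <= a < setp k + n) -> m' a = m1 a by rewrite /m1 => /negbTE->.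
have small a : 0 < n -> a < tmpp -> m' a = m1 a.
  by move=> n0 ta; apply: E; move: ta; rewrite /setp /tmpp; lia.
have reg a : a < s0 -> m' a = m1 a.
  by move=> ta; apply: E; case: (posnP n) => [|/Wge]; move: ta; rewrite /setp /tmpp /Fp; lia.
split=> //.
- by rewrite reg // /s0; lia.
- by rewrite reg // /s0; lia.
- by rewrite reg // /s0; lia.
- by rewrite reg // /s0; lia.
- by move=> l lK; rewrite reg ?rb //; rewrite /s0 /rB; lia.
- by move=> i; rewrite small ?rr //; have := ltn_ord i; rewrite /tmpp; lia.
- by move=> i j; rewrite small ?ra //; have := rowp_bound i j; have := ltn_ord i; rewrite /tmpp /Fp; lia.
- by move=> i; rewrite small ?rw //; have := ltn_ord i; rewrite /tmpp /Fp; lia.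
- move=> l i lK /=; have [->|lk] := eqVneq l k; first exact: m'A.
  rewrite E ?rs //; apply/negP=> /andP[le lt]; case/eqP: lk.
  have lt' : setp l + i - setp k < n by have := ltn_ord i; lia.
  by apply: (setp_inj (ltn_ord i) lt'); lia.
- by move=> l lK; rewrite reg ?rc //; rewrite /s0 /rS; lia.
move=> i a ia; have lti : i < size st by case: ltnP ia => // le; rewrite onth_default.
by rewrite reg ?(ri i a) // /s0 /rI; lia.
Qed.

Lemma ccmdP c s st m : wfc K (size st) c -> represents s st m ->
  tri (ccmd (size st) c) m (tcmd n c) (represents (run c st s) st).
Proof.
elim: c s st m => [k x|k x|k x|c1 IH1 c2 IH2|x c IH|c IH] s st m /=; set d := size st.
- case/and3P=> dK kK wf R; pose v a := eval s (a :: st) x.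
  pose I1 j (m' : store) := represents s st m' /\ forall a : 'I_n, a < j -> m' (tmpp + a) = Posz (v a).
  have tgt a i : i < 10 -> a < n -> tmpp + a <> i.
    by move=> i10 an; have := Wp_ge (leq_ltn_trans (leq0n a) an); rewrite /tmpp /Fp /s0; lia.
  have bigt a d' : a < n -> ~~ low d' (tmpp + a).
    move=> an; have := Wp_ge (leq_ltn_trans (leq0n a) an); rewrite /low /tmpp /Fp /s0; lia.
  have lowE (m1 m2 : store) : (forall a, a <> 1 -> a <> rI d -> m2 a = m1 a) -> agree d m1 m2.
    move=> H a la; apply: H => ad; rewrite ad ?low1 // in la.
    by rewrite low_rI in la.
  apply: tri_seq; apply: (@tri_weaken _ _ _ _ (I1 n) _ _ (leqnn _)); last first.
    move=> m1 [R1 tmp].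
    (* During the copy the variable holds new bits below [j] and old bits from [j] on. The new bits
       [v] come from the initial state, so overwriting does not disturb them. *)
    pose I2 j (m' : store) := represents (put_set s k [set a : 'I_n | if a < j then v a else a \in sets s k]) st m'
      /\ forall a : 'I_n, m' (tmpp + a) = Posz (v a).
    apply: (@tri_weaken _ _ _ _ (I2 n) _ _ (leqnn _)); last first.
      move=> m2 [R2 _]; suff -> : [set a | v a] = [set a : 'I_n | if a < n then v a else a \in sets s k] by [].
      by apply/setP=> a; rewrite !inE ltn_ord.
    apply: tri_loop; first exact: rp_n R1.
    + move=> j m2 m3 [R2 tmp2] H; split; first exact: repr_agree R2 (lowE _ _ H).
      by move=> a; rewrite (lowE _ _ H) ?tmp2 //; exact: bigt.
    + split; last by move=> a; apply: tmp.
      apply: (repr_put_set R1 kK) => // i; rewrite (rp_set R1) //.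
      by rewrite inE.
    move=> a m2 m2I m20 [R2 tmp2]; apply: tri_asm => //=.
    have Wge := Wp_ge (leq_ltn_trans (leq0n a) (ltn_ord a)).
    set m3 := upd m2 1 _; have E3 i : i <> 1 -> m3 i = m2 i by exact: upd_other.
    have m31 : m3 1 = Posz (tmpp + a) by rewrite /m3 upd_same (rp_7 R2) m2I.
    set m4 := upd m3 2 _; have E4 i : i <> 2 -> m4 i = m3 i by exact: upd_other.
    have m42 : m4 2 = Posz (v a) by rewrite /m4 upd_same m31 /= E3 ?tmp2 //; exact: tgt.
    set m5 := upd m4 1 _; have E5 i : i <> 1 -> m5 i = m4 i by exact: upd_other.
    have m51 : m5 1 = Posz (setp k + a).
      rewrite /m5 upd_same !E4 ?E3 ?(rp_base R2) ?m2I //; by rewrite /rB /rI; lia.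
    rewrite m51 E5 // m42 /=; set m6 := upd m5 _ _.
    have E6 i : i <> setp k + a -> m6 i = m5 i by exact: upd_other.
    have Em i : i <> setp k + a -> ~~ (1 <= i <= 3) -> m6 i = m2 i.
      by move=> ik i13; rewrite E6 // E5 ?E4 ?E3 //; lia.
    split.
    + rewrite Em //; last by rewrite /rI; lia.
      by have := dK; rewrite /setp /Fp; move: Wge; rewrite /rI /s0; lia.
    + by rewrite Em //; move: Wge; rewrite /setp /Fp /s0; lia.
    split; last by move=> b; rewrite Em ?tmp2 //; have := ltn_ord b;
      move: Wge; rewrite /setp /tmpp /Fp /s0; lia.
    have R3 : represents (put_set s k [set b : 'I_n | if b < a.+1 then v b else b \in sets s k]) st m6 <->
      represents (put_set (put_set s k [set b : 'I_n | if b < a then v b else b \in sets s k]) k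
        [set b : 'I_n | if b < a.+1 then v b else b \in sets s k]) st m6.
      by split=> -[? ? ? ? ? ? ? ? rs ? ? ?]; split=> // l i lK; rewrite rs //=; case: (l == k).
    apply/R3; apply: (repr_put_set R2 kK) => [i ik fi|i].
      apply: Em; first exact: ik.
      by apply: contra fi => ?; apply/orP; left.
    have [->|ia] := eqVneq i a; first by rewrite /m6 upd_same inE ltnSn.
    rewrite Em; last by move: Wge; rewrite /setp /Fp /s0; lia.
      rewrite (rp_set R2) //= eqxx !inE.
      by have -> : (i < a.+1) = (i < a) by rewrite ltnS [RHS]ltn_neqAle ia.
    by move/addnI/val_inj => /eqP; rewrite (negbTE ia).
  apply: tri_loop; first exact: rp_n R.
  + move=> j m2 m3 [R2 tmp2] H; split; first exact: repr_agree R2 (lowE _ _ H).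
    by move=> a aj'; rewrite (lowE _ _ H) ?tmp2 //; exact: bigt.
  + by split.
  move=> a m2 m2I m20 [R2 tmp2].
  apply: tri_seq; apply: (tri_weaken (cexpP (st := a :: st) wf (repr_push R2 dK m2I))) => // m3 [ag3 m3v].
  apply: tri_asm => //=; set m4 := upd m3 1 _.
  have R3 : represents s (a :: st) m3 := repr_agree (repr_push R2 dK m2I) ag3.
  have m41 : m4 1 = Posz (tmpp + a).
    by rewrite /m4 upd_same (rp_7 R3) (repr_top R3).
  have E4 i : i <> 1 -> m4 i = m3 i by exact: upd_other.
  rewrite m41 /= E4; last by rewrite /rV; lia.
  rewrite m3v; set m5 := upd _ _ _.
  have Wge := Wp_ge (leq_ltn_trans (leq0n a) (ltn_ord a)).
  have R5 : represents s (a :: st) m5.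
    apply: repr_frame R3 _ => i fi; rewrite /m5 upd_other; last first.
      by move=> ia; case/negP: fi; rewrite ia /volatile; have := ltn_ord a; rewrite ltn_add2l leq_addr => ->; rewrite !orbT.
    by rewrite E4 // => i1; rewrite i1 in fi.
  split; [exact: repr_top R5 | exact: rp_n R5 |].
  split; first exact: repr_pop R5.
  move=> b; rewrite ltnS leq_eqVlt => /orP[/eqP ba|ba].
    by rewrite ba /m5 upd_same /v; congr (Posz (eval _ (_ :: _) _)); exact: val_inj.
  rewrite /m5 upd_other; last by lia.
  rewrite E4; last exact: tgt.
  by rewrite ag3 ?tmp2 //; exact: bigt.
- case/and3P=> dK kK wf R.
  apply: tri_seq; apply: (tri_weaken (cexpP wf R)) => // m1 [ag1 m1v].
  apply: tri_asm => //=; set m2 := upd m1 1 _; have E2 i : i <> 1 -> m2 i = m1 i by exact: upd_other.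
  apply: (repr_put_scal (repr_agree R ag1) kK) => [a ak fa|].
    by rewrite upd_other // E2 // => a1; rewrite a1 in fa.
  by rewrite upd_same E2 ?m1v /m2 ?upd_same ?addr0 // /rV; lia.
- case/and3P=> dK kK wf R.
  have lV : low d (rV d) by exact: low_rV.
  pose S j := (\sum_(a : 'I_n | (a < j)%N && eval s (a :: st) x) w a)%R.
  pose I j (m' : store) := agree d m m' /\ m' (rV d) = S j.
  have IE j (m1 m2 : store) : I j m1 -> agree d m1 m2 -> m2 (rV d) = m1 (rV d) -> I j m2.
    by case=> ag v ag' v'; split; [exact: agree_trans ag ag' | rewrite v'].
  apply: tri_seq; apply: (tri_weaken (tri_set 0%R m lV)) => // m1 [ag1 m1v].
  apply: tri_seq; apply: (@tri_weaken _ _ _ _ (I n) _ _ (leqnn _)); last first.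
    move=> m2 [ag2 m2v]; apply: tri_asm => //=; set m3 := upd m2 1 _.
    have E3 i : i <> 1 -> m3 i = m2 i by exact: upd_other.
    apply: (repr_put_scal (repr_agree R ag2) kK) => [a ak fa|].
      by rewrite upd_other // E3 // => a1; rewrite a1 in fa.
    rewrite upd_same E3 ?m2v /m3 ?upd_same ?addr0; last by rewrite /rV; lia.
    by apply: eq_bigl => a; rewrite ltn_ord.
  apply: tri_loop; first exact: rp_n (repr_agree R ag1).
  + move=> j m2 m3 Im2 H; apply: (IE _ _ _ Im2); last by apply: H; rewrite /rV /rI; lia.
    by move=> a la; apply: H => ad; rewrite ad ?low1 // low_rI in la.
  + by split=> //; rewrite m1v /S big_pred0.
  move=> a m2 m2I m20 [ag2 m2v].
  have R2 := repr_push (repr_agree R ag2) dK m2I.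
  have SS : S a.+1 = (S a + if eval s (a :: st) x then w a else 0)%R.
    rewrite /S (bigID (fun b : 'I_n => b == a)) /= addrC; congr (_ + _)%R.
      apply: eq_bigl => b; rewrite ltnS leq_eqVlt andbC; have [->|ba] := eqVneq b a.
        by rewrite ltnn.
      by rewrite /= (_ : (nat_of_ord b == a) = false) //; exact/negbTE.
    case: ifP => va; first by rewrite (big_pred1 a) // => b /=; have [->|] := eqVneq b a; rewrite ?andbF // ltnSn va.
    by rewrite big_pred0 // => b; have [->|] := eqVneq b a; rewrite ?andbF // va andbF.
  have fin (m3 m4 : store) : agree d.+1 m2 m3 -> (forall i, i <> 1 -> i <> rV d -> m4 i = m3 i) ->
      m4 (rV d) = S a.+1 -> [/\ m4 (rI d) = Posz a, m4 0 = Posz n & I a.+1 m4].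
    move=> ag3 E4 m4v; split.
    + by rewrite E4 ?ag3 //; rewrite /low /rI /rV /s0; lia.
    + by rewrite E4 ?ag3 //; rewrite /rV; lia.
    split=> //; apply: (agree_trans (agree_trans ag2 (agreeS ag3))) => i li.
    by apply: E4 => ii; rewrite ii ?low1 // lV in li.
  have lVS : ~~ low d.+1 (rV d) by rewrite /low /rV; lia.
  apply: tri_seq; apply: (tri_weaken (cexpP (st := a :: st) wf R2)) => // m3 [ag3 m3v].
  have R3 := repr_agree R2 ag3.
  apply: tri_ifz; rewrite m3v; case E: (eval s (a :: st) x) SS => /= SS.
    apply: tri_asm => //=; apply: (fin m3) => // [i i1 iV|].
      by rewrite !upd_other.
    rewrite upd_other ?upd_same; last by rewrite /rV; lia.
    rewrite !(upd_other _ _ (i := rV d)); try by rewrite /rV; lia.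
    rewrite ag3 // m2v SS (rp_6 R3) -(rp_w R3 a); congr (_ + _)%R.
    have -> : m3 (rI d) = Posz a by exact: repr_top R3.
    rewrite /= upd_other //.
    by have := Wp_ge (leq_ltn_trans (leq0n a) (ltn_ord a)); rewrite /s0; lia.
  apply: (@tri_weaken _ _ 0 _ _ _ _ (leq0n _) (fun _ H => H)); apply: tri_asm => //=.
  by apply: (fin m3) => //; rewrite ag3 // m2v SS addr0.
- case/andP=> w1 w2 R; apply: tri_seq; apply: (tri_weaken (IH1 _ _ _ w1 R)) => // m1 R1.
  exact: IH2.
- case/and3P=> dK wx wc R; apply: tri_seq; apply: (tri_weaken (cexpP wx R)) => // m1 [ag1 m1v].
  have R1 := repr_agree R ag1.
  apply: tri_ifz; rewrite m1v; case: (eval s st x) => /=.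
    apply: (tri_weaken (IH _ _ _ wc R1)) => // m2 R2; apply: repr_agree R2 _.
    by apply: agree_upd; [exact: low1 | exact: agree_refl].
  by apply: (@tri_weaken _ _ 0 _ _ _ _ (leq0n _) (fun _ H => H)); exact: tri_asm.
case/andP=> dK wc R.
pose sj j := foldl (fun s a => run c (a :: st) s) s (take j (enum 'I_n)).
have -> : foldl (fun s a => run c (a :: st) s) s (enum 'I_n) = sj n.
  by rewrite /sj take_oversize // size_enum_ord.
apply: (tri_loop (I := fun j m' => represents (sj j) st m')); first exact: rp_n R.
- move=> j m1 m2 R1 H; apply: repr_agree R1 _ => a la.
  by apply: H => ad; rewrite ad ?low1 // low_rI in la.
- by rewrite /sj take0.
move=> a m1 m1I m10 R1.
apply: (tri_weaken (IH _ (a :: st) _ wc (repr_push R1 dK m1I))) => // m2 R2.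
split; [exact: repr_top R2 | exact: rp_n R2 |].
rewrite /sj (take_nth a) ?size_enum_ord // nth_ord_enum foldl_rcons.
exact: repr_pop R2.
Qed.

End Semantics.

(** * The algorithm as a program *)

Definition BOr x y := BNot (BAnd (BNot x) (BNot y)).
Definition BImp x y := BNot (BAnd x (BNot y)).
Definition BAll x := BNot (BEx (BNot x)).

(* Variables of recursion level k: the candidates A, the constraints X, the result D (valid if the flag fF is set), the
   component P, the best result B for P so far (valid if fB is set), and the weights fS, fT to be compared. *)
Definition vA k := k * 5.
Definition vX k := k * 5 + 1.
Definition vD k := k * 5 + 2.
Definition vP k := k * 5 + 3.
Definition vB k := k * 5 + 4.
Definition fF k := k * 5.
Definition fB k := k * 5 + 1.
Definition fS k := k * 5 + 2.
Definition fT k := k * 5 + 3.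

Definition hit_exp k :=
  BAnd (BEx (BAnd (BIn (vA k) 0) (BAdj 1 0)))
    (BAll (BAll (BImp (BAnd (BIn (vA k) 1) (BAnd (BIn (vA k) 0) (BAnd (BAdj 2 1) (BAdj 2 0))))
      (BEq 1 0)))).

Definition bad_exp k :=
  BEx (BEx (BAnd (BIn (vX k) 1) (BAnd (BIn (vX k) 0) (BAnd (BAdj 0 2) (BAnd (BNot (BAdj 1 2))
    (BAll (BImp (BAnd (BIn (vA k) 0) (BAdj 2 0)) (BAdj 1 0)))))))).

(** [CFor] only counts the [n] rounds of [cl]; in the expression, index 0 is the vertex bound by
    [CMap]. *)
Definition cl_cmd k := CFor (CMap (vA k) (BAnd (BIn (vA k) 0) (BNot (bad_exp k)))).

Definition comp_cmd k := CSeq (CMap (vP k) (BEq 0 1))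
  (CFor (CMap (vP k) (BOr (BIn (vP k) 0) (BAnd (BIn (vA k) 0)
    (BEx (BEx (BAnd (BIn (vX k) 1) (BAnd (BIn (vP k) 0) (BAnd (BAdj 1 0) (BAdj 1 2)))))))))).

Definition fix_exp k :=
  BAnd (BIn (vP k.+1) 0) (BOr (BEq 0 1)
    (BNot (BEx (BAnd (BIn (vX k) 0) (BAnd (BAdj 0 2) (BAdj 0 1)))))).

(** The recursive call is inlined as [c], the code of level [k]. [BEq 0 0] is the constant true here
    and below. *)
Definition try_cmd k (c : cmd) := CIf (BIn (vP k.+1) 0)
  (CSeq (CMap (vA k) (fix_exp k)) (CSeq c
  (CSeq (CSum (fS k.+1) (BIn (vD k) 0)) (CSeq (CSum (fT k.+1) (BIn (vB k.+1) 0))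
  (CIf (BAnd (BFlag (fF k)) (BOr (BNot (BFlag (fB k.+1))) (BLt (fT k.+1) (fS k.+1))))
    (CSeq (CMap (vB k.+1) (BIn (vD k) 0)) (CSet (fB k.+1) (BEq 0 0)))))))).

Definition best_cmd k (c : cmd) := CIf (BIn (vA k.+1) 0)
  (CSeq (comp_cmd k.+1)
  (CSeq (CMap (vX k) (BAnd (BIn (vX k.+1) 0) (BEx (BAnd (BIn (vP k.+1) 0) (BAdj 1 0)))))
  (CSeq (CSet (fB k.+1) (BNot (BEq 0 0)))
  (CSeq (CMap (vB k.+1) (BNot (BEq 0 0)))
  (CSeq (CFor (try_cmd k c))
  (CSeq (CSet (fF k.+1) (BAnd (BFlag (fF k.+1)) (BFlag (fB k.+1))))
    (CMap (vD k.+1) (BOr (BIn (vD k.+1) 0) (BIn (vB k.+1) 0))))))))).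

Fixpoint solve_cmd k : cmd :=
  if k is k'.+1 then
    CSeq (cl_cmd k)
    (CSeq (CSet (fF k) (BAll (BImp (BIn (vX k) 0) (BEx (BAnd (BIn (vA k) 0) (BAdj 1 0))))))
    (CSeq (CMap (vD k) (BNot (BEq 0 0)))
      (CFor (best_cmd k' (solve_cmd k')))))
  else CSeq (CMap (vD 0) (BIn (vA 0) 0))
            (CSet (fF 0) (BAll (BImp (BIn (vX 0) 0) (hit_exp 0)))).

Fixpoint wsets (c : cmd) : seq nat :=
  match c with
  | CMap k _ => [:: k]
  | CSet _ _ | CSum _ _ => [::]
  | CSeq c1 c2 => wsets c1 ++ wsets c2
  | CIf _ c | CFor c => wsets c
  end.

Fixpoint wscal (c : cmd) : seq nat :=
  match c with
  | CMap k _ => [::]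
  | CSet k _ | CSum k _ => [:: k]
  | CSeq c1 c2 => wscal c1 ++ wscal c2
  | CIf _ c | CFor c => wscal c
  end.

(** Level [k] leaves its own constraints [vX k] and all variables of higher levels intact, so the
    caller can reuse them for the next guess; [vA k] is set anew for each guess. *)
Lemma wsets_solve k i : i \in wsets (solve_cmd k) -> i < k.+1 * 5 /\ i != vX k.
Proof.
elim: k i => [|k IH] i.
  by rewrite /= !inE /vD /vX => /eqP->.
rewrite /= !(mem_cat, inE) -!orbA /vA /vX /vP /vB /vD => H.
suff : (i \in wsets (solve_cmd k)) || (i \in [:: k.+1 * 5; k.+1 * 5 + 2; k.+1 * 5 + 3; k * 5 + 1; k.+1 * 5 + 4; k * 5]).
  case/orP=> [/IH[]|]; first by rewrite /vX; lia.
  by rewrite !inE; lia.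
by rewrite !inE; move: H; case: (i \in _) => //=; rewrite ?orbF; lia.
Qed.

Lemma wscal_solve k i : i \in wscal (solve_cmd k) -> i < k.+1 * 5.
Proof.
elim: k i => [|k IH] i; first by rewrite /= !inE /fF => /eqP->.
rewrite /= !(mem_cat, inE) -!orbA /fF /fB /fS /fT => H.
suff : (i \in wscal (solve_cmd k)) || (i < k.+2 * 5) by case/orP=> [/IH|//]; lia.
by move: H; case: (i \in _) => //=; rewrite ?orbF; lia.
Qed.

(** * The program computes [solve] *)

Section Refinement.
Variables (n : nat) (e : rel 'I_n) (w : 'I_n -> int).
Hypothesis e_sym : symmetric e.
Notation ev := (@eval n e).
Notation rn := (@run n e w).

Lemma run_sets c st s i : i \notin wsets c -> sets (rn c st s) i = sets s i.
Proof.
elim: c st s => //= [k x|c1 IH1 c2 IH2|x c IH|c IH] st s.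
- by rewrite inE => /negbTE->.
- by rewrite mem_cat => /norP[i1 i2]; rewrite IH2 ?IH1.
- by move=> ic; case: ifP => // _; exact: IH.
by move=> ic; elim: (enum _) s => //= a l IHl s; rewrite IHl IH.
Qed.

Lemma run_scal c st s i : i \notin wscal c -> scal (rn c st s) i = scal s i.
Proof.
elim: c st s => //= [k x|k x|c1 IH1 c2 IH2|x c IH|c IH] st s.
- by rewrite inE => /negbTE->.
- by rewrite inE => /negbTE->.
- by rewrite mem_cat => /norP[i1 i2]; rewrite IH2 ?IH1.
- by move=> ic; case: ifP => // _; exact: IH.
by move=> ic; elim: (enum _) s => //= a l IHl s; rewrite IHl IH.
Qed.

Lemma eval_or s st x y : ev s st (BOr x y) = ev s st x || ev s st y.
Proof. by rewrite /= -negb_or negbK. Qed.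

Lemma eval_imp s st x y : ev s st (BImp x y) = (ev s st x ==> ev s st y).
Proof. by rewrite /=; case: (ev s st x); case: (ev s st y). Qed.

Lemma eval_all s st x : ev s st (BAll x) = [forall a, ev s (a :: st) x].
Proof. by rewrite /= negb_exists; apply: eq_forallb => a; rewrite negbK. Qed.

Lemma eval_ex s st x : ev s st (BEx x) = [exists a, ev s (a :: st) x].
Proof. by []. Qed.

Lemma eval_and s st x y : ev s st (BAnd x y) = ev s st x && ev s st y.
Proof. by []. Qed.

Lemma eval_hit s st x k : ev s (x :: st) (hit_exp k) = hit e x (sets s (vA k)).
Proof.
rewrite /hit_exp eval_and eval_ex eval_all; congr (_ && _).
apply: eq_forallb => a; rewrite eval_all; apply: eq_forallb => b.
by rewrite eval_imp.
Qed.

Lemma eval_bad s st a k :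
  ev s (a :: st) (bad_exp k) = bad e (sets s (vX k)) (sets s (vA k)) a.
Proof.
rewrite /bad_exp eval_ex; apply: eq_existsb => x; rewrite eval_ex; apply: eq_existsb => y.
rewrite !eval_and; do 4 congr (_ && _).
by rewrite eval_all; apply: eq_forallb => b; rewrite eval_imp.
Qed.

Lemma Posz_bool_neq0 (b : bool) : (Posz b != 0%R) = b. Proof. by case: b. Qed.

Lemma cl_cmd_sets k st s :
  sets (rn (cl_cmd k) st s) (vA k) = cl e (sets s (vX k)) (sets s (vA k)).
Proof.
pose c := CMap (vA k) (BAnd (BIn (vA k) 0) (BNot (bad_exp k))).
suff H l s' : sets (foldl (fun s a => rn c (a :: st) s) s' l) (vA k) =
    iter (size l) (prune e (sets s' (vX k))) (sets s' (vA k)).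
  by have := H (enum 'I_n) s; rewrite size_enum_ord.
elim: l s' => [//|a l IHl] s'; rewrite [LHS]IHl [size _]/= iterSr.
have -> : sets (rn c (a :: st) s') (vX k) = sets s' (vX k).
  by apply: run_sets; rewrite inE /vX /vA; lia.
congr (iter _ _ _); rewrite [LHS]/= eqxx; apply/setP=> b; rewrite !inE.
by rewrite -(eval_bad s' (a :: st) b k).
Qed.

Lemma comp_cmd_sets k st s u :
  sets (rn (comp_cmd k) (u :: st) s) (vP k) = component e (sets s (vA k)) (sets s (vX k)) u.
Proof.
pose x := BOr (BIn (vP k) 0) (BAnd (BIn (vA k) 0)
    (BEx (BEx (BAnd (BIn (vX k) 1) (BAnd (BIn (vP k) 0) (BAnd (BAdj 1 0) (BAdj 1 2))))))).
suff H l s' : sets (foldl (fun s a => rn (CMap (vP k) x) (a :: u :: st) s) s' l) (vP k) =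
    iter (size l) (grow e (sets s' (vA k)) (sets s' (vX k))) (sets s' (vP k)).
  have := H (enum 'I_n) (rn (CMap (vP k) (BEq 0 1)) (u :: st) s); rewrite size_enum_ord.
  rewrite (@run_sets _ _ _ (vA k)) ?(@run_sets _ _ _ (vX k)) ?inE; try by rewrite /vX /vA /vP; lia.
  move=> E; rewrite [LHS]E; congr (iter _ _ _); rewrite /= eqxx.
  by apply/setP=> b; rewrite !inE.
elim: l s' => [//|a l IHl] s'; rewrite [LHS]IHl [size _]/= iterSr.
rewrite (@run_sets _ _ _ (vA k)) ?(@run_sets _ _ _ (vX k)) ?inE; try by rewrite /vX /vA /vP; lia.
congr (iter _ _ _); rewrite [LHS]/= eqxx; apply/setP=> b; rewrite !inE.
by rewrite -negb_or negbK.
Qed.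

Notation slv := (solve e w).

Definition solve_spec k := forall st s (r := slv k (sets s (vX k)) (sets s (vA k)))
  (s' := rn (solve_cmd k) st s), sets s' (vD k) = r.2 /\ (scal s' (fF k) != 0%R) = r.1.

Definition best_vars k (s : state n) := (scal s (fB k) != 0%R, sets s (vB k)).

(** This and the following equations hold by conversion; they unfold [run] one constructor at a
    time. *)
Lemma run_seq c1 c2 st s : rn (CSeq c1 c2) st s = rn c2 st (rn c1 st s).
Proof. by []. Qed.

Lemma run_if x c st s : rn (CIf x c) st s = if ev s st x then rn c st s else s.
Proof. by []. Qed.

Lemma run_for c st s : rn (CFor c) st s = foldl (fun s a => rn c (a :: st) s) s (enum 'I_n).
Proof. by []. Qed.

Lemma run_map k x st s : sets (rn (CMap k x) st s) k = [set a | ev s (a :: st) x].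
Proof. by rewrite /= eqxx. Qed.

Lemma run_set k x st s : scal (rn (CSet k x) st s) k = Posz (ev s st x).
Proof. by rewrite /= eqxx. Qed.

Lemma run_sum k x st s : scal (rn (CSum k x) st s) k = (\sum_(a | ev s (a :: st) x) w a)%R.
Proof. by rewrite /= eqxx. Qed.

Lemma try_cmdP k st s v : solve_spec k ->
  best_vars k.+1 (rn (try_cmd k (solve_cmd k)) (v :: st) s) =
  let Y := sets s (vX k) in let P := sets s (vP k.+1) in let a := best_vars k.+1 s in
  if v \in P then
    let r := slv k Y (fix_in e Y P v) in
    if r.1 && (~~ a.1 || (set_weight w a.2 < set_weight w r.2)%R) then r else a
  else a.
Proof.
move=> spec; rewrite /try_cmd run_if [ev _ _ _]/=; case: ifP => // vP_.
rewrite !run_seq; set s1 := rn (CMap _ _) _ s.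
have s1X : sets s1 (vX k) = sets s (vX k) by apply: run_sets; rewrite inE /vX /vA; lia.
have s1A : sets s1 (vA k) = fix_in e (sets s (vX k)) (sets s (vP k.+1)) v.
  by rewrite /s1 run_map; apply/setP=> c; rewrite !inE /= -negb_or negbK.
have [] := spec (v :: st) s1; rewrite s1X s1A; set r := slv _ _ _.
set s2 := rn _ _ s1 => s2D s2F.
have s2B : sets s2 (vB k.+1) = sets s (vB k.+1).
  rewrite /s2 run_sets; last by apply/negP=> /wsets_solve[]; rewrite /vB; lia.
  by rewrite /s1 run_sets // inE /vB /vA; lia.
have s2b : scal s2 (fB k.+1) = scal s (fB k.+1).
  by rewrite /s2 run_scal //; apply/negP=> /wscal_solve; rewrite /fB; lia.
set s3 := rn (CSum _ _) _ s2; set s4 := rn (CSum _ _) _ s3.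
have s3D i : sets s3 i = sets s2 i by exact: run_sets.
have s4D i : sets s4 i = sets s2 i by rewrite /s4 run_sets.
have s4sc i : i != fS k.+1 -> i != fT k.+1 -> scal s4 i = scal s2 i.
  move=> iS iT; rewrite /s4 (@run_scal (CSum _ _)) ?inE //.
  by rewrite /s3 (@run_scal (CSum _ _)) ?inE.
have s4S : scal s4 (fS k.+1) = set_weight w r.2.
  rewrite /s4 run_scal /s3 ?run_sum; last by rewrite inE /fS /fT; lia.
  by rewrite -s2D.
have s4T : scal s4 (fT k.+1) = set_weight w (sets s (vB k.+1)).
  by rewrite /s4 run_sum -s2B -s3D.
have s4b : scal s4 (fB k.+1) = scal s (fB k.+1).
  by rewrite -s2b; apply: s4sc; rewrite /fB /fS /fT; lia.
have s4F : (scal s4 (fF k) != 0%R) = r.1.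
  by rewrite -s2F s4sc //; rewrite /fF /fS /fT; lia.
clearbody s4; rewrite run_if eval_and eval_or [ev _ _ (BFlag _)]/= s4F [ev _ _ (BNot _)]/= s4b
  [ev _ _ (BLt _ _)]/= s4S s4T /=.
case: ifP => [/andP[r1 _]|_].
  rewrite [RHS]surjective_pairing r1 -s2D -s4D /best_vars /= !eqxx; congr (_, _).
  by apply/setP=> b; rewrite inE.
by rewrite /best_vars s4b s4D s2B.
Qed.

Lemma wsets_try k i : i \in wsets (try_cmd k (solve_cmd k)) ->
  [/\ i != vX k, i != vP k.+1, i != vA k.+1, i != vX k.+1 & i != vD k.+1].
Proof.
rewrite /= !(mem_cat, inE) => H.
have : (i \in wsets (solve_cmd k)) || ((i == vA k) || (i == vB k.+1)).
  by move: H; case: (i \in _) => //=; rewrite orbF.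
case/orP=> [/wsets_solve[]|]; rewrite /vX /vP /vA /vD /vB => *; split; lia.
Qed.

Lemma best_loopP k st s : solve_spec k ->
  scal s (fB k.+1) = 0%R -> sets s (vB k.+1) = set0 ->
  best_vars k.+1 (rn (CFor (try_cmd k (solve_cmd k))) st s) =
  best e w (slv k) (sets s (vX k)) (sets s (vP k.+1)).
Proof.
move=> spec sc0 se0; rewrite run_for /best.
have -> : (false, set0) = best_vars k.+1 s by rewrite /best_vars sc0 se0 eqxx.
elim: (enum 'I_n) s {sc0 se0} => [//|v l IHl] s.
rewrite [LHS]IHl try_cmdP // (@run_sets (try_cmd _ _) _ _ (vX k)).
  rewrite (@run_sets (try_cmd _ _) _ _ (vP k.+1)) //.
  by apply/negP=> /wsets_try[_]; rewrite eqxx.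
by apply/negP=> /wsets_try[]; rewrite eqxx.
Qed.

Lemma wsets_best k i : i \in wsets (best_cmd k (solve_cmd k)) -> i != vA k.+1 /\ i != vX k.+1.
Proof.
rewrite [wsets _]/= -/(try_cmd k _) !(mem_cat, inE) => H.
have : (i \in wsets (solve_cmd k)) || (i \in [:: vA k; vX k; vP k.+1; vB k.+1; vD k.+1]).
  by move: H; rewrite !inE; case: (i \in _) => //=; lia.
case/orP=> [/wsets_solve[]|]; rewrite ?inE /vX /vP /vA /vD /vB => *; split; lia.
Qed.

Definition solve_vars k (s : state n) := (scal s (fF k) != 0%R, sets s (vD k)).

Lemma best_cmdP k st s u : solve_spec k ->
  solve_vars k.+1 (rn (best_cmd k (solve_cmd k)) (u :: st) s) =
  let A := sets s (vA k.+1) in let X := sets s (vX k.+1) in let a := solve_vars k.+1 s in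
  if u \in A then
    let b := best e w (slv k) (restrict e X (component e A X u)) (component e A X u) in
    (a.1 && b.1, a.2 :|: b.2)
  else a.
Proof.
move=> spec; rewrite /best_cmd run_if [ev _ _ _]/=; case: ifP => // uA.
rewrite (run_seq (comp_cmd _)) (run_seq (CMap (vX _) _)) (run_seq (CSet (fB _) _))
  (run_seq (CMap (vB _) _)) (run_seq (CFor _)) (run_seq (CSet (fF _) _)).
set s1 := rn (comp_cmd _) _ s; set s2 := rn (CMap (vX k) _) _ s1.
set s3 := rn (CSet (fB _) _) _ s2; set s4 := rn (CMap (vB _) _) _ s3.
set s5 := rn (CFor _) _ s4; set s6 := rn (CSet (fF _) _) _ s5.
have s1P := comp_cmd_sets k.+1 st s u; rewrite -/s1 in s1P.
have s4P : sets s4 (vP k.+1) = component e (sets s (vA k.+1)) (sets s (vX k.+1)) u.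
  rewrite -s1P /s4 (@run_sets (CMap _ _)) ?inE; last by rewrite /vP /vB; lia.
  by rewrite /s3 (@run_sets (CSet _ _)) // /s2 (@run_sets (CMap _ _)) ?inE //; rewrite /vP /vX; lia.
have s1X : sets s1 (vX k.+1) = sets s (vX k.+1).
  by apply: run_sets; rewrite /= !inE /vX /vP; lia.
have s4X : sets s4 (vX k) = restrict e (sets s (vX k.+1)) (sets s4 (vP k.+1)).
  rewrite s4P -s1P -s1X /s4 (@run_sets (CMap _ _)) ?inE; last by rewrite /vX /vB; lia.
  rewrite /s3 (@run_sets (CSet _ _)) // /s2 run_map; apply/setP=> x; rewrite !inE.
  by [].
have s4b : scal s4 (fB k.+1) = 0%R.
  by rewrite /s4 (@run_scal (CMap _ _)) // /s3 run_set /= eqxx.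
have s4B : sets s4 (vB k.+1) = set0.
  by rewrite /s4 run_map; apply/setP=> x; rewrite !inE /= eqxx.
have := best_loopP (u :: st) spec s4b s4B; rewrite -/s5 s4X s4P; set b := best _ _ _ _ _ => accb.
have s5D : sets s5 (vD k.+1) = sets s (vD k.+1).
  rewrite /s5 run_sets; last by apply/negP=> /wsets_try[_ _ _ _]; rewrite eqxx.
  rewrite /s4 (@run_sets (CMap _ _)) ?inE; last by rewrite /vD /vB; lia.
  rewrite /s3 (@run_sets (CSet _ _)) // /s2 (@run_sets (CMap _ _)) ?inE; last by rewrite /vD /vX; lia.
  by rewrite /s1 run_sets //= !inE /vD /vP; lia.
have s5F : scal s5 (fF k.+1) = scal s (fF k.+1).
  rewrite /s5 run_scal; last first.
    rewrite /= !(mem_cat, inE); apply/negP=> H.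
    have : (fF k.+1 \in wscal (solve_cmd k)) || (fF k.+1 \in [:: fS k.+1; fT k.+1; fB k.+1]).
      by move: H; rewrite !inE; case: (_ \in _) => //=; lia.
    by case/orP=> [/wscal_solve|]; rewrite ?inE /fF /fS /fT /fB; lia.
  rewrite /s4 (@run_scal (CMap _ _)) // /s3 (@run_scal (CSet _ _)) ?inE; last by rewrite /fF /fB; lia.
  by rewrite /s2 (@run_scal (CMap _ _)) // /s1 run_scal.
have s6F : (scal s6 (fF k.+1) != 0%R) = (scal s (fF k.+1) != 0%R) && b.1.
  by rewrite /s6 run_set eval_and Posz_bool_neq0 -s5F -accb.
rewrite /solve_vars run_map (@run_scal (CMap _ _)) // s6F; congr (_, _).
have s6s i : sets s6 i = sets s5 i by exact: run_sets.
clearbody s6; apply/setP=> x; rewrite !inE eval_or /= !s6s s5D.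
by rewrite -accb.
Qed.

Lemma solve_cmdP k : solve_spec k.
Proof.
elim: k => [|k IHk] st s.
  rewrite [solve_cmd 0]/= run_seq; set s1 := rn (CMap _ _) _ s.
  have s1D : sets s1 (vD 0) = sets s (vA 0) by rewrite /s1 run_map; apply/setP=> a; rewrite inE.
  split; first by rewrite run_sets.
  rewrite run_set Posz_bool_neq0 eval_all; apply: eq_forallb => x.
  have s1X : sets s1 (vX 0) = sets s (vX 0) by exact: run_sets.
  have s1A : sets s1 (vA 0) = sets s (vA 0) by exact: run_sets.
  by clearbody s1; rewrite eval_imp eval_hit /= s1A s1X.
rewrite (run_seq (cl_cmd _)) (run_seq (CSet _ _)) (run_seq (CMap _ _)); set s1 := rn (cl_cmd _) _ s; set s2 := rn (CSet _ _) _ s1.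
set s3 := rn (CMap _ _) _ s2; set X := sets s (vX k.+1).
set A' := cl e X (sets s (vA k.+1)).
have s1A : sets s1 (vA k.+1) = A' by exact: cl_cmd_sets.
have s1X : sets s1 (vX k.+1) = X by apply: run_sets; rewrite /= inE /vX /vA; lia.
have s3s i : i != vD k.+1 -> sets s3 i = sets s1 i.
  by move=> iD; rewrite /s3 (@run_sets (CMap _ _)) ?inE // /s2 run_sets.
have s3A : sets s3 (vA k.+1) = A' by rewrite s3s // /vA /vD; lia.
have s3X : sets s3 (vX k.+1) = X by rewrite s3s // /vX /vD; lia.
have s3acc : solve_vars k.+1 s3 = ([forall x, (x \in X) ==> [exists a, (a \in A') && cn e x a]], set0).
  congr (_, _); last by rewrite /s3 run_map; apply/setP=> x; rewrite !inE /= eqxx.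
  rewrite /s3 (@run_scal (CMap _ _)) // /s2 run_set Posz_bool_neq0 eval_all -s1X -s1A.
  by apply: eq_forallb => x; rewrite eval_imp.
suff H l s' : sets s' (vA k.+1) = A' -> sets s' (vX k.+1) = X ->
    solve_vars k.+1 (foldl (fun s a => rn (best_cmd k (solve_cmd k)) (a :: st) s) s' l) =
    foldl (fun acc u => if u \in A' then
        let b := best e w (slv k) (restrict e X (component e A' X u)) (component e A' X u) in
        (acc.1 && b.1, acc.2 :|: b.2) else acc) (solve_vars k.+1 s') l.
  have := H (enum 'I_n) s3 s3A s3X; rewrite s3acc -run_for /solve_vars => E.
  by split; [exact: (congr1 snd E) | exact: (congr1 fst E)].
elim: l s' => [//|u l IHl] s' A'E XE; rewrite [LHS]IHl.
- rewrite -[RHS]/(foldl _ _ l); congr (foldl _ _ _).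
  by rewrite (best_cmdP _ _ _ IHk) A'E XE.
- by rewrite run_sets //; apply/negP=> /wsets_best[]; rewrite eqxx.
by rewrite run_sets //; apply/negP=> /wsets_best[_]; rewrite eqxx.
Qed.

End Refinement.

(** * Running time, input and output *)

Definition poly_bounded (f : nat -> nat) := exists c k, forall n, f n <= c * n ^ k + c.

(** The 1 is needed for [n = 0], where the power with exponent 0 is 1 and the others vanish. *)
Lemma expn_split n i j : i <= j -> n ^ i <= n ^ j + 1.
Proof.
case: n => [|n] ij; last by rewrite addn1 leqW // leq_pexp2l.
by case: i ij => [|i] ij; [rewrite expn0 addn1 | rewrite exp0n].
Qed.

Lemma poly_const c : poly_bounded (fun=> c).
Proof. by exists c, 0 => n; rewrite leq_addl. Qed.

Lemma poly_id : poly_bounded id.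
Proof. by exists 1, 1 => n; rewrite mul1n expn1 leq_addr. Qed.

Lemma poly_add f g : poly_bounded f -> poly_bounded g -> poly_bounded (fun n => f n + g n).
Proof.
move=> [c [k H]] [d [l G]]; exists (2 * (c + d)), (k + l) => n.
have Hk := expn_split n (leq_addr l k); have Gl := expn_split n (leq_addl k l).
apply: leq_trans (leq_add (H n) (G n)) _.
have := leq_mul (leqnn c) Hk; have := leq_mul (leqnn d) Gl.
by rewrite !mulnDr; lia.
Qed.

Lemma poly_mul f g : poly_bounded f -> poly_bounded g -> poly_bounded (fun n => f n * g n).
Proof.
move=> [c [k H]] [d [l G]]; exists (4 * (c * d)), (k + l) => n.
have Hk := expn_split n (leq_addr l k); have Gl := expn_split n (leq_addl k l).
apply: leq_trans (leq_mul (H n) (G n)) _.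
have := leq_mul (leqnn (c * d)) Hk; have := leq_mul (leqnn (c * d)) Gl.
rewrite expnD; set x := n ^ k in Hk *; set y := n ^ l in Gl *.
rewrite ?mulnDr ?mulnDl; have -> : c * x * (d * y) = c * d * (x * y) by rewrite mulnACA.
have -> : c * (d * y) = c * d * y by rewrite mulnA.
have -> : c * x * d = c * d * x by rewrite mulnAC.
by lia.
Qed.

Ltac poly := repeat first
  [ assumption | apply: poly_add | apply: poly_mul | exact: poly_const | exact: poly_id ].

Lemma poly_texp x : poly_bounded (fun n => texp n x).
Proof. by elim: x => /= *; poly. Qed.

Lemma poly_tcmd c : poly_bounded (fun n => tcmd n c).
Proof. by elim: c => /= *; have := poly_texp; move=> P; poly; exact: P. Qed.

(** Chunks of equal length have addresses linear in their index, which is how the jump on [n] finds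
    its target. *)
Lemma placed_chunks prog a z (f : nat -> seq instr) N i :
  (forall j, size (f j) = z) -> placed prog a (flatten [seq f j | j <- iota 0 N]) ->
  i < N -> placed prog (a + z * i) (f i).
Proof.
move=> szf; suff H k : placed prog a (flatten [seq f j | j <- iota k N]) -> i < N ->
    placed prog (a + z * i) (f (k + i)) by exact: H.
elim: N a k i => [//|N IH] a k i /= /placed_cat[p1 p2].
case: i => [|i] lti; first by rewrite muln0 !addn0.
by have := IH _ k.+1 i p2 lti; rewrite szf mulnS addnA addSnnS.
Qed.

(** * Freeing the low registers *)

Section Machine.
Variables (n : nat) (e : rel 'I_n) (w : 'I_n -> int).
Hypotheses (e_sym : symmetric e) (e_irr : irreflexive e).
Variables (K : nat).
Let s0 := K * 4 + 10.
Let inp := encode_input e w.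

Lemma inp_edge (i j : 'I_n) : inp (1 + i * n + j) = Posz (e i j).
Proof.
rewrite /inp /encode_input add1n addSn /=.
have lt : i * n + j < n * n.
  have := ltn_ord i; have := ltn_ord j => jn i_n.
  have : i.+1 * n <= n * n by rewrite leq_mul2r i_n orbT.
  by rewrite mulSn; lia.
have n0 : 0 < n := leq_ltn_trans (leq0n i) (ltn_ord i).
rewrite lt divnMDl // divn_small // addn0 modnMDl modn_small //.
by rewrite !insubT ?ltn_ord // => *; congr (Posz (nat_of_bool (e _ _))); exact: val_inj.
Qed.

Lemma inp_w (i : 'I_n) : inp (1 + n * n + i) = w i.
Proof.
rewrite /inp /encode_input add1n addSn /=.
rewrite ltnNge leq_addr /= ltn_add2l ltn_ord addKn.
by case: insubP => [u _ ui|]; [congr (w _); exact: val_inj | rewrite ltn_ord].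
Qed.

Lemma inp_out a : 1 + n * n + n <= a -> inp a = 0%R.
Proof.
case: a => [|a]; first by lia.
move=> H; rewrite /inp /encode_input /=.
by rewrite !ifN //; lia.
Qed.

(** Register 1 holds a diagonal entry, or nothing if [n = 0]. Its value is therefore known, and it
    can be used before anything has been moved. *)
Lemma inp_1 : inp 1 = 0%R.
Proof.
case: (posnP n) => [n0|n0]; first by apply: inp_out; rewrite n0.
by have := inp_edge (Ordinal n0) (Ordinal n0); rewrite mul0n !addn0 e_irr.
Qed.

(* The input matrix stands at address aj, except that row 0 may have been overwritten. *)
Record input_at aj (m : store) : Prop := InputAt {
  in_n : m 0 = Posz n;
  in_4 : m 4 = Posz aj;
  in_s0 : s0 <= aj + n;
  in_aj : 0 < aj;
  in_edge : forall i j : 'I_n, 0 < i -> m (aj + i * n + j) = Posz (e i j);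
  in_w : forall i : 'I_n, m (aj + n * n + i) = w i;
  in_out : forall a, aj + n * n + n <= a -> m a = 0%R }.

(* For n < s0, the program counter records n and the whole input is copied from [0, M) to [M, 2 M); for n >= s0, row
   0 of the matrix occupies registers 1 to n at least, it is recovered from column 0, and its registers are free. *)
Let M := s0 * s0 + s0 + 2.
Definition pos_large := 1 + 2 * s0.
Definition pos_small := pos_large + 5.
Definition pos_shift := pos_small + 3 * s0.
Definition pos_main := pos_shift + M + 1.

Definition detect_code := IConst 1 1 ::
  flatten [seq [:: IJz 0 (pos_small + 3 * c); ISub 0 0 1] | c <- iota 0 s0].
Definition large_code :=
  [:: IConst 1 (Posz s0); IAdd 0 0 1; IConst 4 1; IConst 1 0; IJz 1 pos_main].
Definition small_code :=
  flatten [seq [:: IConst 0 (Posz c); IConst 1 0; IJz 1 pos_shift] | c <- iota 0 s0].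
(** For [n < s0] the input is shorter than [M], so register [2 * M] is zero and adding it is a move.
    The matrix, formerly at 1, is then found at [M + 1]. *)
Definition shift_code := [seq IAdd (i + M) i (2 * M) | i <- iota 0 M] ++ [:: IConst 4 (Posz M.+1)].
Definition pre_code := detect_code ++ large_code ++ small_code ++ shift_code.

Lemma size_chunks z (f : nat -> seq instr) N :
  (forall j, size (f j) = z) -> size (flatten [seq f j | j <- iota 0 N]) = z * N.
Proof.
move=> szf; suff H k : size (flatten [seq f j | j <- iota k N]) = z * N by [].
by elim: N k => [|N IH] k /=; rewrite ?muln0 // size_cat IH szf mulnS.
Qed.

Lemma size_detect : size detect_code = pos_large.
Proof. by rewrite /= (@size_chunks 2). Qed.

Lemma size_small : size small_code = 3 * s0.
Proof. exact: (@size_chunks 3). Qed.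

Lemma size_shift : size shift_code = M + 1.
Proof. by rewrite size_cat size_map size_iota. Qed.

Lemma size_pre : size pre_code = pos_main.
Proof.
rewrite /pre_code size_cat [size (large_code ++ _)]size_cat [size (small_code ++ _)]size_cat.
by rewrite size_detect size_small size_shift /pos_main /pos_shift /pos_small /=; lia.
Qed.

(** The sources lie below [M] or at [2 * M], the targets between, so the moves do not interfere. *)
Lemma shift_effect (m : store) N : N <= M ->
  let m' := foldl eff m [seq IAdd (i + M) i (2 * M) | i <- iota 0 N] in
  forall a, m' a = if M <= a < M + N then (m (a - M)%N + m (2 * M)%N)%R else m a.
Proof.
elim: N => [|N IH] leN m' a.
  by rewrite /m' /= ifN //; lia.
have {}IH := IH (ltnW leN).
rewrite /m' -[N.+1]addn1 iotaD map_cat foldl_cat /= /upd.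
set m1 := foldl _ _ _ in IH *; rewrite !{}IH.
case: eqP => [->|aN].
  rewrite [N + M]addnC leq_addr addnA addn1 ltnSn /= addKn.
  by rewrite !ifN //; lia.
by congr (if _ then _ else _); lia.
Qed.

Lemma detect prog c : placed prog 0 pre_code -> c <= n -> c <= s0 ->
  exists m, [/\ exec prog (1 + 2 * c) (init_config e w) = Config (1 + 2 * c) m,
    m 0 = (Posz n - Posz c)%R, m 1 = 1%R & forall a, 1 < a -> m a = inp a].
Proof.
move=> pl; have [/placed_cons[p0 pd] _] := placed_cat pl.
elim: c => [|c IH] cn cs.
  exists (upd inp 1 1); rewrite muln0 addn0 /init_config (exec_straight _ _ p0) //=.
  by split=> // [|a a1]; rewrite ?subr0 // upd_other //; lia.
have [m [E m0 m1 mi]] := IH (ltnW cn) (ltnW cs).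
have /placed_cons[q0 /placed_cons[q1 _]] :=
  @placed_chunks _ _ 2 (fun c => [:: IJz 0 (pos_small + 3 * c); ISub 0 0 1]) _ c (fun _ => erefl) pd cs.
exists (upd m 0 (m 0 - m 1)%R); have -> : 1 + 2 * c.+1 = 1 + 2 * c + 2 by lia.
rewrite exec_add E (exec_jz _ _ q0) ifN; last by rewrite m0; lia.
rewrite (exec_straight _ _ q1) //; split.
- by rewrite addn2.
- by rewrite upd_same m0 m1; lia.
- by rewrite upd_other.
by move=> a a1; rewrite upd_other ?mi //; lia.
Qed.

Lemma pre_codeP prog : placed prog 0 pre_code ->
  exists t m aj, [/\ t <= 2 * s0 + M + 10,
    exec prog t (init_config e w) = Config pos_main m & input_at aj m].
Proof.
move=> pl; have [pd /placed_cat[pL /placed_cat[pS psh]]] := placed_cat pl.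
rewrite size_detect add0n in pL pS psh.
rewrite size_small in psh.
have [ns|ns] := leqP s0 n.
  have [m [E m0 m1 mi]] := detect pl ns (leqnn _).
  move: pL => /placed_cons[q0 /placed_cons[q1 /placed_cons[q2 /placed_cons[q3 /placed_cons[q4 _]]]]].
  pose m' := upd (upd (upd (upd m 1 (Posz s0)) 0 (Posz n)) 4 1%R) 1 0%R.
  exists (1 + 2 * s0 + 5), m', 1; split; first by lia.
    rewrite exec_add E -/pos_large (exec_straight _ _ q0) // (exec_straight _ _ q1) //.
    rewrite (exec_straight _ _ q2) // (exec_straight _ _ q3) // (exec_jz _ _ q4) /=.
    have -> : (upd m 1 (Posz s0) 0 + upd m 1 (Posz s0) 1)%R = Posz n.
      by rewrite upd_same upd_other // m0; lia.
    by [].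
  have out a : 4 < a -> m' a = inp a.
    by move=> a4; rewrite /m' !upd_other ?mi //; lia.
  (* The overwritten registers 1 and 4 belong to row 0, about which [in_edge] claims nothing. *)
  have n4 : 4 < n by move: ns; rewrite /s0; lia.
  split=> //.
  - by lia.
  - move=> i j i0; rewrite out ?inp_edge //.
    have : 1 * n <= i * n by rewrite leq_mul2r i0 orbT.
    by lia.
  - move=> i; rewrite out ?inp_w //; have : n <= n * n by rewrite leq_pmulr //; lia.
    by lia.
  - by move=> a Ha; rewrite out ?inp_out //; lia.
have [m [E m0 m1 mi]] := detect pl (leqnn n) (ltnW ns).
have /placed_cons[q0 _] :=
  @placed_chunks _ _ 2 (fun c => [:: IJz 0 (pos_small + 3 * c); ISub 0 0 1]) _ n (fun _ => erefl)
    (proj2 (placed_cons pd)) ns.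
have /placed_cons[r0 /placed_cons[r1 /placed_cons[r2 _]]] :=
  @placed_chunks _ _ 3 (fun c => [:: IConst 0 (Posz c); IConst 1 0; IJz 1 pos_shift]) _ n (fun _ => erefl) pS ns.
have [psh1 /placed_cons[r3 _]] := placed_cat psh.
rewrite size_map size_iota in r3.
pose m2 := upd (upd m 0 (Posz n)) 1 0%R.
have m2i a : m2 a = inp a.
  rewrite /m2 /upd; case: eqP => [->|a1]; first by rewrite inp_1.
  case: eqP => [->|a0] //; apply: mi; lia.
have [t [m3 [let_ E3 m3E]]] : exists t m3, [/\ t <= M, exec prog t (Config pos_shift m2) =
    Config (pos_shift + M) m3 & forall a, m3 a = if M <= a < 2 * M then inp (a - M) else inp a].
  pose l := [seq IAdd (i + M) i (2 * M) | i <- iota 0 M].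
  have sl : all straight l by rewrite all_map; apply/allP.
  have nn : n * n <= s0 * s0 by rewrite leq_mul // ltnW.
  case: (tri_asm (m := m2) (Q := fun m => m = foldl eff m2 l) sl erefl) => H.
  have [t [m3 [let_ E3 m3E]]] := H prog pos_shift psh1; rewrite /= in m3E; rewrite m3E in E3; exists t, (foldl eff m2 l); split=> //.
  + by move: let_; rewrite size_map size_iota.
  + by rewrite E3 /asm size_map size_iota.
  move=> a; rewrite (shift_effect m2 (leqnn M)) -[M + M]/(M + M) mul2n -addnn !m2i.
  case: ifP => // _; rewrite [inp (M + M)]inp_out ?addr0 //.
  by rewrite /M; lia.
exists (1 + 2 * n + (1 + (3 + (t + 1)))), (upd m3 4 (Posz M.+1)), M.+1; split; first by lia.
  rewrite exec_add E exec_add (exec_jz _ _ q0) m0 subrr eqxx.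
  rewrite exec_add (exec_straight _ _ r0) // (exec_straight _ _ r1) // (exec_jz _ _ r2) /=.
  rewrite -/m2 exec_add E3 (exec_straight _ _ r3) //=.
  by rewrite /pos_main addn1.
have nn : n * n <= s0 * s0 by rewrite leq_mul // ltnW.
have M4 : 10 < M by rewrite /M /s0; lia.
have lo a : 0 < a -> a < 1 + n * n + n -> upd m3 4 (Posz M.+1) (M + a) = inp a.
  move=> a0 aM; rewrite upd_other; last by lia.
  rewrite m3E leq_addr addKn ifT //; rewrite /M; lia.
split=> //.
- by rewrite upd_other // m3E ifN //; lia.
- by rewrite /M; lia.
- move=> i j i0; rewrite -inp_edge -lo ?add1n //; last first.
    have := ltn_ord i; have := ltn_ord j => jn i_n.
    have : i.+1 * n <= n * n by rewrite leq_mul2r i_n orbT.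
    by rewrite mulSn; lia.
  by congr (upd _ _ _ _); lia.
- move=> i; rewrite -inp_w -lo ?add1n //; last by have := ltn_ord i; lia.
  by congr (upd _ _ _ _); lia.
move=> a Ha; rewrite upd_other; last by lia.
by rewrite m3E; case: ifP => _; apply: inp_out; lia.
Qed.

End Machine.

(** * Building the memory layout *)

Section Setup.
Variables (n : nat) (e : rel 'I_n) (w : 'I_n -> int).
Hypothesis e_sym : symmetric e.
Variables (K aj : nat).
Hypothesis K_gt0 : 0 < K.
Let s0 := K * 4 + 10.
Let F := Fp n aj.

(** Each array starts [n] cells after the previous one, the first of them [n] cells after the
    temporary array. *)
Definition base_code := [seq IAdd (rB k) (if k == 0 then 7 else rB k.-1) 0 | k <- iota 0 K].

Definition setup_regs : block :=
  seqb (asm [:: IConst 1 0; IAdd 6 4 1])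
  (seqb (forb (rI 0) (asm [:: IAdd 6 6 0]))
  (seqb (asm [:: IAdd 5 6 0; IAdd 8 5 0; IAdd 9 8 0; IAdd 7 9 0; IConst 1 1; IAdd 7 7 1])
    (asm base_code))).

Definition setup_rows : block :=
  seqb (asm [:: IConst 1 0; IAdd 2 4 1])
  (seqb (forb (rI 0) (asm [:: IAdd 1 5 (rI 0); IStore 1 2; IAdd 2 2 0]))
    (asm [:: IStore 5 8])).

(** By symmetry, column 0 is copied in place of row 0. The entry at (0, 0) may be arbitrary here;
    [setup_diag] corrects it. *)
Definition setup_row0 : block :=
  seqb (asm [:: IConst 1 0; IAdd 2 4 1])
    (forb (rI 0) (asm [:: ILoad 3 2; IAdd 1 8 (rI 0); IStore 1 3; IAdd 2 2 0])).

(** Ones on the diagonal turn adjacency into the closed adjacency [cn]. *)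
Definition setup_diag : block :=
  forb (rI 0) (asm [:: IAdd 1 5 (rI 0); ILoad 1 1; IAdd 1 1 (rI 0); IConst 2 1; IStore 1 2]).

Definition setup : block := seqb setup_regs (seqb setup_rows (seqb setup_row0 setup_diag)).

Definition setup_time m := (2 + ((m * (1 + 6) + 3) + (6 + K))) +
  ((2 + ((m * (3 + 6) + 3) + 1)) + ((2 + (m * (4 + 6) + 3)) + (m * (5 + 6) + 3))).

Record regs_at (m : store) : Prop := RegsAt {
  ra_0 : m 0 = Posz n;
  ra_4 : m 4 = Posz aj;
  ra_5 : m 5 = Posz F;
  ra_6 : m 6 = Posz (Wp n aj);
  ra_7 : m 7 = Posz (tmpp n aj);
  ra_8 : m 8 = Posz (F + n);
  ra_base : forall k, k < K -> m (rB k) = Posz (setp n aj k) }.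

Definition same_low (m m' : store) :=
  forall a, a < s0 -> a != 1 -> a != 2 -> a != 3 -> a != 10 -> m' a = m a.

Lemma regs_frame m m' : regs_at m -> same_low m m' -> regs_at m'.
Proof.
move=> [r0 r4 r5 r6 r7 r8 rb] H; split; rewrite ?H //; try by rewrite /s0; lia.
by move=> k kK; rewrite H ?rb // /rB /s0; lia.
Qed.

Lemma base_effect m N : m 0 = Posz n -> m 7 = Posz (tmpp n aj) ->
  let m' := foldl eff m [seq IAdd (rB k) (if k == 0 then 7 else rB k.-1) 0 | k <- iota 0 N] in
  (forall k, k < N -> m' (rB k) = Posz (setp n aj k)) /\
  (forall a, (forall k, k < N -> a <> rB k) -> m' a = m a).
Proof.
move=> m0 m7; elim: N => [//|N [IH1 IH2]] m'.
rewrite /m' -[N.+1]addn1 iotaD map_cat foldl_cat /=.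
set m1 := foldl _ _ _ in IH1 IH2 *.
have m10 : m1 0 = Posz n by rewrite IH2 // => k _; rewrite /rB; lia.
split=> [k|a Ha].
  rewrite addn1 ltnS leq_eqVlt => /orP[/eqP->|kN]; last first.
    by rewrite upd_other ?IH1 // /rB; lia.
  have -> : m1 (if N == 0 then 7 else rB N.-1) = Posz (tmpp n aj + N * n).
    case: eqP => [->|/eqP]; first by rewrite IH2 ?m7 ?addn0 // => k' _; rewrite /rB; lia.
    rewrite -lt0n => N0; rewrite IH1 ?prednK // /setp /tmpp.
    by rewrite -{2}(prednK N0) mulSn; congr Posz; lia.
  by rewrite upd_same m10 /setp /tmpp; congr Posz; lia.
rewrite upd_other ?IH2 //; last by apply: Ha; rewrite addn1.
by move=> k kN; apply: Ha; rewrite addn1 ltnS ltnW.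
Qed.

Lemma setup_regsP m : input_at e w K aj m ->
  tri setup_regs m (2 + ((n * (1 + 6) + 3) + (6 + K)))
    (fun m' => regs_at m' /\ forall a, s0 <= a -> m' a = m a).
Proof.
move=> [m0 m4 _ _ _ _ _].
apply: (@tri_seq _ _ _ 2); apply: tri_asm => //; set m1 := foldl eff m _.
have m1E a : a <> 1 -> a <> 6 -> m1 a = m a by move=> a1 a6; rewrite /m1 /= !upd_other.
have m16 : m1 6 = Posz aj by rewrite /m1 /= upd_same upd_same upd_other // m4 addr0.
clearbody m1.
pose I j (m' : store) := [/\ m' 0 = Posz n, m' 4 = Posz aj, m' 6 = Posz (aj + j * n) &
  forall a, s0 <= a -> m' a = m a].
apply: tri_seq; apply: (@tri_weaken _ _ _ _ (I n) _ _ (leqnn _)); last first.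
  move=> m2 [m20 m24 m26 m2E].
  apply: (@tri_seq _ _ _ 6); apply: tri_asm => //; set m3 := foldl eff m2 _.
  have m3E a : a <> 1 -> a <> 5 -> a <> 7 -> a <> 8 -> a <> 9 -> m3 a = m2 a.
    by move=> *; rewrite /m3 /= !upd_other.
  have m35 : m3 5 = Posz F by rewrite /m3 /= /upd /= m26 m20.
  have m38 : m3 8 = Posz (F + n) by rewrite /m3 /= /upd /= m26 m20.
  have m37 : m3 7 = Posz (tmpp n aj).
    by rewrite /m3 /= /upd /= m26 m20 /tmpp -/F /=; congr Posz; rewrite /F /Fp /Wp; lia.
  clearbody m3.
  have m30 : m3 0 = Posz n by rewrite m3E.
  have := base_effect K m30 m37; rewrite -/base_code => -[B1 B2].
  apply: (@tri_weaken _ _ (size base_code)).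
  - apply: (@tri_asm _ _ (fun m' => m' = foldl eff m3 base_code)) => //.
    by rewrite all_map; apply/allP.
  - by rewrite size_map size_iota.
  move=> _ ->; split.
    have E9 a : a <= 9 -> foldl eff m3 base_code a = m3 a.
      by move=> a9; apply: B2 => k _; rewrite /rB; lia.
    by split; rewrite ?E9 ?m30 ?m35 ?m37 ?m38 // m3E.
  move=> a sa; rewrite B2; last by move=> k kK; move: sa; rewrite /s0 /rB; lia.
  by rewrite m3E ?m2E //; move: sa; rewrite /s0; lia.
apply: tri_loop.
- by rewrite m1E ?m0.
- move=> j m2 m3 [m20 m24 m26 m2E] H; split; rewrite ?H //.
  by move=> a sa; rewrite H ?m2E //; move: sa; rewrite /s0 /rI; lia.
- split; rewrite ?m16 ?m1E ?addn0 ?m0 ?m4 //.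
  by move=> a sa; apply: m1E; move: sa; rewrite /s0; lia.
move=> a m2 m2a _ [m20 m24 m26 m2E]; apply: tri_asm => //=.
split; rewrite ?upd_other //; split; rewrite ?upd_same ?upd_other //.
  by rewrite m26 m20; congr Posz; rewrite mulSn; lia.
by move=> b sb; rewrite upd_other ?m2E //; move: sb; rewrite /s0; lia.
Qed.

Hypothesis s0_aj : s0 <= aj + n.
Hypothesis aj_gt0 : 0 < aj.

Lemma F_ge : s0 <= F.
Proof.
case: (posnP n) => [n0|n0]; first by move: s0_aj; rewrite /F /Fp /Wp n0; lia.
by have := Wp_ge s0_aj n0; rewrite /F /Fp; lia.
Qed.

(** The last store redirects entry 0 of the table to the copy of row 0. If [n = 0] the table is
    empty and the store falls just behind it, hence the summand [(n == 0)]. *)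
Lemma setup_rowsP m : regs_at m ->
  tri setup_rows m (2 + ((n * (3 + 6) + 3) + 1))
    (fun m' => [/\ regs_at m', forall i : 'I_n, m' (F + i) = Posz (rowp n aj i) &
      forall a, s0 <= a -> a < F \/ F + n + (n == 0) <= a -> m' a = m a]).
Proof.
move=> R; have Fge := F_ge.
apply: (@tri_seq _ _ _ 2); apply: tri_asm => //; set m1 := foldl eff m _.
have R1 : regs_at m1 by apply: regs_frame R _ => a _ a1 a2 _ _; rewrite /m1 /= !upd_other //; exact/eqP.
have m12 : m1 2 = Posz aj by rewrite /m1 /= upd_same upd_same upd_other // (ra_4 R) addr0.
have m1E a : s0 <= a -> m1 a = m a by move=> sa; rewrite /m1 /= !upd_other //; move: sa; rewrite /s0; lia.
clearbody m1.
pose I j (m' : store) := [/\ regs_at m', m' 2 = Posz (aj + j * n),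
  forall i : 'I_n, i < j -> m' (F + i) = Posz (aj + i * n) &
  forall a, s0 <= a -> a < F \/ F + n <= a -> m' a = m a].
apply: tri_seq; apply: (@tri_weaken _ _ _ _ (I n) _ _ (leqnn _)); last first.
  move=> m2 [R2 m22 m2F m2E]; apply: tri_asm => //=; rewrite (ra_5 R2) (ra_8 R2) /=.
  split.
  - by apply: regs_frame R2 _ => a sa _ _ _ _; rewrite upd_other //; lia.
  - move=> i; rewrite /rowp; case: eqP => [->|/eqP i0]; first by rewrite addn0 upd_same.
    by rewrite upd_other ?m2F //; lia.
  by move=> a sa Ha; rewrite upd_other ?m2E //; case: (posnP n) Ha => [->|n0]; lia.
apply: tri_loop.
- exact: ra_0 R1.
- move=> j m2 m3 [R2 m22 m2F m2E] H; split.
  + by apply: regs_frame R2 _ => a _ a1 _ _ a10; apply: H; exact/eqP.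
  + by rewrite H.
  + by move=> i ij; rewrite H ?m2F //; move: Fge; rewrite /s0 /rI; lia.
  + by move=> a sa Ha; rewrite H ?m2E //; move: sa; rewrite /s0 /rI; lia.
- by split=> //; [rewrite m12 addn0 | move=> a sa _; exact: m1E].
move=> a m2 m2a _ [R2 m22 m2F m2E]; apply: tri_asm => //=.
set m3 := upd m2 1 _; have m31 : m3 1 = Posz (F + a) by rewrite /m3 upd_same (ra_5 R2) m2a.
have m3E i : i <> 1 -> m3 i = m2 i by exact: upd_other.
rewrite m31 /= m3E // m22; clearbody m3; set m4 := upd m3 _ _; set m5 := upd m4 _ _.
have an := ltn_ord a.
have E i : i <> 1 -> i <> 2 -> i <> F + a -> m5 i = m2 i.
  by move=> i1 i2 iF; rewrite /m5 upd_other // /m4 upd_other // m3E.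
have m5F : m5 (F + a) = Posz (aj + a * n).
  by rewrite /m5 upd_other ?/m4 ?upd_same //; move: Fge; rewrite /s0; lia.
have R5 : regs_at m5.
  by apply: regs_frame R2 _ => i si i1 i2 _ _; apply: E; try exact/eqP; lia.
split; [by rewrite E //; move: Fge; rewrite /s0 /rI; lia | exact: ra_0 R5 |].
split=> //.
- rewrite /m5 upd_same /m4 !upd_other; try by move: Fge; rewrite /s0; lia.
  by rewrite !m3E // m22 (ra_0 R2); congr Posz; rewrite mulSn; lia.
- move=> i; rewrite ltnS leq_eqVlt => /orP[/eqP ia|ia]; first by rewrite ia.
  by rewrite E ?m2F //; move: Fge; rewrite /s0; lia.
by move=> i si Hi; rewrite E ?m2E //; move: si; rewrite /s0; lia.
Qed.

Lemma setup_row0P m : regs_at m ->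
  tri setup_row0 m (2 + (n * (4 + 6) + 3))
    (fun m' => [/\ regs_at m',
      forall i : 'I_n, 0 < i -> m' (F + n + i) = m (aj + i * n) &
      forall a, s0 <= a -> a < F + n \/ F + 2 * n <= a -> m' a = m a]).
Proof.
move=> R; have Fge := F_ge.
apply: (@tri_seq _ _ _ 2); apply: tri_asm => //; set m1 := foldl eff m _.
have R1 : regs_at m1 by apply: regs_frame R _ => a _ a1 a2 _ _; rewrite /m1 /= !upd_other //; exact/eqP.
have m12 : m1 2 = Posz aj by rewrite /m1 /= upd_same upd_same upd_other // (ra_4 R) addr0.
have m1E a : s0 <= a -> m1 a = m a by move=> sa; rewrite /m1 /= !upd_other //; move: sa; rewrite /s0; lia.
clearbody m1.
pose I j (m' : store) := [/\ regs_at m', m' 2 = Posz (aj + j * n),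
  forall i : 'I_n, 0 < i < j -> m' (F + n + i) = m (aj + i * n) &
  forall a, s0 <= a -> a < F + n \/ F + 2 * n <= a -> m' a = m a].
apply: (@tri_weaken _ _ _ _ (I n) _ _ (leqnn _)); last first.
  by move=> m2 [R2 m22 m2F m2E]; split=> // i i0; rewrite m2F // i0 ltn_ord.
apply: tri_loop.
- exact: ra_0 R1.
- move=> j m2 m3 [R2 m22 m2F m2E] H; split.
  + by apply: regs_frame R2 _ => a _ a1 _ _ a10; apply: H; exact/eqP.
  + by rewrite H.
  + by move=> i ij; rewrite H ?m2F //; move: Fge; rewrite /s0 /rI; lia.
  + by move=> a sa Ha; rewrite H ?m2E //; move: sa; rewrite /s0 /rI; lia.
- split=> //; [by rewrite m12 addn0 | by move=> i; rewrite ltn0 andbF | ].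
  by move=> a sa _; exact: m1E.
move=> a m2 m2a _ [R2 m22 m2F m2E]; apply: tri_asm => //=.
rewrite m22 /=; set v := m2 (aj + a * n); set m3 := upd m2 3 v.
have m3E i : i <> 3 -> m3 i = m2 i by exact: upd_other.
have m33 : m3 3 = v by exact: upd_same.
clearbody m3; set m4 := upd m3 1 _.
have m41 : m4 1 = Posz (F + n + a) by rewrite /m4 upd_same !m3E // (ra_8 R2) m2a.
have m4E i : i <> 1 -> m4 i = m3 i by exact: upd_other.
rewrite m41 /= m4E // m33; clearbody m4; set m5 := upd m4 _ _; set m6 := upd m5 _ _.
have an := ltn_ord a.
have E i : i <> 1 -> i <> 2 -> i <> 3 -> i <> F + n + a -> m6 i = m2 i.
  by move=> i1 i2 i3 iF; rewrite /m6 upd_other // /m5 upd_other // m4E // m3E.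
have m6F : m6 (F + n + a) = v.
  by rewrite /m6 upd_other ?/m5 ?upd_same //; move: Fge; rewrite /s0; lia.
have R6 : regs_at m6.
  by apply: regs_frame R2 _ => i si i1 i2 i3 _; apply: E; try exact/eqP; lia.
split; [by rewrite E //; move: Fge; rewrite /s0 /rI; lia | exact: ra_0 R6 |].
split=> //.
- rewrite /m6 upd_same /m5 !upd_other; try by move: Fge; rewrite /s0; lia.
  by rewrite !m4E // !m3E // m22 (ra_0 R2); congr Posz; rewrite mulSn; lia.
- move=> i /andP[i0]; rewrite ltnS leq_eqVlt => /orP[/eqP ia|ia].
    rewrite ia m6F /v; have n0 : n <= a * n by rewrite leq_pmull // -ia.
    have : a.+1 * n <= n * n by rewrite leq_mul2r an orbT.
    by rewrite mulSn => aN; apply: m2E; [lia | left; rewrite /F /Fp /Wp; lia].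
  by rewrite E ?m2F ?i0 //; move: Fge; rewrite /s0; lia.
by move=> i si Hi; rewrite E ?m2E //; move: si; rewrite /s0; lia.
Qed.

Lemma rowp_inj (i i' j j' : 'I_n) : rowp n aj i + j = rowp n aj i' + j' -> i = i' /\ j = j'.
Proof.
have R := rowp_bound s0_aj i j; have R' := rowp_bound s0_aj i' j'.
have n0 : 0 < n := leq_ltn_trans (leq0n i) (ltn_ord i).
move: R R'; rewrite /rowp.
case: (eqVneq (nat_of_ord i) 0) => i0; case: (eqVneq (nat_of_ord i') 0) => i'0 R R' E;
  try by [split; apply: val_inj => /=; lia | move: R R' E; rewrite /Fp; lia].
have {}E : i * n + j = i' * n + j' by lia.
have := congr1 (fun x => x %/ n) E; have := congr1 (fun x => x %% n) E.
rewrite /= !modnMDl !modn_small // !divnMDl // !divn_small // !addn0 => jj ii.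
by split; exact: val_inj.
Qed.

Lemma setup_diagP m : regs_at m -> (forall i : 'I_n, m (F + i) = Posz (rowp n aj i)) ->
  tri setup_diag m (n * (5 + 6) + 3)
    (fun m' => [/\ regs_at m',
      forall i : 'I_n, m' (rowp n aj i + i) = 1%R &
      forall a, s0 <= a -> (forall i : 'I_n, a <> rowp n aj i + i) -> m' a = m a]).
Proof.
move=> R Frow; have Fge := F_ge.
pose I j (m' : store) := [/\ regs_at m',
  forall i : 'I_n, i < j -> m' (rowp n aj i + i) = 1%R &
  forall a, s0 <= a -> (forall i : 'I_n, a <> rowp n aj i + i) -> m' a = m a].
have rge (i j : 'I_n) : s0 <= rowp n aj i + j.
  by have := rowp_bound s0_aj i j; move: Fge; rewrite /F -/s0; lia.
have rF (i j k : 'I_n) : F + k <> rowp n aj i + j.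
  by have := rowp_bound s0_aj i j; have := ltn_ord k; rewrite /F /Fp; lia.
apply: (@tri_weaken _ _ _ _ (I n) _ _ (leqnn _)); last first.
  by move=> m2 [R2 m2F m2E]; split=> // i; rewrite m2F.
apply: tri_loop.
- exact: ra_0 R.
- move=> j m2 m3 [R2 m2F m2E] H; split.
  + by apply: regs_frame R2 _ => a _ a1 _ _ a10; apply: H; exact/eqP.
  + by move=> i ij; rewrite H ?m2F //; have := rge i i; rewrite /s0 /rI; lia.
  + by move=> a sa Ha; rewrite H ?m2E //; move: sa; rewrite /s0 /rI; lia.
- by split.
move=> a m2 m2a _ [R2 m2F m2E]; apply: tri_asm => //=.
have m2Fa : m2 (F + a) = Posz (rowp n aj a) by rewrite m2E ?Frow //; lia.
set m3 := upd m2 1 _; have m31 : m3 1 = Posz (F + a) by rewrite /m3 upd_same (ra_5 R2) m2a.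
have m3E i : i <> 1 -> m3 i = m2 i by exact: upd_other.
rewrite m31 /=; clearbody m3; set m4 := upd m3 1 _.
have m41 : m4 1 = Posz (rowp n aj a).
  by rewrite /m4 upd_same m3E ?m2Fa //; move: Fge; rewrite /s0; lia.
have m4E i : i <> 1 -> m4 i = m2 i by move=> i1; rewrite /m4 upd_other ?m3E.
clearbody m4; set m5 := upd m4 1 _.
have m51 : m5 1 = Posz (rowp n aj a + a) by rewrite /m5 upd_same m41 m4E ?m2a.
have m5E i : i <> 1 -> m5 i = m2 i by move=> i1; rewrite /m5 upd_other ?m4E.
clearbody m5; set m5' := upd m5 2 1%R.
have m5'1 : m5' 1 = Posz (rowp n aj a + a) by rewrite /m5' upd_other.
have m5'2 : m5' 2 = 1%R by rewrite /m5' upd_same.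
rewrite m5'1 m5'2 /=; set m6 := upd m5' _ _.
have E i : i <> 1 -> i <> 2 -> i <> rowp n aj a + a -> m6 i = m2 i.
  by move=> i1 i2 ia; rewrite /m6 /m5' !upd_other // m5E.
have aa := rge a a.
have R6 : regs_at m6.
  by apply: regs_frame R2 _ => i si i1 i2 _ _; apply: E; try exact/eqP; lia.
split; [by rewrite E //; move: aa; rewrite /s0 /rI; lia | exact: ra_0 R6 |].
split=> //.
- move=> i; rewrite ltnS leq_eqVlt => /orP[/eqP ia|ia].
    by rewrite (val_inj ia : i = a) /m6 upd_same.
  rewrite E ?m2F //; try by have := rge i i; rewrite /s0; lia.
  by case/rowp_inj => ia' _; rewrite ia' ltnn in ia.
by move=> i si Hi; rewrite E ?m2E //; move: si; rewrite /s0; lia.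
Qed.

Lemma setupP m : input_at e w K aj m ->
  tri setup m (setup_time n) (fun m' => exists2 s, represents e w K aj s [::] m' &
    forall k, sets s k = set0).
Proof.
move=> Im; have Fge := F_ge; have [_ _ _ _ Ie Iw Io] := Im.
apply: tri_seq; apply: (tri_weaken (setup_regsP Im)) => // m1 [R1 m1E].
apply: tri_seq; apply: (tri_weaken (setup_rowsP R1)) => // m2 [R2 m2F m2E].
apply: tri_seq; apply: (tri_weaken (setup_row0P R2)) => // m3 [R3 m3F m3E].
have m3row (i : 'I_n) : m3 (F + i) = Posz (rowp n aj i).
  by rewrite m3E ?m2F //; have := ltn_ord i; lia.
apply: (tri_weaken (setup_diagP R3 m3row)) => // m4 [R4 m4D m4E].
have inW a : s0 <= a -> a < F -> (forall i : 'I_n, a <> rowp n aj i + i) -> m4 a = m a.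
  by move=> sa aF aD; rewrite m4E // m3E ?m2E ?m1E //; lia.
have nrow a (i : 'I_n) : Wp n aj <= a -> a < F + n \/ F + 2 * n <= a -> a <> rowp n aj i + i.
  by have := rowp_bound s0_aj i i; rewrite /F /Fp; lia.
exists (State (fun=> set0) (fun k => m4 (rS k))) => //.
have [r0 r4 r5 r6 r7 r8 rb] := R4.
split=> //.
- move=> i; rewrite m4E ?m3row //; first by rewrite /F in Fge *; lia.
  by move=> j; apply: nrow; rewrite /F /Fp; have := ltn_ord i; lia.
- move=> i j; have [->|ij] := eqVneq j i; first by rewrite m4D cnn.
  rewrite /cn (negbTE ij) /=; have R := rowp_bound s0_aj i j.
  rewrite m4E; last by move=> k /rowp_inj[ik jk]; rewrite ik jk eqxx in ij.
    rewrite /rowp; case: eqP => [i0|/eqP i0].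
      rewrite -/F m3F; last by rewrite lt0n; apply: contraNneq ij => j0; apply/eqP/val_inj; rewrite /= j0 i0.
      have jn := ltn_ord j; have j_gt0 : 0 < j.
        by rewrite lt0n; apply: contraNneq ij => j0; apply/eqP/val_inj; rewrite /= j0 i0.
      have n0 : 1 * n <= j * n by rewrite leq_mul2r j_gt0 orbT.
      have : j.+1 * n <= n * n by rewrite leq_mul2r jn orbT.
      rewrite mulSn => jN.
      have aF : aj + j * n < F by rewrite /F /Fp /Wp; lia.
      rewrite m2E ?m1E; try lia.
      by rewrite -[aj + j * n]addn0 -i0 Ie // e_sym.
    move: R; rewrite /rowp (negbTE i0) -/s0 => R.
    by rewrite m3E ?m2E ?m1E ?Ie //; move: R; rewrite /F /Fp; lia.
  by move: R; rewrite -/s0; move: Fge; rewrite /F; lia.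
- move=> i; have iN := ltn_ord i; rewrite inW ?Iw //.
  + by have := Wp_ge s0_aj (leq_ltn_trans (leq0n i) iN); rewrite -/s0; lia.
  + by rewrite /F /Fp; lia.
  by move=> j; apply: nrow; rewrite /F /Fp; lia.
- move=> k i kK; have iN := ltn_ord i; rewrite inE /=.
  have big : F + 2 * n <= setp n aj k + i by rewrite /setp -/F; lia.
  have n0 : 0 < n := leq_ltn_trans (leq0n i) iN.
  rewrite m4E ?m3E ?m2E ?m1E ?Io //; try by [lia | move: big; rewrite /F /Fp /Wp; lia].
  by move=> j; apply: nrow; [move: big; rewrite /F /Fp; lia | right].
by case.
Qed.

End Setup.

(** * Writing the output *)

Section Output.
Variables (n : nat) (e : rel 'I_n) (w : 'I_n -> int) (K aj kD kF : nat).
Let s0 := K * 4 + 10.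
Hypotheses (kDK : kD < K) (kFK : kF < K) (s0_aj : s0 <= aj + n) (aj_gt0 : 0 < aj).
Let O := outp n aj.

(* Registers below s0 hold the program's own data, so each of them is turned into a pointer to its final value. *)
Definition load_code N :=
  flatten [seq [:: IConst j (Posz j); IAdd j j 0; ILoad j j] | j <- iota 1 N].

Definition last_code := [:: IConst 1 0; IAdd 0 9 1] ++ load_code s0.-1 ++ [:: ILoad 0 0].

(** The result is collected at [outp], away from its destination. A loop writes the registers from
    [s0] on; those below, which include the registers of the loop, are loaded by straight-line code,
    and register 0, the pointer, comes last. *)
Definition output : block :=
  seqb (asm [:: IAdd 9 5 0; IAdd 9 9 0; IStore 9 (rS kF)])
  (seqb (forb (rI 0) (asm [:: IAdd 1 (rB kD) (rI 0); ILoad 2 1; IConst 1 1; IAdd 1 1 9;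
      IAdd 1 1 (rI 0); IStore 1 2]))
  (seqb (forb (rI 0) (seqb (asm [:: IConst 1 1; IAdd 1 1 (rI 0); IConst 2 (Posz s0); ISub 2 1 2])
      (ifneg 2 (asm [::]) (asm [:: IAdd 2 1 9; ILoad 2 2; IStore 1 2]))))
    (asm last_code))).

Definition output_time m := 3 + ((m * (6 + 6) + 3) + ((m * ((4 + (3 + 3)) + 6) + 3) + size last_code)).

Lemma load_effect m N : m 0 = Posz O -> N < s0 -> s0 <= O ->
  forall a, foldl eff m (load_code N) a = if 1 <= a <= N then m (O + a) else m a.
Proof.
move=> m0 + s0O; elim: N => [|N IH] Ns a; first by rewrite /= ifN //; lia.
have {}IH := IH (ltnW Ns).
have -> : load_code N.+1 = load_code N ++ [:: IConst N.+1 (Posz N.+1); IAdd N.+1 N.+1 0; ILoad N.+1 N.+1].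
  rewrite /load_code; have -> : iota 1 N.+1 = iota 1 N ++ [:: N.+1] by rewrite -(addn1 N) iotaD add1n addn1.
  by rewrite map_cat flatten_cat.
rewrite foldl_cat; set m1 := foldl eff m _ in IH *.
have m10 : m1 0 = Posz O by rewrite IH.
clearbody m1; rewrite /=; set m2 := upd m1 _ _.
have m2E i : i <> N.+1 -> m2 i = m1 i by exact: upd_other.
have m2N : m2 N.+1 = Posz N.+1 by exact: upd_same.
clearbody m2; rewrite m2N m2E // m10; set m3 := upd m2 _ _.
have m3N : m3 N.+1 = Posz (O + N.+1) by rewrite /m3 upd_same -PoszD addnC.
have m3E i : i <> N.+1 -> m3 i = m1 i by move=> iN; rewrite /m3 upd_other // m2E.
clearbody m3; rewrite m3N /=; have [->|aN] := eqVneq a N.+1.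
  rewrite upd_same m3E; last by lia.
  by rewrite IH ifN ?ltnSn //; lia.
rewrite upd_other ?m3E ?IH; try exact/eqP.
by congr (if _ then _ else _); lia.
Qed.

Lemma load_straight N : all straight (load_code N).
Proof. by rewrite /load_code; elim: (iota 1 N). Qed.

Lemma outputP s m : represents e w K aj s [::] m ->
  tri output m (output_time n) (fun m' => m' 0 = scal s kF /\
    forall i : 'I_n, m' i.+1 = Posz (i \in sets s kD)).
Proof.
case=> r0 r5 _ _ rb _ _ _ rs rc _ _.
have K0 := leq_ltn_trans (leq0n kD) kDK.
have Fge : s0 <= Fp n aj by exact: F_ge.
have Oge : s0 <= O by rewrite /O /outp; lia.
have nO : n <= Fp n aj by rewrite /Fp; lia.
pose v (i : 'I_n) := Posz (i \in sets s kD).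
apply: (@tri_seq _ _ _ 3); apply: tri_asm => //=.
set m1 := upd m 9 _; set m2 := upd m1 9 _; have m29 : m2 9 = Posz O.
  rewrite /m2 upd_same /m1 upd_same upd_other // r5 r0.
  by rewrite /O /outp; congr Posz; lia.
have m2E i : i <> 9 -> m2 i = m i by move=> i9; rewrite /m2 /m1 !upd_other.
clearbody m2; rewrite m29 /= m2E; last by rewrite /rS; lia.
rewrite rc //; set m3 := upd m2 O _.
have m3E i : i <> 9 -> i <> O -> m3 i = m i by move=> i9 iO; rewrite /m3 upd_other ?m2E.
have m39 : m3 9 = Posz O by rewrite /m3 upd_other ?m29 //; move: Oge; rewrite /s0; lia.
have m3O : m3 O = scal s kF by exact: upd_same.
clearbody m3.
have sO (i : 'I_n) j : j <= n -> setp n aj kD + i <> O + j.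
  by rewrite /setp /O /outp; lia.
pose I j (m' : store) := [/\ m' 0 = Posz n /\ m' 9 = Posz O, m' (rB kD) = Posz (setp n aj kD) /\ m' O = scal s kF,
  forall i : 'I_n, i < j -> m' (O + i.+1) = v i & forall i : 'I_n, m' (setp n aj kD + i) = v i].
apply: tri_seq; apply: (@tri_weaken _ _ _ _ (I n) _ _ (leqnn _)); last first.
  move=> m4 [[m40 m49] [_ m4O] m4v _].
  have {}m4v (i : 'I_n) : m4 (O + i.+1) = v i by exact: m4v.
  pose J j (m' : store) := [/\ m' 0 = Posz n, m' 9 = Posz O, m' O = scal s kF,
    forall i : 'I_n, m' (O + i.+1) = v i & forall i : 'I_n, i < j -> s0 <= i.+1 -> m' i.+1 = v i].
  apply: tri_seq; apply: (@tri_weaken _ _ _ _ (J n) _ _ (leqnn _)); last first.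
    move=> m5 [m50 m59 m5O m5v m5h]; apply: tri_asm.
      by rewrite /last_code all_cat [all _ (_ ++ _)]all_cat load_straight.
    rewrite /last_code !foldl_cat [foldl _ m5 _]/=; set m6 := upd (upd m5 1 0%R) 0 _.
    have m60 : m6 0 = Posz O by rewrite /m6 !upd_same upd_other // m59 addr0.
    have m6E i : 1 < i -> m6 i = m5 i by move=> i1; rewrite /m6 !upd_other //; lia.
    clearbody m6; have Ls : s0.-1 < s0 by rewrite /s0; lia.
    have L := load_effect m60 Ls Oge; set m7 := foldl eff m6 _ in L *.
    have m70 : m7 0 = Posz O by rewrite L.
    split=> /=.
      rewrite upd_same m70 /= L ifN; last by move: Oge; rewrite /s0; lia.
      by rewrite m6E ?m5O //; move: Oge; rewrite /s0; lia.
    move=> i; rewrite upd_other // L; case: ifP => Hi.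
      by rewrite m6E ?m5v //; move: Oge; rewrite /s0; lia.
    rewrite m6E ?m5h //; move: Hi; rewrite /s0; lia.
  apply: tri_loop => //.
    move=> j m5 m6 [m50 m59 m5O m5v m5h] H; split; rewrite ?H //; try by move: Oge; rewrite /s0 /rI; lia.
      by move=> i; rewrite H ?m5v //; move: Oge; rewrite /s0 /rI; lia.
    by move=> i ij si; rewrite H ?m5h //; move: si; rewrite /s0 /rI; lia.
  move=> a m5 m5a _ [m50 m59 m5O m5v m5h]; have an := ltn_ord a.
  apply: (@tri_seq _ _ _ 4); apply: tri_asm => //; set m6 := foldl eff m5 _.
  have m6E i : i <> 1 -> i <> 2 -> m6 i = m5 i by move=> i1 i2; rewrite /m6 /= !upd_other.
  have m61 : m6 1 = Posz a.+1.
    by rewrite /m6 /= /upd /= m5a.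
  have m62 : m6 2 = (Posz a.+1 - Posz s0)%R.
    by rewrite /m6 /= /upd /= m5a.
  clearbody m6; apply: tri_ifneg; rewrite m62.
  have m6J : [/\ m6 0 = Posz n, m6 9 = Posz O, m6 O = scal s kF &
      forall i : 'I_n, m6 (O + i.+1) = v i].
    split; rewrite ?m6E //; try by move: Oge; rewrite /s0; lia.
    by move=> i; rewrite m6E ?m5v //; move: Oge; rewrite /s0; lia.
  have [m60 m69 m6O m6v] := m6J.
  have m6h (i : 'I_n) : i < a -> s0 <= i.+1 -> m6 i.+1 = v i.
    by move=> ia si; rewrite m6E ?m5h //; move: si; rewrite /s0; lia.
  have m6a : m6 (rI 0) = Posz a by rewrite m6E.
  case: ifP => neg.
    apply: (@tri_weaken _ _ 0 _ _ _ _ (leq0n _) (fun _ H => H)); apply: tri_asm => //=.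
    split=> //; split=> // i; rewrite ltnS leq_eqVlt => /orP[/eqP ia|]; last exact: m6h.
    by rewrite ia => si; move: neg; lia.
  have sa : s0 <= a.+1 by lia.
  apply: tri_asm => //=; set m7 := upd m6 2 _.
  have m72 : m7 2 = Posz (O + a.+1) by rewrite /m7 upd_same m61 m69 -PoszD addnC.
  have m7E i : i <> 2 -> m7 i = m6 i by exact: upd_other.
  rewrite m72 /=; clearbody m7; set m8 := upd m7 2 _.
  have m82 : m8 2 = v a by rewrite /m8 upd_same m7E ?m6v //; move: Oge; rewrite /s0; lia.
  have m8E i : i <> 2 -> m8 i = m6 i by move=> i2; rewrite /m8 upd_other ?m7E.
  rewrite m82 m8E // m61 /=; clearbody m8; set m9 := upd (upd _ _ _) _ _.
  have E i : i <> 1 -> i <> 2 -> i <> a.+1 -> m9 i = m6 i.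
    by move=> i1 i2 ia; rewrite /m9 !upd_other ?m8E.
  have aO i : a.+1 <> O + i by rewrite /O /outp; lia.
  split; [by rewrite E //; move: sa; rewrite /s0 /rI; lia | by rewrite E //; lia |].
  split.
  - by rewrite E //; lia.
  - by rewrite E //; move: sa; rewrite /s0; lia.
  - by rewrite E //; [move: Oge; rewrite /s0; lia | move: Oge; rewrite /s0; lia | have := aO 0; lia].
  - by move=> i; rewrite E ?m6v //; [move: Oge; rewrite /s0; lia | move: Oge; rewrite /s0; lia | have := aO i.+1; lia].
  move=> i; rewrite ltnS leq_eqVlt => /orP[/eqP ia _|ia si].
    rewrite (val_inj ia : i = a) /m9 upd_other ?upd_same //; move: sa; rewrite /s0; lia.
  by rewrite E ?m6h //; move: si; rewrite /s0; lia.
apply: tri_loop.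
- by rewrite m3E //; move: Oge; rewrite /s0; lia.
- move=> j m4 m5 [[m40 m49] [m4b m4O] m4v m4s] H; split.
  + by rewrite !H.
  + by rewrite !H //; move: Oge; rewrite /s0 /rI /rB; lia.
  + by move=> i ij; rewrite H ?m4v //; move: Oge; rewrite /s0 /rI; lia.
  + by move=> i; rewrite H ?m4s //; rewrite /setp; move: Fge; rewrite /s0 /rI; lia.
- split=> //.
  + by split=> //; rewrite m3E //; move: Oge; rewrite /s0; lia.
  + by split=> //; rewrite m3E ?rb //; move: Oge; rewrite /s0 /rB; lia.
  + move=> i; rewrite m3E ?rs //; first by rewrite /setp; move: Fge; rewrite /s0; lia.
    by have := sO i 0 (leq0n _); rewrite addn0.
move=> a m4 m4a _ [[m40 m49] [m4b m4O] m4v m4s]; have an := ltn_ord a.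
apply: tri_asm => //=; set m5 := upd m4 1 _.
have m51 : m5 1 = Posz (setp n aj kD + a) by rewrite /m5 upd_same m4b m4a -PoszD.
have m5E i : i <> 1 -> m5 i = m4 i by exact: upd_other.
rewrite m51 /= [m5 (_ + _)]m5E ?m4s; last by rewrite /setp; move: Fge; rewrite /s0; lia.
clearbody m5; set m6 := upd m5 2 _; set m7 := upd m6 1 1%R.
have m71 : m7 1 = 1%R by exact: upd_same.
have m72 : m7 2 = v a by rewrite /m7 upd_other // /m6 upd_same.
have m7E i : i <> 1 -> i <> 2 -> m7 i = m4 i by move=> i1 i2; rewrite /m7 /m6 !upd_other ?m5E.
clearbody m7; rewrite m71 [m7 9]m7E // m49; set m8 := upd m7 1 _.
have m81 : m8 1 = Posz O.+1 by rewrite /m8 upd_same -PoszD.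
have m8E i : i <> 1 -> m8 i = m7 i by exact: upd_other.
clearbody m8; rewrite m81 [m8 (rI 0)]m8E // [m7 (rI 0)]m7E // m4a; set m9 := upd m8 1 _.
have m91 : m9 1 = Posz (O + a.+1) by rewrite /m9 upd_same -PoszD addSnnS.
have m92 : m9 2 = v a by rewrite /m9 upd_other // m8E.
have m9E i : i <> 1 -> i <> 2 -> m9 i = m4 i by move=> i1 i2; rewrite /m9 upd_other // m8E ?m7E.
clearbody m9; rewrite m91 m92 /=; set m10 := upd _ _ _.
have E i : i <> 1 -> i <> 2 -> i <> O + a.+1 -> m10 i = m4 i.
  by move=> i1 i2 ia; rewrite /m10 upd_other ?m9E.
have big i : i < s0 -> i <> O + a.+1 by move=> si; lia.
split.
- by rewrite E //; apply: big; rewrite /s0 /rI; lia.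
- by rewrite E //; apply: big; rewrite /s0; lia.
split.
- by rewrite !E //; apply: big; rewrite /s0; lia.
- split; first by rewrite E //; try apply: big; rewrite /s0 /rB; lia.
  by rewrite E //; move: Oge; rewrite /s0; lia.
- move=> i; rewrite ltnS leq_eqVlt => /orP[/eqP ia|ia].
    by rewrite (val_inj ia : i = a) /m10 upd_same.
  by rewrite E ?m4v //; move: Oge; rewrite /s0; lia.
move=> i; rewrite E ?m4s //; last exact: sO.
- by rewrite /setp; move: Fge; rewrite /s0; lia.
- by rewrite /setp; move: Fge; rewrite /s0; lia.
Qed.

End Output.

Definition top_cmd := CSeq (CMap (vA 4) (BEq 0 0)) (CSeq (CMap (vX 4) (BEq 0 0)) (solve_cmd 4)).

(** * The complete program *)

Section Program.
Variable K : nat.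
Hypotheses (K_gt0 : 0 < K) (top_wf : wfc K 0 top_cmd) (vD_lt : vD 4 < K) (fF_lt : fF 4 < K).

Definition main_code : block :=
  seqb (setup K) (seqb (ccmd 0 top_cmd) (output K (vD 4) (fF 4))).

Definition program := pre_code K ++ main_code (pos_main K) ++ [:: IHalt].

Lemma main_codeP n (e : rel 'I_n) (w : 'I_n -> int) aj m (r := solve e w 4 setT setT) :
  symmetric e -> input_at e w K aj m ->
  tri main_code m (setup_time K n + (tcmd n top_cmd + output_time K n))
    (fun m' => (m' 0 != 0%R) = r.1 /\ forall i : 'I_n, m' i.+1 = Posz (i \in r.2)).
Proof.
move=> e_sym Im; have s0_aj := in_s0 Im; have aj0 := in_aj Im.
apply: tri_seq; apply: (tri_weaken (setupP e_sym K_gt0 s0_aj aj0 Im)) => // m1 [s R1 _].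
apply: tri_seq; apply: (tri_weaken (ccmdP s0_aj (st := [::]) top_wf R1)) => // m2 R2.
apply: (tri_weaken (outputP vD_lt fF_lt s0_aj aj0 R2)) => // m3 [m30 m3v].
rewrite /top_cmd (run_seq _ _ (CMap (vA 4) _)) (run_seq _ _ (CMap (vX 4) _)) in m30 m3v.
set s2 := run _ _ _ _ (run _ _ _ _ s) in m30 m3v.
have := solve_cmdP e w 4 [::] s2.
have -> : sets s2 (vX 4) = setT by rewrite run_map; apply/setP=> a; rewrite !inE /= eqxx.
have -> : sets s2 (vA 4) = setT.
  by rewrite /s2 (@run_sets _ _ _ (CMap (vX 4) _)) // run_map; apply/setP=> a; rewrite !inE /= eqxx.
rewrite -/r => -[sD sF]; split; first by rewrite m30 sF.
by move=> i; rewrite m3v sD.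
Qed.

Lemma program_correct : exists c k, forall n (e : rel 'I_n) (w : 'I_n -> int),
  simple_graph e -> P_free 6 e ->
  let fin := exec program (c * n ^ k + c) (init_config e w) in
  halted program fin /\
  (if regs fin 0 == 0%R then ~ (exists S : {set 'I_n}, efficient_dominating e S)
   else efficient_dominating e (output_set n (regs fin)) /\
     forall S : {set 'I_n}, efficient_dominating e S ->
       (set_weight w S <= set_weight w (output_set n (regs fin)))%R).
Proof.
(* The bound of [pre_codeP], unfolded. *)
pose T0 := 2 * (K * 4 + 10) + ((K * 4 + 10) * (K * 4 + 10) + (K * 4 + 10) + 2) + 10.
pose time n := T0 + (setup_time K n + (tcmd n top_cmd + output_time K n)).
have [c [k Hck]] : poly_bounded time.
  have P := poly_tcmd top_cmd; rewrite /time /setup_time /output_time; poly.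
exists c, k => n e w [e_sym e_irr] e_P6 /=.
have plpre : placed program 0 (pre_code K) by move=> i lti; rewrite nth_cat lti.
have plmain : placed program (pos_main K) (main_code (pos_main K)).
  move=> i lti; rewrite nth_cat size_pre ifN -?leqNgt ?leq_addr // addKn.
  by rewrite nth_cat lti.
have [t1 [m1 [aj [le1 E1 Im]]]] := pre_codeP w e_irr plpre.
have [H] := main_codeP e_sym Im.
have [t2 [m2 [le2 E2 [m20 m2v]]]] := H _ _ plmain.
set p := pos_main K + _ in E2.
have halt : step program (Config p m2) = None.
  rewrite /step [pc _]/= /program nth_cat size_pre ifN -?leqNgt ?leq_addr // addKn.
  by rewrite nth_cat ltnn subnn.
have -> : exec program (c * n ^ k + c) (init_config e w) = Config p m2.
  have le : t1 + t2 <= c * n ^ k + c by apply: leq_trans (Hck n); rewrite /time leq_add.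
  rewrite -(subnKC le) exec_add exec_add E1 E2.
  (* A halted machine does not move, so the remaining fuel is harmless. *)
  by case: (_ - _) => //= f; rewrite halt.
split; first by rewrite /halted halt.
have := solve_correct e_sym e_irr e_P6 w; cbv zeta; rewrite -m20 [regs _]/=.
have -> : output_set n m2 = (solve e w 4 setT setT).2.
  by apply/setP=> i; rewrite inE m2v; case: (_ \in _).
by case: eqP.
Qed.

End Program.

(* There is a fixed RAM program running in time c * n^k + c on every
   n-vertex P6-free graph with integer vertex weights, which either outputs
   a maximum-weight efficient dominating set or correctly reports that none
   exists. *)
Theorem theorem2 :
  exists (prog : seq instr) (c k : nat),
    forall (n : nat) (e : rel 'I_n) (w : 'I_n -> int),
      simple_graph e -> P_free 6 e ->
      let fin := exec prog (c * n ^ k + c) (init_config e w) in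
      halted prog fin /\
      (if regs fin 0 == 0%R then
         ~ (exists S : {set 'I_n}, efficient_dominating e S)
       else
         efficient_dominating e (output_set n (regs fin)) /\
         forall S : {set 'I_n}, efficient_dominating e S ->
           (set_weight w S <= set_weight w (output_set n (regs fin)))%R).
Proof.
(* Five levels, 0 to 4, with five set variables each; 25 also exceeds the nesting depth. *)
have wf : wfc 25 0 top_cmd by vm_compute.
by exists (program 25); apply: (program_correct _ wf).
Qed.
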